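(* Given $\varepsilon>0$, there exists an adversarially robust streaming algorithm on insertion-only streams over $[n]$ of length $m$ with $\log m=O(\log n)$ that outputs a $(1+\varepsilon)$-approximation for $F_2$, succeeds with probability at least $\frac{2}{3}$, and uses \[O\!\left(\frac{1}{\varepsilon^2}\log n\log^4\frac{1}{\varepsilon}\left(\log\frac{1}{\varepsilon}+\log\log n\right)\right)\] bits of space.
   Context: An insertion-only stream is a sequence of updates $u_1,\dots,u_m\in[n]$; the frequency vector $f^{(t)}$ after time $t$ has $f^{(t)}_i=|\{s\le t:u_s=i\}|$. $F_2(x)=\sum_i x_i^2$. In the adversarially robust model, each update may be chosen by an adaptive adversary after seeing all previous outputs of the algorithm; the algorithm succeeds if at every time $t$ its output is a $(1+\varepsilon)$-approximation to $F_2(f^{(t)})$. *)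

(* Defs.v *)
From mathcomp Require Import all_boot all_order all_algebra.
From mathcomp Require Import reals exp.

Set Implicit Arguments.
Unset Strict Implicit.
Unset Printing Implicit Defensive.

Import Order.TTheory GRing.Theory Num.Theory.

Local Open Scope ring_scope.

Record fdist (R : realType) (T : finType) := FDist {
  fdist_fun :> T -> R;
  fdist_ge0 : forall x, 0 <= fdist_fun x;
  fdist_sum1 : \sum_x fdist_fun x = 1 }.

Definition log2 (R : realType) (x : R) : R := ln x / ln 2%:R.

(* A streaming algorithm over the universe [n] using [b] bits of space: the
   whole memory kept between two consecutive updates is a string of [b] bits.
   The steps use fresh random bits; randomness that is needed again later has
   to be kept in memory and is therefore charged to the space. *)
Record streaming_alg (R : realType) (n b : nat) := StreamingAlg {
  alg_init : fdist R (b.-tuple bool);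
  alg_step : b.-tuple bool -> 'I_n -> fdist R (b.-tuple bool);
  alg_out : b.-tuple bool -> R }.

(* Deterministic adaptive strategy: the next update as a function of the
   outputs seen so far, in chronological order; the earlier updates are then
   themselves functions of these outputs. *)
Definition strategy (R : realType) (n : nat) := seq R -> 'I_n.

(* Frequency vector of the updates [us]. *)
Definition freq (n : nat) (us : seq 'I_n) (i : 'I_n) : nat := count_mem i us.

Definition F2 (n : nat) (x : 'I_n -> nat) : nat := (\sum_(i < n) x i ^ 2)%N.

Definition approx (R : realType) (eps z y : R) : bool :=
  (1 - eps) * y <= z <= (1 + eps) * y.

Section Game.
Variables (R : realType) (n b : nat) (A : streaming_alg R n b) (m : nat).

(* [p ord0] is the initial memory, [p t] the memory after the [t]-th update. *)
Definition run := {ffun 'I_m.+1 -> b.-tuple bool}.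

(* Outputs after the updates 1, ..., t; used only for t <= m. *)
Definition outputs (p : run) (t : nat) : seq R :=
  [seq alg_out A (p (inord s)) | s <- iota 1 t].

(* The updates u_1, ..., u_t issued when the memory evolves as [p]. *)
Definition updates (adv : strategy R n) (p : run) (t : nat) : seq 'I_n :=
  [seq adv (outputs p s) | s <- iota 0 t].

Definition run_prob (adv : strategy R n) (p : run) : R :=
  alg_init A (p ord0) *
  \prod_(t < m)
    alg_step A (p (inord t)) (adv (outputs p t)) (p (inord t.+1)).

(* Correctness at every time t = 1, ..., m. *)
Definition run_correct (eps : R) (adv : strategy R n) (p : run) : bool :=
  [forall t : 'I_m,
    approx eps (alg_out A (p (inord t.+1)))
               (F2 (freq (updates adv p t.+1)))%:R].

Definition success_prob (eps : R) (adv : strategy R n) : R :=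
  \sum_(p : run | run_correct eps adv p) run_prob adv p.

(* The adversary may be randomized: it draws a private seed, independent of
   the randomness of the algorithm, that selects its adaptive strategy. *)
Definition robust (eps p : R) : Prop :=
  forall (Omega : finType) (seed : fdist R Omega)
         (adv : Omega -> strategy R n),
    p <= \sum_w seed w * success_prob eps (adv w).

End Game.

(* eps^-2 log n log^4(1/eps) (log(1/eps) + log log n). As log(1/eps) vanishes
   at eps = 1, eps is first capped at 1/2, so that for larger eps the bound is
   the one for eps = 1/2. *)
Definition space_bound (R : realType) (eps : R) (n : nat) : R :=
  let e := Num.min eps 2^-1 in
  (e ^+ 2)^-1 * log2 n%:R * (log2 e^-1) ^+ 4 *
  (log2 e^-1 + log2 (log2 n%:R)).

(* Main.v *)
Require Import Defs.
From mathcomp Require Import all_boot all_order all_algebra.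
From mathcomp Require Import reals exp.
From mathcomp Require boolp.
From mathcomp Require Import zify ring lra.

(** The exact vector of the first [N0] updates is stored, and afterwards the
    output runs through a fixed grid of values: epoch [e] consists of the [2^J]
    equally spaced values between [W 2^e] and [W 2^(e+1)], where
    [2^J = Theta(1/eps)] and [W] is F2 after [N0] updates. The adversary thus
    only learns when the output moves to the next grid value. That moment is
    detected by a binary tree of difference estimators: the node [(e, j, a)]
    compares F2 at the two ends of a dyadic block of [2^j] grid values of epoch
    [e], a root estimates F2 at the beginning of the epoch, and a telescoping
    sum over O(J) nodes gives F2 now.

    A difference estimator averages [y^2 - x^2] over sign sketches [x] and [y]
    of the stream at the two ends, and takes the median of [M] such averages.
    Since its variance is proportional to the squared norm of the difference,
    level [j] needs only [2^j / eps] rows (up to logarithms), so all levels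
    cost the same. Correctness at all times of the current block follows from a
    maximal inequality for sign sums along an insertion-only stream and a union
    over poly(1/eps) segments on which F2 is almost constant.

    Robustness: until the last grid value of its block is reached, the outputs
    do not depend on the seeds of a node. Stopping the game there leaves a
    stream that is independent of these seeds, to which the oblivious analysis
    applies. The sketches of an epoch are seeded [L = O(J)] epochs in advance,
    when the stream seen so far is still negligible, so that only [L] epochs
    are in memory at any time. *)

Set Implicit Arguments.
Unset Strict Implicit.
Unset Printing Implicit Defensive.

Import Order.TTheory GRing.Theory Num.Theory.

Local Open Scope ring_scope.

(** * Uniform expectation on finite types *)

Section Expectation.
Variable R : realType.

(** Origin of the logarithms: an estimate of F2 adds up to [J + 2] nodes and may err by a quarter of
    a grid step, so a node gets relative precision [kappa = 1 / (8 (J + 2) 2 ^ J)]. By Chebyshev's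
    inequality the number of rows is proportional to [kappa ^- 2], which accounts for [J ^ 2]; the
    levels and the [L] live epochs give the other two factors [J]. The number [M] of copies gives
    [log (1 / eps) + log log n]: the union bound runs over segments and over the nodes of
    [E = O(log n)] epochs, never over the [m] times.

    A sketch seeded late misses the inner product of the prefix with the later updates. By
    Cauchy-Schwarz its relative size is of order [2 ^ (- L / 2)], and pushing it below [kappa] makes
    [L] of order [J].

    A row must fit into [O(log n)] bits. Four-wise independent signs suffice both for the variances
    and for the maximal inequality, with seeds of [O(log n)] bits; the sketches are integers of
    absolute value at most [m].

    The storing phase makes F2 so large compared with [4 ^ J] that one update moves it by at most a
    quarter of a grid step. One move of the output per update then keeps up with F2. *)

Definition Ex (T : finType) (F : T -> R) : R := (\sum_x F x) / #|T|%:R.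

Definition Pr (T : finType) (P : pred T) : R := Ex (fun x => (P x)%:R).

Section Basic.
Variable T : finType.
Implicit Types (F G : T -> R) (P Q : pred T).

Lemma eq_Ex F G : F =1 G -> Ex F = Ex G.
Proof. by move=> FG; rewrite /Ex (eq_bigr G). Qed.

Lemma le_Ex F G : (forall x, F x <= G x) -> Ex F <= Ex G.
Proof.
by move=> FG; rewrite ler_wpM2r ?invr_ge0 ?ler0n // ler_sum.
Qed.

Lemma Ex_ge0 F : (forall x, 0 <= F x) -> 0 <= Ex F.
Proof. by move=> F0; rewrite divr_ge0 ?ler0n // sumr_ge0. Qed.

Lemma ExD F G : Ex (fun x => F x + G x) = Ex F + Ex G.
Proof. by rewrite /Ex big_split mulrDl. Qed.

Lemma ExZ c F : Ex (fun x => c * F x) = c * Ex F.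
Proof. by rewrite /Ex -mulr_sumr mulrA. Qed.

Lemma Ex_sum (I : Type) (r : seq I) (P : pred I) (F : I -> T -> R) :
  Ex (fun x => \sum_(i <- r | P i) F i x) = \sum_(i <- r | P i) Ex (F i).
Proof. by rewrite /Ex exchange_big /= mulr_suml. Qed.

Lemma Ex_cst c : (0 < #|T|)%N -> Ex (fun _ : T => c) = c.
Proof.
by move=> T0; rewrite /Ex sumr_const -(mulr_natr c) mulfK // pnatr_eq0 -lt0n.
Qed.

Lemma Ex_cst_le c : 0 <= c -> Ex (fun _ : T => c) <= c.
Proof.
move=> c0; have [T0|] := posnP #|T|; last by move=> /Ex_cst->.
by rewrite /Ex T0 invr0 mulr0.
Qed.

Lemma ExN F : Ex (fun x => - F x) = - Ex F.
Proof. by rewrite /Ex sumrN mulNr. Qed.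

Lemma Pr_ge0 P : 0 <= Pr P.
Proof. by apply: Ex_ge0 => x; rewrite ler0n. Qed.

Lemma le_Pr P Q : (forall x, P x -> Q x) -> Pr P <= Pr Q.
Proof.
move=> PQ; apply: le_Ex => x; rewrite ler_nat.
by case Px: (P x) => //; rewrite PQ.
Qed.

Lemma Pr_pred0 P : (forall x, ~~ P x) -> Pr P = 0.
Proof.
by move=> P0; rewrite /Pr /Ex big1 ?mul0r // => x _; rewrite (negPf (P0 x)).
Qed.

Lemma PrC P : (0 < #|T|)%N -> Pr P = 1 - Pr (predC P).
Proof.
move=> T0; rewrite -[X in X - _](Ex_cst _ T0) /Pr -ExN -ExD.
by apply: eq_Ex => x /=; case: (P x); rewrite ?subrr ?subr0.
Qed.

Lemma PrU P Q : Pr (fun x => P x || Q x) <= Pr P + Pr Q.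
Proof.
rewrite /Pr -ExD; apply: le_Ex => x; rewrite -natrD ler_nat.
by case: (P x); case: (Q x).
Qed.

Lemma Pr_exists (I : finType) (P : I -> pred T) :
  Pr (fun x => [exists i, P i x]) <= \sum_i Pr (P i).
Proof.
rewrite /Pr -Ex_sum; apply: le_Ex => x.
rewrite -natr_sum ler_nat; case: existsP => [[i Pi]|//].
by rewrite (bigD1 i) //= Pi.
Qed.

Lemma markov F a : (forall x, 0 <= F x) -> 0 < a ->
  Pr (fun x => a < F x) <= Ex F / a.
Proof.
move=> F0 a0; rewrite ler_pdivlMr // mulrC -ExZ; apply: le_Ex => x.
by case: ltP => [/ltW|_]; rewrite ?mulr1 // mulr0.
Qed.

End Basic.

(** Independence of the coordinates of a uniform function, by distributing the product over the
    sums. *)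
Lemma Ex_prod (I T : finType) (H : I -> T -> R) :
  Ex (fun w : {ffun I -> T} => \prod_i H i (w i)) = \prod_i Ex (H i).
Proof.
rewrite /Ex -bigA_distr_bigA /= card_ffun natrX.
rewrite big_split /= prodr_const exprVn //.
Qed.

Lemma Ex_prodin (I T : finType) (A : {set I}) (H : I -> T -> R) : (0 < #|T|)%N ->
  Ex (fun w : {ffun I -> T} => \prod_(i in A) H i (w i)) = \prod_(i in A) Ex (H i).
Proof.
move=> T0; rewrite (big_mkcond (mem A)) /=.
transitivity (Ex (fun w : {ffun I -> T} =>
   \prod_i (if i \in A then H i (w i) else 1))).
  by apply: eq_Ex => w; rewrite big_mkcond.
rewrite (Ex_prod (fun i x => if i \in A then H i x else 1)).
by apply: eq_bigr => i _; case: ifP => // _; rewrite Ex_cst.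
Qed.

Lemma Ex_coord (I T : finType) (i : I) (h : T -> R) : (0 < #|T|)%N ->
  Ex (fun w : {ffun I -> T} => h (w i)) = Ex h.
Proof.
move=> T0; have := Ex_prodin [set i] (fun=> h) T0.
by rewrite big_set1 => <-; apply: eq_Ex => w; rewrite big_set1.
Qed.

Lemma Ex_coord2 (I T : finType) (i j : I) (h g : T -> R) :
  (0 < #|T|)%N -> i != j ->
  Ex (fun w : {ffun I -> T} => h (w i) * g (w j)) = Ex h * Ex g.
Proof.
move=> T0 ij.
have := Ex_prodin [set i; j] (fun k => if k == i then h else g) T0.
rewrite big_setU1 ?inE // big_set1 eqxx eq_sym (negPf ij) => <-.
by apply: eq_Ex => w; rewrite big_setU1 ?inE // big_set1 eqxx eq_sym (negPf ij).
Qed.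

(* Second moment of a sum of independent centered terms: only the diagonal
   survives. *)
Lemma chebyshev_avg (I T : finType) (A : pred I) (X : T -> R) (l : R) :
  (0 < #|T|)%N -> (0 < #|A|)%N -> 0 < l ->
  Pr (fun w : {ffun I -> T} =>
        l < `|(\sum_(i | A i) X (w i)) / #|A|%:R - Ex X|)
  <= Ex (fun x => X x ^+ 2) / (#|A|%:R * l ^+ 2).
Proof.
move=> T0 A0 l0; set k : R := #|A|%:R; set mu := Ex X.
have k0 : 0 < k by rewrite ltr0n.
pose S (w : {ffun I -> T}) := \sum_(i | A i) (X (w i) - mu).
have ES : Ex (fun w => S w ^+ 2) <= k * Ex (fun x => X x ^+ 2).
  have -> : Ex (fun w => S w ^+ 2)
      = \sum_(i | A i) \sum_(j | A j) Ex (fun w : {ffun I -> T} =>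
           (X (w i) - mu) * (X (w j) - mu)).
    transitivity (Ex (fun w : {ffun I -> T} => \sum_(i | A i) \sum_(j | A j)
        (X (w i) - mu) * (X (w j) - mu))).
      apply: eq_Ex => w.
      by rewrite expr2 mulr_suml; apply: eq_bigr => i _; rewrite mulr_sumr.
    by rewrite Ex_sum; apply: eq_bigr => i _; rewrite Ex_sum.
  have E0 : Ex (fun x => X x - mu) = 0 by rewrite ExD Ex_cst // subrr.
  have -> : k * Ex (fun x => X x ^+ 2) = \sum_(i | A i) Ex (fun x => X x ^+ 2).
    by rewrite sumr_const mulr_natl.
  apply: ler_sum => i Ai; rewrite (bigD1 i) //= big1 ?addr0; last first.
    move=> j /andP[_ ji]; rewrite (Ex_coord2 (fun x => X x - mu) (fun x => X x - mu)) //.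
      by rewrite E0 mul0r.
    by rewrite eq_sym.
  rewrite (Ex_coord i (fun x => (X x - mu) * (X x - mu))) //.
  have -> : Ex (fun x => (X x - mu) * (X x - mu)) = Ex (fun x => X x ^+ 2) - mu ^+ 2.
    transitivity (Ex (fun x => X x ^+ 2) + (- (mu *+ 2)) * Ex X + mu ^+ 2).
      rewrite -[X in _ = _ + X](Ex_cst _ T0) -ExZ -!ExD; apply: eq_Ex => x; ring.
    rewrite -/mu; ring.
  by rewrite lerBlDr lerDl sqr_ge0.
have kl0 : 0 < (k * l) ^+ 2 by rewrite exprn_gt0 // mulr_gt0.
have -> : Ex (fun x => X x ^+ 2) / (k * l ^+ 2)
    = k * Ex (fun x => X x ^+ 2) / (k * l) ^+ 2.
  by field; rewrite !gt_eqF.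
apply: (@le_trans _ _ (Ex (fun w => S w ^+ 2) / (k * l) ^+ 2)); last first.
  by rewrite ler_wpM2r // invr_ge0 ltW.
apply: le_trans (markov _ kl0); last by move=> w; rewrite sqr_ge0.
apply: le_Pr => w; rewrite -/mu -/k => Hl.
rewrite -[S w ^+ 2]real_normK ?num_real //.
rewrite ltr_pXn2r ?nnegrE ?normr_ge0 ?(ltW (mulr_gt0 k0 l0)) //.
have -> : S w = k * ((\sum_(i | A i) X (w i)) / k - mu).
  by rewrite mulrBr mulrCA divff ?gt_eqF // mulr1 /S sumrB sumr_const mulr_natl.
by rewrite normrM (gtr0_norm k0) ltr_pM2l.
Qed.

End Expectation.

(** * Four-wise independent signs *)

(** The trivial solutions of [x + y + z + w = 0] in characteristic 2, and equally the index patterns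
    for which a product of four independent signs has mean 1. *)
Definition paired (T : eqType) (x y z w : T) : bool :=
  [|| (x == y) && (z == w), (x == z) && (y == w) | (x == w) && (y == z)].

(* Greedy choice: a new vector only has to avoid the sums of three old ones. *)
Lemma sidon_seq (d n : nat) (V := {ffun 'I_d -> bool}) : (n ^ 3 <= #|V|)%N ->
  exists s : seq V, [/\ size s = n, uniq s &
    {in s & &, forall x y z, {in s, forall w,
       x + y + z + w = 0 -> paired x y z w}}].
Proof.
have V2 (x : V) : x + x = 0 by apply/ffunP => k; rewrite !ffunE; case: (x k).
have eq0 (a b : V) : a + b = 0 -> a = b.
  by move=> ab; rewrite -[a]addr0 -(V2 b) addrA ab add0r.
elim: n => [|n IHn] Hn; first by exists [::]; split.
have n3 : (n ^ 3 < n.+1 ^ 3)%N by rewrite ltn_exp2r.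
have [s [ss us sP]] := IHn (leq_trans (ltnW n3) Hn).
pose L := [seq x + yz | x <- s, yz <- [seq y + z | y <- s, z <- s]].
have [v Lv] : exists v, v \notin L.
  apply/existsP; rewrite -negb_forall; apply/negP => /forallP LV.
  suff : (#|V| <= n ^ 3)%N by apply/negP; rewrite -ltnNge (leq_trans n3 Hn).
  rewrite (_ : (n ^ 3)%N = size L); last by rewrite !size_allpairs ss.
  by rewrite -cardsT (leq_trans _ (card_size L)) // subset_leq_card //; apply/subsetP => x _.
have nv x y z : x \in s -> y \in s -> z \in s -> v <> x + (y + z).
  move=> xs ys zs E; move/negP: Lv; apply; rewrite E.
  by apply: allpairs_f => //; apply: allpairs_f.
(* Threefold sums with repetition already cover [s] itself. *)
have vs x : x \in s -> v <> x by move=> xs E; apply: (nv x x x); rewrite // V2 addr0.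
exists (v :: s); split; rewrite /= ?ss ?us ?andbT //.
  by apply/negP => /vs.
move=> x y z; rewrite !inE => /orP Hx /orP Hy /orP Hz w; rewrite inE => /orP Hw.
(* Sixteen cases by which of the four vectors equal [v]. An odd number of occurrences makes [v] an
   old vector or a sum of three; an even number cancels and leaves an equation between the
   others. *)
case: Hx => [/eqP->|xs]; case: Hy => [/eqP->|ys]; case: Hz => [/eqP->|zs];
  case: Hw => [/eqP->|ws]; rewrite /paired ?eqxx ?orbT //= => H.
- by rewrite V2 add0r in H; case: (vs _ ws); exact: eq0.
- by rewrite V2 add0r addrC in H; case: (vs _ zs); exact: eq0.
- by rewrite V2 add0r in H; rewrite (eq0 _ _ H) eqxx ?orbT.
- case: (vs _ ys); apply: eq0.
  by rewrite -H [RHS](ACl ((1*3)*(4*2))) /= V2 add0r.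
- have : y + w = 0 by rewrite -H [RHS](ACl ((1*3)*(2*4))) /= V2 add0r.
  by move/eq0->; rewrite eqxx ?orbT.
- have : y + z = 0 by rewrite -H [RHS](ACl ((1*4)*(2*3))) /= V2 add0r.
  by move/eq0->; rewrite eqxx ?orbT.
- by case: (nv _ _ _ ys zs ws); apply: eq0; rewrite -H !addrA.
- case: (vs _ xs); apply: eq0.
  by rewrite -H [RHS](ACl ((2*3)*(4*1))) /= V2 add0r.
- have : x + w = 0 by rewrite -H [RHS](ACl ((2*3)*(1*4))) /= V2 add0r.
  by move/eq0->; rewrite eqxx ?orbT.
- have : x + z = 0 by rewrite -H [RHS](ACl ((2*4)*(1*3))) /= V2 add0r.
  by move/eq0->; rewrite eqxx ?orbT.
- by case: (nv _ _ _ xs zs ws); apply: eq0; rewrite -H [RHS](ACl (2*(1*(3*4)))) /= !addrA.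
- have : x + y = 0 by rewrite -H [RHS](ACl ((3*4)*(1*2))) /= V2 add0r.
  by move/eq0->; rewrite eqxx ?orbT.
- by case: (nv _ _ _ xs ys ws); apply: eq0; rewrite -H [RHS](ACl (3*(1*(2*4)))) /= !addrA.
- by case: (nv _ _ _ xs ys zs); apply: eq0; rewrite -H [RHS](ACl (4*(1*(2*3)))) /= !addrA.
- by apply: (sP x y z).
Qed.

Section Signs.
Variables (R : realType) (d : nat).
Let V := {ffun 'I_d -> bool}.

Definition chi (b x : V) : R := \prod_k (if b k && x k then -1 else 1).

Lemma chiD b x y : chi b (x + y) = chi b x * chi b y.
Proof.
rewrite /chi -big_split; apply: eq_bigr => k _ /=; rewrite ffunE.
by case: (b k); case: (x k); case: (y k) => /=; rewrite ?mulr1 ?mulrNN ?mul1r.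
Qed.

Lemma chi_pm b x : chi b x = 1 \/ chi b x = -1.
Proof.
rewrite /chi; apply: (big_ind (fun v : R => v = 1 \/ v = -1)) => [|x1 x2 [->|->] [->|->]|i _]; auto.
- by left; rewrite mulr1.
- by right; rewrite mul1r.
- by right; rewrite mulr1.
- by left; rewrite mulrNN mulr1.
by case: ifP; auto.
Qed.

(** Orthogonality of the characters of the group of bit vectors: any coordinate [k] with [x k]
    contributes the factor [(1 - 1) / 2]. *)
Lemma Ex_chi x : Ex (chi^~ x) = (x == 0)%:R.
Proof.
rewrite /chi (Ex_prod (fun k (c : bool) => if c && x k then -1 else 1 : R)).
case: eqP => [->|/eqP x0].
  apply: big1 => k _; rewrite ffunE /Ex.
  by rewrite (eq_bigr (fun=> 1)) => [|c _]; rewrite ?andbF // sumr_const divff // pnatr_eq0 card_bool.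
have [k xk] : exists k, x k.
  apply/existsP; apply: contraR x0; rewrite negb_exists => /forallP x0.
  by apply/eqP/ffunP => k; rewrite ffunE (negPf (x0 k)).
by rewrite (bigD1 k) //= /Ex big_bool xk /= addNr mul0r mul0r.
Qed.

End Signs.

(** The sign of [i] is the character value at the [i]-th vector of a Sidon sequence. A product of
    four signs is then one character at the sum of four vectors, and this sum vanishes only for
    paired indices. *)
Lemma exists_signs (R : realType) (n d : nat) : (n ^ 3 <= 2 ^ d)%N ->
  exists sg : {ffun 'I_d -> bool} -> 'I_n -> R,
    (forall b i, sg b i = 1 \/ sg b i = -1) /\
    (forall i j k l, Ex (fun b => sg b i * sg b j * sg b k * sg b l)
                     = (paired i j k l)%:R).
Proof.
move=> nd; have V2 (x : {ffun 'I_d -> bool}) : x + x = 0.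
  by apply/ffunP => k; rewrite !ffunE; case: (x k).
have [|s [ss us sP]] := @sidon_seq d n.
  by rewrite card_ffun card_bool card_ord.
pose a (i : 'I_n) := nth 0 s i.
have a_in i : a i \in s by rewrite mem_nth // ss.
have a_eq i j : (a i == a j) = (i == j) by rewrite nth_uniq ?ss.
exists (fun b i => chi R b (a i)); split=> [b i|i j k l]; first exact: chi_pm.
rewrite (eq_Ex (G := fun b => chi R b (a i + a j + a k + a l))) => [|b]; last first.
  by rewrite !chiD.
rewrite Ex_chi; congr (nat_of_bool _)%:R; apply/eqP/idP => [|].
  by move/(sP (a i) (a j) (a k)); rewrite /paired !a_eq; apply; exact: a_in.
case/or3P => /andP[/eqP-> /eqP->].
- by rewrite V2 add0r V2.
- by rewrite [LHS](ACl ((1*3)*(2*4))) /= !V2.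
- by rewrite [LHS](ACl ((1*4)*(2*3))) /= !V2.
Qed.

(** * Moments and a maximal inequality *)

Lemma crossing (P : pred nat) (T t : nat) : (T < t)%N -> ~~ P T -> P t ->
  exists c, [/\ (T <= c < t)%N, ~~ P c & P c.+1].
Proof.
move=> Tt PT; rewrite -(subnKC Tt); elim: (t - T.+1)%N => [|k IHk].
  by rewrite addn0 => PT1; exists T; split; rewrite ?leqnn.
case Pk: (P (T.+1 + k)%N) => Pk1.
  by have [c [/andP[c1 c2] c3 c4]] := IHk Pk; exists c; split => //; lia.
by exists (T.+1 + k)%N; split; rewrite ?Pk -?addnS //; lia.
Qed.

(** The split [(x + y) ^ 2 <= 9 x ^ 2 + 9/8 y ^ 2] applied twice, with [9 ^ 3 = 729] and
    [(9/8) ^ 3 < 3/2]. The weights are lopsided because only the coefficient of [y ^ 4] is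
    multiplied along the recursion. *)
Lemma quartic_split (R : realType) (x y z : R) :
  0 <= x -> 0 <= y -> 0 <= z -> z <= x + y -> z ^+ 4 <= 729 * x ^+ 4 + 3 / 2 * y ^+ 4.
Proof.
move=> x0 y0 z0 zxy.
have z2 : z ^+ 2 <= 9 * x ^+ 2 + 9 / 8 * y ^+ 2.
  apply: (@le_trans _ _ ((x + y) ^+ 2)); first by rewrite lerXn2r ?nnegrE ?addr_ge0.
  have := sqr_ge0 (8 * x - y); lra.
apply: (@le_trans _ _ ((9 * x ^+ 2 + 9 / 8 * y ^+ 2) ^+ 2)).
  rewrite (_ : z ^+ 4 = (z ^+ 2) ^+ 2); last by rewrite -exprM.
  rewrite lerXn2r ?nnegrE ?sqr_ge0 //.
  by rewrite addr_ge0 ?mulr_ge0 ?sqr_ge0 //; lra.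
have := sqr_ge0 (64 * x ^+ 2 - y ^+ 2).
have : 0 <= y ^+ 4 by rewrite exprn_ge0.
have -> : x ^+ 4 = (x ^+ 2) ^+ 2 by rewrite -exprM.
have -> : y ^+ 4 = (y ^+ 2) ^+ 2 by rewrite -exprM.
lra.
Qed.

(** A constant [C] closes the recursion as soon as [729 * 3 + 3/4 C <= C], that is [C >= 8748];
    hence 10000. *)
Lemma quartic_recursion (R : realType) (M x y1 y2 : R) :
  0 <= x <= M -> 0 <= y1 <= M / 2 -> 0 <= y2 <= M / 2 ->
  729 * (3 * (x * x)) + 3 / 2 * (10000 * y1 ^+ 2) + 3 / 2 * (10000 * y2 ^+ 2)
    <= 10000 * M ^+ 2.
Proof.
move=> /andP[x0 h3] /andP[y10 h1] /andP[y20 h2].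
have h4 : x * x <= M * M by apply: ler_pM.
have h5 : y1 * y1 <= M / 2 * (M / 2) by apply: ler_pM.
have h6 : y2 * y2 <= M / 2 * (M / 2) by apply: ler_pM.
have := sqr_ge0 M; rewrite !expr2; lra.
Qed.

Lemma quartic_max_split (R : realType) (x y1 y2 z : R) :
  0 <= x -> 0 <= y1 -> 0 <= y2 -> 0 <= z -> z <= x + Num.max y1 y2 ->
  z ^+ 4 <= 729 * x ^+ 4 + 3 / 2 * y1 ^+ 4 + 3 / 2 * y2 ^+ 4.
Proof.
move=> x0 y10 y20 z0; have := exprn_ge0 4 y10; have := exprn_ge0 4 y20.
rewrite /Num.max; case: ifP => _ h1 h2.
  by move=> /(quartic_split x0 y20 z0); lra.
by move=> /(quartic_split x0 y10 z0); lra.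
Qed.

Section Vectors.
Variables (R : realType) (n : nat).
Implicit Types v w : 'I_n -> R.

Definition ip v w : R := \sum_i v i * w i.
Definition N2 v : R := \sum_i v i ^+ 2.

Lemma N2_ge0 v : 0 <= N2 v.
Proof. by apply: sumr_ge0 => i _; rewrite sqr_ge0. Qed.

Lemma ip_ge0 v w : (forall i, 0 <= v i) -> (forall i, 0 <= w i) -> 0 <= ip v w.
Proof. by move=> v0 w0; apply: sumr_ge0 => i _; rewrite mulr_ge0. Qed.

Lemma eq_N2 v w : v =1 w -> N2 v = N2 w.
Proof. by move=> vw; apply: eq_bigr => i _; rewrite vw. Qed.

Lemma N2D v w : N2 (fun i => v i + w i) = N2 v + 2 * ip v w + N2 w.
Proof.
rewrite /N2 /ip mulr_sumr -!big_split; apply: eq_bigr => i _ /=; ring.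
Qed.

Lemma sum_delta (F : 'I_n -> R) i : \sum_j F j * (i == j)%:R = F i.
Proof.
rewrite (bigD1 i) //= eqxx mulr1 big1 ?addr0 // => j ji.
by rewrite eq_sym (negPf ji) mulr0.
Qed.

Lemma cauchy_schwarz v w : ip v w ^+ 2 <= N2 v * N2 w.
Proof.
have E1 : ip v w ^+ 2 = \sum_i \sum_j v i * w i * (v j * w j).
  by rewrite expr2 /ip mulr_suml; apply: eq_bigr => i _; rewrite mulr_sumr.
have E2 : N2 v * N2 w = \sum_i \sum_j v i ^+ 2 * w j ^+ 2.
  by rewrite /N2 mulr_suml; apply: eq_bigr => i _; rewrite mulr_sumr.
have E3 : N2 v * N2 w = \sum_i \sum_j v j ^+ 2 * w i ^+ 2.
  by rewrite E2 exchange_big.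
rewrite -(ler_pM2l (ltr0Sn R 1)) [X in _ <= X](_ : _ = N2 v * N2 w + N2 v * N2 w); last by ring.
rewrite {1}E2 E3 E1 -big_split mulr_sumr; apply: ler_sum => i _ /=.
rewrite -big_split mulr_sumr; apply: ler_sum => j _ /=.
rewrite -subr_ge0 (_ : _ - _ = (v i * w j - v j * w i) ^+ 2) ?sqr_ge0 //; ring.
Qed.

Variables (Sd : finType) (sg : Sd -> 'I_n -> R).
Hypothesis Sd_gt0 : (0 < #|Sd|)%N.
Hypothesis sg_pm : forall b i, sg b i = 1 \/ sg b i = -1.
Hypothesis sg4 : forall i j k l,
  Ex (fun b => sg b i * sg b j * sg b k * sg b l) = (paired i j k l)%:R.

Definition dot (b : Sd) v : R := \sum_i sg b i * v i.

Lemma eq_dot b v w : v =1 w -> dot b v = dot b w.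
Proof. by move=> vw; apply: eq_bigr => i _; rewrite vw. Qed.

Lemma dotD b v w : dot b (fun i => v i + w i) = dot b v + dot b w.
Proof. by rewrite /dot -big_split; apply: eq_bigr => i _; rewrite mulrDr. Qed.

Lemma Ex_dot2 v w : Ex (fun b => dot b v * dot b w) = ip v w.
Proof.
have sg2 i j : Ex (fun b => sg b i * sg b j) = (i == j)%:R.
  (* Second moments come out of the fourfold hypothesis by inserting [sg b i ^ 2 = 1]. *)
  transitivity (Ex (fun b => sg b i * sg b j * sg b i * sg b i)).
    by apply: eq_Ex => b; case: (sg_pm b i) => ->; rewrite ?mulr1 // mulrN1 mulrN1 opprK.
  rewrite sg4 /paired eqxx andbT; congr (nat_of_bool _)%:R.
  by rewrite (eq_sym j i) orbb /= orbb.
transitivity (\sum_i \sum_j v i * w j * Ex (fun b => sg b i * sg b j)).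
  transitivity (Ex (fun b => \sum_i \sum_j v i * w j * (sg b i * sg b j))).
    apply: eq_Ex => b; rewrite mulr_suml; apply: eq_bigr => i _.
    by rewrite mulr_sumr; apply: eq_bigr => j _; ring.
  rewrite Ex_sum; apply: eq_bigr => i _; rewrite Ex_sum; apply: eq_bigr => j _.
  by rewrite ExZ.
apply: eq_bigr => i _; under eq_bigr do rewrite sg2.
by rewrite sum_delta.
Qed.

(** The three pairings contribute [N2 v * N2 w] and twice [ip v w ^ 2]. As all coefficients are
    nonnegative, the indicator of [paired] may be replaced by the sum of the three indicators. *)
Lemma Ex_dot4 v w : (forall i, 0 <= v i) -> (forall i, 0 <= w i) ->
  Ex (fun b => dot b v ^+ 2 * dot b w ^+ 2) <= 3 * (N2 v * N2 w).
Proof.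
move=> v0 w0.
pose c i j k l := v i * v j * w k * w l.
have -> : Ex (fun b => dot b v ^+ 2 * dot b w ^+ 2)
    = \sum_i \sum_j \sum_k \sum_l c i j k l * (paired i j k l)%:R.
  transitivity (Ex (fun b => \sum_i \sum_j \sum_k \sum_l
      c i j k l * (sg b i * sg b j * sg b k * sg b l))).
    apply: eq_Ex => b; rewrite !expr2 /dot -mulrA mulr_suml.
    apply: eq_bigr => i _; rewrite mulr_suml mulr_sumr.
    apply: eq_bigr => j _; rewrite mulr_suml !mulr_sumr.
    apply: eq_bigr => k _; rewrite !mulr_sumr.
    apply: eq_bigr => l _; rewrite /c; ring.
  do 4!(rewrite Ex_sum; apply: eq_bigr => ? _).
  by rewrite ExZ sg4.
have -> : 3 * (N2 v * N2 w) = N2 v * N2 w + N2 v * N2 w + N2 v * N2 w by ring.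
apply: (@le_trans _ _ (N2 v * N2 w + ip v w ^+ 2 + ip v w ^+ 2)); last first.
  by rewrite !lerD // cauchy_schwarz.
have -> : N2 v * N2 w =
    \sum_i \sum_j \sum_k \sum_l c i j k l * ((i == j)%:R * (k == l)%:R).
  rewrite /N2 mulr_suml; apply: eq_bigr => i _; rewrite mulr_sumr.
  rewrite exchange_big /=; apply: eq_bigr => k _.
  transitivity (\sum_j v i * v j * w k * w k * (i == j)%:R).
    by rewrite (sum_delta (fun j => v i * v j * w k * w k)); ring.
  apply: eq_bigr => j _; transitivity (\sum_l v i * v j * w k * w l * (i == j)%:R * (k == l)%:R).
    by rewrite (sum_delta (fun l => v i * v j * w k * w l * (i == j)%:R)).
  by apply: eq_bigr => l _; rewrite /c; ring.
have E2 (i j : 'I_n) : v i * v j * w i * w j =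
    \sum_k \sum_l c i j k l * ((i == k)%:R * (j == l)%:R).
  transitivity (\sum_k v i * v j * w k * w j * (i == k)%:R).
    by rewrite (sum_delta (fun k => v i * v j * w k * w j)).
  apply: eq_bigr => k _; transitivity (\sum_l v i * v j * w k * w l * (i == k)%:R * (j == l)%:R).
    by rewrite (sum_delta (fun l => v i * v j * w k * w l * (i == k)%:R)).
  by apply: eq_bigr => l _; rewrite /c; ring.
have E3 (i j : 'I_n) : v i * v j * w i * w j =
    \sum_k \sum_l c i j k l * ((i == l)%:R * (j == k)%:R).
  rewrite E2 exchange_big /=; apply: eq_bigr => k _; apply: eq_bigr => l _.
  by rewrite /c; ring.
have E1 : ip v w ^+ 2 = \sum_i \sum_j v i * v j * w i * w j.
  rewrite expr2 /ip mulr_suml; apply: eq_bigr => i _; rewrite mulr_sumr.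
  by apply: eq_bigr => j _; ring.
rewrite {1}E1 (eq_bigr _ (fun i _ => eq_bigr _ (fun j _ => E2 i j))).
rewrite E1 (eq_bigr _ (fun i _ => eq_bigr _ (fun j _ => E3 i j))).
rewrite -!big_split; apply: ler_sum => i _ /=.
rewrite -!big_split; apply: ler_sum => j _ /=.
rewrite -!big_split; apply: ler_sum => k _ /=.
rewrite -!big_split; apply: ler_sum => l _ /=.
rewrite -!mulrDr ler_wpM2l ?mulr_ge0 // /paired.
by rewrite -!natrM -!natrD ler_nat; case: (i == j); case: (k == l);
  case: (i == k); case: (j == l); case: (i == l); case: (j == k).
Qed.

(** * Prefix sums along an insertion-only stream and their maximum *)

Section Stream.
Variable us : nat -> 'I_n.

Definition cnt T t : 'I_n -> R := fun i => (\sum_(T <= s < t) (us s == i))%:R.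

Lemma cnt_ge0 T t i : 0 <= cnt T t i.
Proof. exact: ler0n. Qed.

Lemma cnt_id T t : (t <= T)%N -> cnt T t =1 fun=> 0.
Proof. by move=> tT i; rewrite /cnt big_geq. Qed.

Lemma cntD T c t : (T <= c <= t)%N -> cnt T t =1 fun i => cnt T c i + cnt c t i.
Proof. by move=> /andP[Tc ct] i; rewrite /cnt (big_cat_nat Tc ct) natrD. Qed.

Lemma N2_cnt_id T t : (t <= T)%N -> N2 (cnt T t) = 0.
Proof.
by move=> tT; rewrite /N2 big1 // => i _; rewrite cnt_id // expr0n.
Qed.

Lemma N2_cntD T c t : (T <= c <= t)%N ->
  N2 (cnt T t) = N2 (cnt T c) + 2 * ip (cnt T c) (cnt c t) + N2 (cnt c t).
Proof. by move=> Tct; rewrite (eq_N2 (cntD Tct)) N2D. Qed.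

Lemma N2_cnt_add T c t : (T <= c <= t)%N ->
  N2 (cnt T c) + N2 (cnt c t) <= N2 (cnt T t).
Proof.
move=> Tct; rewrite (N2_cntD Tct) lerD2r lerDl mulr_ge0 //.
exact: ip_ge0 (cnt_ge0 _ _) (cnt_ge0 _ _).
Qed.

Lemma le_N2_cnt T t t' : (t <= t')%N -> N2 (cnt T t) <= N2 (cnt T t').
Proof.
move=> tt'; have [tT|Tt] := leqP t T; first by rewrite N2_cnt_id // N2_ge0.
apply: le_trans (@N2_cnt_add T t t' _); last by rewrite (ltnW Tt).
by rewrite lerDl N2_ge0.
Qed.

Lemma N2_cnt_gt0 T t : (T < t)%N -> 0 < N2 (cnt T t).
Proof.
move=> Tt; rewrite lt_neqAle N2_ge0 andbT eq_sym psumr_neq0.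
  apply/hasP; exists (us T); rewrite ?mem_index_enum //= exprn_gt0 //.
  by rewrite ltr0n big_ltn // eqxx.
by move=> i _; rewrite sqr_ge0.
Qed.

Definition mx b T t : R := \big[Num.max/0]_(T <= c < t.+1) `|dot b (cnt T c)|.

Lemma mx_ge0 b T t : 0 <= mx b T t.
Proof. by rewrite /mx; elim/big_rec: _ => // i x _ x0; rewrite le_max x0 orbT. Qed.

Lemma le_mx b T c t : (T <= c <= t)%N -> `|dot b (cnt T c)| <= mx b T t.
Proof.
move=> Tct; rewrite /mx; apply: (@le_bigmax_seq _ _ _ _ _ c xpredT (fun c => `|dot b (cnt T c)|)) => //.
by rewrite mem_index_iota ltnS.
Qed.

Lemma mx_split b T c t : (T <= c < t)%N ->
  mx b T t <= `|dot b (cnt T c.+1)| + Num.max (mx b T c) (mx b c.+1 t).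
Proof.
move=> /andP[Tc ct]; rewrite {1}/mx big_seq_cond.
apply: bigmax_le => [|r]; first by rewrite addr_ge0 // le_max mx_ge0.
rewrite mem_index_iota ltnS andbT => /andP[Tr rt].
have [rc|cr] := leqP r c.
  by apply: ler_wpDl; rewrite // le_max le_mx // Tr.
rewrite (eq_dot _ (@cntD T c.+1 r _)) ?cr ?andbT ?leqW // dotD.
rewrite (le_trans (ler_normD _ _)) // lerD2l le_max orbC le_mx //.
by rewrite cr.
Qed.

(* Splitting the interval at half of its mass halves both summands of the
   recursion, which beats the constant 3/2 < 2 in front of them. *)
Lemma Ex_mx4 T t : Ex (fun b => mx b T t ^+ 4) <= 10000 * N2 (cnt T t) ^+ 2.
Proof.
have [N] := ubnP (t - T); elim: N => // N IH in T t *.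
rewrite ltnS => tTN.
have [tT|Tt] := leqP t T.
  rewrite N2_cnt_id // expr0n mulr0 /Ex.
  rewrite big1 ?mul0r // => b _.
  rewrite (_ : mx b T t = 0) ?expr0n //; apply/le_anti; rewrite mx_ge0 andbT.
  rewrite /mx big_seq_cond; apply: bigmax_le => // r.
  rewrite mem_index_iota ltnS andbT => /andP[Tr rt].
  rewrite (eq_dot _ (cnt_id (leq_trans rt tT))) /dot big1 ?normr0 // => i _.
  by rewrite mulr0.
set M := N2 (cnt T t); have M0 : 0 < M by apply: N2_cnt_gt0.
(* The update at [c] crosses half of the mass, so that the stretches before and after it carry at
   most [M / 2] each, the latter because squared norms of nonnegative vectors are superadditive. *)
have [|||c [/andP[Tc ct] Mc1 Mc]] := @crossing (fun c => M / 2 < N2 (cnt T c)) T t => //.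
- by rewrite N2_cnt_id // -leNgt divr_ge0 // ltW.
- by rewrite ltr_pdivrMr // -/M ltr_pMr // ltr1n.
rewrite -leNgt in Mc1.
have [l1 l2] : (c - T < N)%N /\ (t - c.+1 < N)%N by clear - Tc ct tTN; lia.
have Mc2 : N2 (cnt c.+1 t) <= M / 2.
  have : N2 (cnt T c.+1) + N2 (cnt c.+1 t) <= M by apply: N2_cnt_add; rewrite leqW.
  by lra.
have Mc3 : N2 (cnt T c.+1) <= M by apply: le_N2_cnt.
have H1 : Ex (fun b => mx b T t ^+ 4) <=
    729 * (3 * (N2 (cnt T c.+1) * N2 (cnt T c.+1))) +
    3 / 2 * (10000 * N2 (cnt T c) ^+ 2) + 3 / 2 * (10000 * N2 (cnt c.+1 t) ^+ 2).
  apply: (@le_trans _ _ (729 * Ex (fun b => dot b (cnt T c.+1) ^+ 2 * dot b (cnt T c.+1) ^+ 2)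
     + 3 / 2 * Ex (fun b => mx b T c ^+ 4) + 3 / 2 * Ex (fun b => mx b c.+1 t ^+ 4))); last first.
    apply: lerD; last by apply: ler_wpM2l; [exact: divr_ge0|exact: IH].
    apply: lerD; last by apply: ler_wpM2l; [exact: divr_ge0|exact: IH].
    by apply: ler_wpM2l => //; apply: Ex_dot4 => i; exact: cnt_ge0.
  rewrite -!ExZ -!ExD; apply: le_Ex => b.
  have := @mx_split b T c t; rewrite Tc ct => /(_ isT).
  rewrite -(real_normK (num_real (dot b (cnt T c.+1)))) -exprD.
  by apply: quartic_max_split; rewrite ?mx_ge0.
apply: (le_trans H1).
by apply: quartic_recursion; rewrite N2_ge0.
Qed.

Lemma Ex_mx2 T t : Ex (fun b => mx b T t ^+ 2) <= 100 * N2 (cnt T t).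
Proof.
set mu := Ex _.
have mu0 : 0 <= mu by apply: Ex_ge0 => b; rewrite sqr_ge0.
rewrite -(@ler_pXn2r _ 2) ?nnegrE //; last by rewrite mulr_ge0 ?N2_ge0.
apply: (@le_trans _ _ (Ex (fun b => mx b T t ^+ 4))); last first.
  by rewrite (le_trans (Ex_mx4 T t)) // exprMn; lra.
(* Jensen's inequality, as nonnegativity of the variance of [mx ^ 2]. *)
have : 0 <= Ex (fun b => (mx b T t ^+ 2 - mu) ^+ 2) by apply: Ex_ge0 => b; rewrite sqr_ge0.
have -> : Ex (fun b => (mx b T t ^+ 2 - mu) ^+ 2)
   = Ex (fun b => mx b T t ^+ 4) + (- (2 * mu)) * mu + mu ^+ 2.
  transitivity (Ex (fun b => mx b T t ^+ 4 + - (2 * mu) * mx b T t ^+ 2 + mu ^+ 2)).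
    by apply: eq_Ex => b; ring.
  by rewrite !ExD ExZ Ex_cst.
by rewrite expr2; lra.
Qed.

End Stream.
End Vectors.

(** * Difference estimators *)

Section Median.
Variables (R : realType) (M : nat).
Implicit Type f : 'I_M -> R.

Definition upper_half f (i : 'I_M) : bool := (M < 2 * #|[pred j | (f i <= f j)%R]|)%N.

(* The largest value reached by more than half of the entries; [0] if [M = 0]. *)
Definition median f : R :=
  if [pick i | upper_half f i && [forall j, upper_half f j ==> (f j <= f i)]]
  is Some i then f i else 0.

(** Two majorities intersect. The least value inside the interval is reached by a majority, hence is
    at most the median; and the majority at or above the median shares an index with the majority
    inside the interval. *)
Lemma median_itv f (lo hi : R) :
  (M < 2 * #|[pred j | (lo <= f j <= hi)%R]|)%N -> lo <= median f <= hi.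
Proof.
set P := [pred j | _]; move=> HP.
have [i0 Pi0] : exists i, P i.
  apply/existsP; apply: contraLR HP; rewrite negb_exists => /forallP P0.
  by rewrite eq_card0 ?muln0 // => i; apply/negbTE/P0.
have [i Pi imin] : exists2 i, P i & forall j, P j -> f i <= f j.
  by case: (arg_minP f Pi0) => i Pi Hi; exists i.
have ui : upper_half f i.
  apply: (leq_trans HP); rewrite leq_mul2l; apply: subset_leq_card.
  by apply/subsetP => j; rewrite !inE => /imin.
rewrite /median; case: pickP => [k /andP[uk /forallP kmax]|none]; last first.
  have [k uk kmax] : exists2 k, upper_half f k & forall j, upper_half f j -> f j <= f k.
    by case: (arg_maxP f ui) => k uk Hk; exists k.
  by have := none k; rewrite uk /= => /forallP[] j; apply/implyP/kmax.
apply/andP; split.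
  apply: (le_trans _ (implyP (kmax i) ui)).
  by have := Pi; rewrite inE => /andP[].
have [j /andP[kj Pj]] : exists j, (f k <= f j) && P j.
  apply/existsP; apply: contraT; rewrite negb_exists => /forallP N.
  have := cardUI [pred j | f k <= f j] P.
  rewrite [#|predI _ _|]eq_card0 ?addn0; last by move=> j; apply/negbTE/N.
  have := max_card (predU [pred j | f k <= f j] P); rewrite card_ord.
  move: uk HP; rewrite /upper_half.
  by move: #|_| #|P| #|predU _ _| => u v w; clear; lia.
by apply: (le_trans kj); move: Pj; rewrite inE => /andP[].
Qed.

(* There are at most 2^M sets of bad copies, each of probability at most
   16^(-M/2). *)
Lemma Pr_half_bad (T : finType) (bad : pred T) : (0 < #|T|)%N ->
  Pr R bad <= 16^-1 ->
  Pr R (fun w : {ffun 'I_M -> T} => (M <= 2 * #|[pred c | bad (w c)]|)%N)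
  <= 2^-1 ^+ M.
Proof.
move=> T0 Hbad.
pose P (S : {set 'I_M}) (w : {ffun 'I_M -> T}) :=
  (M <= 2 * #|S|)%N && [forall (c | c \in S), bad (w c)].
apply: (@le_trans _ _ (Pr R (fun w => [exists S, P S w]))).
  apply: le_Pr => w Hw; apply/existsP; exists [set c | bad (w c)].
  rewrite /P cardsE Hw; apply/forallP => c; apply/implyP; by rewrite inE.
apply: (le_trans (Pr_exists _ _)).
apply: (@le_trans _ _ (\sum_(S : {set 'I_M}) 4^-1 ^+ M)); last first.
  rewrite sumr_const -cardsT -powersetT card_powerset cardsT card_ord.
  rewrite -(mulr_natl (4^-1 ^+ M)) natrX -exprMn.
  by rewrite (_ : 2 * 4^-1 = 2^-1) //; field.
apply: ler_sum => S _; rewrite /P.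
case: leqP => HS /=; last by rewrite Pr_pred0 ?exprn_ge0 // invr_ge0.
have -> : Pr R (fun w : {ffun 'I_M -> T} => [forall (c | c \in S), bad (w c)])
   = Ex (fun w : {ffun 'I_M -> T} => \prod_(c in S) (bad (w c))%:R).
  apply: eq_Ex => w; case: forallP => [H|/forallP].
    by rewrite big1 // => c cS; have := H c; rewrite cS /= => ->.
  rewrite negb_forall => /existsP[c]; rewrite negb_imply => /andP[cS /negPf bc].
  by rewrite (bigD1 c) //= bc mul0r.
rewrite (Ex_prodin S (fun _ x => (bad x)%:R)) //.
apply: (@le_trans _ _ (\prod_(c in S) 16^-1)).
  by apply: ler_prod => c _; rewrite Hbad andbT Pr_ge0.
rewrite prodr_const (_ : 16^-1 = 4^-1 ^+ 2 :> R); last by field.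
by rewrite -exprM ler_wiXn2l // ?invr_ge0 // invf_le1 // ler1n.
Qed.

End Median.

(** Source of the factor [2 ^ 15] between [eta] and [kappa]: one half of [X] pays for the error at
    the start of a segment, the other half, at least [2 ^ 14 * Y], for the drift of estimate and
    truth along it. *)
Lemma three_errors (R : realType) (x y z X Y : R) :
  `|x| <= X / 2 -> `|y| <= 9792 * Y -> 0 <= z <= Y -> 2 ^+ 15 * Y <= X ->
  `|x + y - z| <= X.
Proof.
move=> xX yY /andP[z0 zY] YX.
apply: (le_trans (ler_normB _ _)); rewrite (ger0_norm z0).
have Y0 : 0 <= Y := le_trans z0 zY.
have c : 9792 + 1 <= 2 ^+ 14 :> R by rewrite natr1 -natrX ler_nat; vm_compute.
have X2 : 2 ^+ 14 * Y <= X / 2 by rewrite ler_pdivlMr // mulrAC -exprSr.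
rewrite [leRHS](splitr X) (le_trans (lerD (ler_normD x y) zY)) // -addrA lerD //.
rewrite (le_trans (lerD yY (lexx Y))) // (le_trans _ X2) //.
by rewrite -[X in _ + X]mul1r -mulrDl ler_wpM2r.
Qed.

Lemma am_gm_norm (R : realType) (c x y : R) : 0 < c ->
  `|2 * x * y| <= c^-1 * x ^+ 2 + c * y ^+ 2.
Proof.
move=> c0; have cn0 := lt0r_neq0 c0.
have p1 : 0 <= c^-1 * (x - c * y) ^+ 2 by rewrite mulr_ge0 ?sqr_ge0 // invr_ge0 ltW.
have p2 : 0 <= c^-1 * (x + c * y) ^+ 2 by rewrite mulr_ge0 ?sqr_ge0 // invr_ge0 ltW.
have e1 : c^-1 * (x - c * y) ^+ 2 = c^-1 * x ^+ 2 + c * y ^+ 2 - 2 * x * y by field.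
have e2 : c^-1 * (x + c * y) ^+ 2 = c^-1 * x ^+ 2 + c * y ^+ 2 + 2 * x * y by field.
by rewrite ler_norml; lra.
Qed.

(** * One difference estimator against a fixed stream, at all times at once *)

Section Tracking.
Variables (R : realType) (n : nat) (Sd : finType) (sg : Sd -> 'I_n -> R).
Hypothesis Sd_gt0 : (0 < #|Sd|)%N.
Hypothesis sg_pm : forall b i, sg b i = 1 \/ sg b i = -1.
Hypothesis sg4 : forall i j k l,
  Ex (fun b => sg b i * sg b j * sg b k * sg b l) = (paired i j k l)%:R.
Variable us : nat -> 'I_n.
Variables (I0 : finType) (A : pred I0).
Hypothesis A_gt0 : (0 < #|A|)%N.

Local Notation cnt := (cnt R us).
Local Notation F t := (N2 (cnt 0 t)).

Definition diff_est (w : {ffun I0 -> Sd}) (T t1 t : nat) : R :=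
  (\sum_(i | A i) (dot sg (w i) (cnt T t) ^+ 2 - dot sg (w i) (cnt T t1) ^+ 2)) / #|A|%:R.

(** An increment is the squared norm of the new updates plus their inner product with the past, and
    a shorter past has the smaller inner product. *)
Lemma N2_cnt_from (T a b : nat) : (T <= a <= b)%N ->
  N2 (cnt T b) - N2 (cnt T a) <= F b - F a.
Proof.
move=> /andP[Ta ab].
rewrite (@N2_cntD R n us T a b) ?Ta // (@N2_cntD R n us 0 a b) //.
rewrite [leLHS](_ : _ = 2 * ip (cnt T a) (cnt a b) + N2 (cnt a b)); last by ring.
rewrite [leRHS](_ : _ = 2 * ip (cnt 0 a) (cnt a b) + N2 (cnt a b)); last by ring.
rewrite lerD2r ler_pM2l //; apply: ler_sum => i _.
rewrite ler_wpM2r ?cnt_ge0 // (@cntD R n us 0 T a) ?Ta // lerDr; exact: cnt_ge0.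
Qed.

Lemma le_N2_cnt_from (T t : nat) : N2 (cnt T t) <= F t.
Proof.
have [tT|Tt] := leqP t T; first by rewrite N2_cnt_id // N2_ge0.
have := @N2_cnt_add R n us 0 T t; rewrite (ltnW Tt) => /(_ isT).
by apply: le_trans; rewrite lerDr N2_ge0.
Qed.

Section Segment.
Variables (T t1 a b : nat) (Z V kappa eta : R).
Hypotheses (Tt1 : (T <= t1)%N) (t1a : (t1 <= a)%N) (ab : (a <= b)%N).
Hypotheses (Z0 : 0 < Z) (k0 : 0 < kappa) (eta0 : 0 < eta) (eta1 : eta <= 1).
Hypothesis eta_kappa : 2 ^+ 15 * eta <= kappa.
Hypothesis kV : 9216 * V <= #|A|%:R * kappa ^+ 2 * Z.
Hypotheses (Fa : F a <= 4 * Z) (Va : N2 (cnt t1 a) <= V).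
Hypothesis Fab : F b - F a <= eta ^+ 2 * Z.

(** The events control the estimate at [a], the fluctuation of the sketches after [a], and the
    sketches at [a], which multiply that fluctuation in the cross term. Each has probability at most
    1/48, so [4800 = 48 * 100] and [192 = 48 * 4]; together they give the 1/16 required by the
    median. *)
Definition bad_copy (w : {ffun I0 -> Sd}) : bool :=
  [|| kappa * Z / 2 < `|diff_est w T t1 a - (N2 (cnt T a) - N2 (cnt T t1))|,
      4800 * (eta ^+ 2 * Z) < (\sum_(i | A i) mx sg us (w i) a b ^+ 2) / #|A|%:R
    | 192 * Z < (\sum_(i | A i) dot sg (w i) (cnt T a) ^+ 2) / #|A|%:R].

Let A0 : 0 < (#|A|%:R : R). Proof. by rewrite ltr0n. Qed.

Lemma Pr_avg_gt (X : Sd -> R) (c : R) : (forall x, 0 <= X x) -> 0 < c ->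
  48 * Ex X <= c ->
  Pr R (fun w : {ffun I0 -> Sd} => c < (\sum_(i | A i) X (w i)) / #|A|%:R) <= 48^-1.
Proof.
move=> X0 c0 Xc.
pose Y (w : {ffun I0 -> Sd}) := (\sum_(i | A i) X (w i)) / #|A|%:R.
apply: (@le_trans _ _ (Ex Y / c)).
  apply: markov => // w; rewrite divr_ge0 ?(ltW A0) //; exact: sumr_ge0.
have -> : Ex Y = Ex X.
  rewrite /Y; under eq_Ex do rewrite mulrC.
  rewrite ExZ Ex_sum; under eq_bigr do rewrite Ex_coord //.
  by rewrite sumr_const -(mulr_natl (Ex X)) mulrA mulVf ?mul1r // gt_eqF.
by rewrite ler_pdivrMr // mulrC ler_pdivlMr // mulrC.
Qed.

Lemma Pr_bad_copy : Pr R bad_copy <= 16^-1.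
Proof.
have Ta : (T <= a)%N by apply: leq_trans t1a.
have Ta4 : N2 (cnt T a) <= 4 * Z := le_trans (le_N2_cnt_from T a) Fa.
have -> : 16^-1 = 48^-1 + (48^-1 + 48^-1) :> R by field.
apply: (le_trans (PrU _ _ _)); apply: lerD; last first.
  have etaZ : 0 < eta ^+ 2 * Z by rewrite mulr_gt0 // exprn_gt0.
  apply: (le_trans (PrU _ _ _)); apply: lerD.
    apply: (Pr_avg_gt (X := fun x => mx sg us x a b ^+ 2)) => [x||].
    - by rewrite sqr_ge0.
    - by rewrite mulr_gt0.
    have : N2 (cnt a b) <= eta ^+ 2 * Z.
      apply: le_trans Fab; have := @N2_cnt_add R n us 0 a b; rewrite ab => /(_ isT).
      by rewrite lerBrDl.
    by have := Ex_mx2 Sd_gt0 sg4 us a b; lra.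
  apply: (Pr_avg_gt (X := fun x => dot sg x (cnt T a) ^+ 2)) => [x||].
  - by rewrite sqr_ge0.
  - by rewrite mulr_gt0.
  under eq_Ex do rewrite expr2.
  rewrite (Ex_dot2 sg_pm sg4) (_ : ip _ _ = N2 (cnt T a)); last first.
    by apply: eq_bigr => i _; rewrite expr2.
  by lra.
(* Factoring the difference of squares isolates the sketch of the updates after [t1]. The second
   moment then carries a factor [V] in place of one factor [Z], which is the gain of a difference
   estimator. *)
pose u i := cnt T a i + cnt T t1 i.
pose X x := dot sg x (cnt t1 a) * dot sg x u.
have Tt1a : (T <= t1 <= a)%N by rewrite Tt1.
have XE x : dot sg x (cnt T a) ^+ 2 - dot sg x (cnt T t1) ^+ 2 = X x.
  rewrite /X /u dotD (eq_dot sg x (@cntD R n us T t1 a Tt1a)) dotD; ring.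
have u2 : N2 u <= 16 * Z.
  apply: (@le_trans _ _ (4 * N2 (cnt T a))); last by lra.
  rewrite /N2 mulr_sumr; apply: ler_sum => i _; rewrite /u (@cntD R n us T t1 a Tt1a).
  rewrite [leRHS](_ : _ = (2 * (cnt T t1 i + cnt t1 a i)) ^+ 2); last by ring.
  rewrite lerXn2r ?nnegrE ?mulr_ge0 ?addr_ge0 ?cnt_ge0 //.
  by have := @cnt_ge0 R n us t1 a i; lra.
have EX : Ex X = N2 (cnt T a) - N2 (cnt T t1).
  rewrite /X (Ex_dot2 sg_pm sg4) /ip /N2 -sumrB; apply: eq_bigr => i _.
  by rewrite /u (@cntD R n us T t1 a Tt1a); ring.
have EX2 : Ex (fun x => X x ^+ 2) <= 3 * (V * (16 * Z)).
  under eq_Ex do rewrite /X exprMn.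
  apply: (le_trans (Ex_dot4 sg4 _ _)).
  - by move=> i; exact: cnt_ge0.
  - by move=> i; rewrite addr_ge0 ?cnt_ge0.
  by rewrite ler_pM2l // ler_pM ?N2_ge0.
have kZ : 0 < kappa * Z / 2 by rewrite divr_gt0 // mulr_gt0.
apply: (@le_trans _ _ (Ex (fun x => X x ^+ 2) / (#|A|%:R * (kappa * Z / 2) ^+ 2))).
  apply: le_trans (chebyshev_avg X Sd_gt0 A_gt0 kZ).
  apply: le_Pr => w; rewrite EX /diff_est.
  by under eq_bigr do rewrite XE.
(* [9216 = 3 * 16 * 4 * 48]: the fourth-moment constant, the bound on [N2 u], the halved threshold
   squared, and the probability. *)
rewrite ler_pdivrMr; last by rewrite mulr_gt0 // exprn_gt0.
apply: (le_trans EX2).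
rewrite -(ler_pM2l (_ : 0 < 192)) //.
have -> : 192 * (48^-1 * (#|A|%:R * (kappa * Z / 2) ^+ 2)) = (#|A|%:R * kappa ^+ 2 * Z) * Z.
  by field.
rewrite (_ : 192 * _ = 9216 * V * Z); last by ring.
by rewrite ler_pM2r.
Qed.

(** After [a] a squared sketch changes by [2 x y + x ^ 2]. Splitting the cross term with weight
    [eta] balances the average of [x ^ 2], of order [eta ^ 2 * Z], against that of [y ^ 2], of order
    [Z]. The total is at most [(4800 + 192 + 4800) * (eta * Z)]. *)
Lemma good_copy w t : ~~ bad_copy w -> (a <= t <= b)%N ->
  `|diff_est w T t1 t - (N2 (cnt T t) - N2 (cnt T t1))| <= kappa * Z.
Proof.
rewrite /bad_copy !negb_or -!leNgt => /and3P[H1 H2 H3] /andP[Hat Htb].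
have Ta : (T <= a)%N by apply: leq_trans t1a.
have Tat : (T <= a <= t)%N by rewrite Ta.
pose x i := dot sg (w i) (cnt a t); pose y i := dot sg (w i) (cnt T a).
have E : diff_est w T t1 t = diff_est w T t1 a +
    (\sum_(i | A i) (2 * x i * y i + x i ^+ 2)) / #|A|%:R.
  rewrite /diff_est -mulrDl -big_split; congr (_ / _); apply: eq_bigr => i _ /=.
  rewrite (eq_dot sg (w i) (@cntD R n us T a t Tat)) dotD /x /y; ring.
have Hx i : x i ^+ 2 <= mx sg us (w i) a b ^+ 2.
  rewrite -[x i ^+ 2]real_normK ?num_real // lerXn2r ?nnegrE ?mx_ge0 //.
  by apply: le_mx; rewrite Hat.
have Hxy : `|(\sum_(i | A i) (2 * x i * y i + x i ^+ 2)) / #|A|%:R| <=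
    (eta^-1 + 1) * ((\sum_(i | A i) mx sg us (w i) a b ^+ 2) / #|A|%:R)
    + eta * ((\sum_(i | A i) dot sg (w i) (cnt T a) ^+ 2) / #|A|%:R).
  rewrite normrM (gtr0_norm (_ : 0 < #|A|%:R^-1)) ?invr_gt0 //.
  rewrite !mulrA -mulrDl ler_wpM2r ?invr_ge0 ?(ltW A0) //.
  rewrite !mulr_sumr -big_split; apply: (le_trans (ler_norm_sum _ _ _)).
  apply: ler_sum => i _ /=; rewrite -/(y i).
  apply: (@le_trans _ _ ((eta^-1 + 1) * x i ^+ 2 + eta * y i ^+ 2)); last first.
    by rewrite lerD2r ler_wpM2l // addr_ge0 // invr_ge0 ltW.
  apply: (le_trans (ler_normD _ _)).
  rewrite (ger0_norm (sqr_ge0 (x i))) (mulrDl eta^-1) mul1r.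
  by rewrite [leRHS]addrAC lerD2r; apply: am_gm_norm.
have Hxy' : `|(\sum_(i | A i) (2 * x i * y i + x i ^+ 2)) / #|A|%:R| <= 9792 * (eta * Z).
  apply: (le_trans Hxy).
  apply: (@le_trans _ _ ((eta^-1 + 1) * (4800 * (eta ^+ 2 * Z)) + eta * (192 * Z))).
    by apply: lerD; apply: ler_wpM2l => //; rewrite ?addr_ge0 ?invr_ge0 ?(ltW eta0).
  have -> : (eta^-1 + 1) * (4800 * (eta ^+ 2 * Z)) + eta * (192 * Z)
     = 4992 * (eta * Z) + 4800 * (eta * (eta * Z)).
    by field; rewrite gt_eqF.
  have : eta * (eta * Z) <= eta * Z by rewrite ler_piMl // mulr_ge0 // ltW.
  by lra.
have D1 : 0 <= N2 (cnt T t) - N2 (cnt T a) by rewrite subr_ge0 le_N2_cnt.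
have D2 : N2 (cnt T t) - N2 (cnt T a) <= eta * Z.
  apply: (le_trans (N2_cnt_from Tat)).
  apply: (@le_trans _ _ (F b - F a)); first by rewrite lerD2r le_N2_cnt.
  by apply: (le_trans Fab); rewrite expr2 -mulrA ler_piMl // mulr_ge0 // ltW.
have Hk : 2 ^+ 15 * (eta * Z) <= kappa * Z by rewrite mulrA ler_pM2r.
rewrite E (_ : _ - _ = diff_est w T t1 a - (N2 (cnt T a) - N2 (cnt T t1))
   + (\sum_(i | A i) (2 * x i * y i + x i ^+ 2)) / #|A|%:R
   - (N2 (cnt T t) - N2 (cnt T a))); last by ring.
by apply: (@three_errors _ _ _ _ _ (eta * Z)); rewrite ?D1.
Qed.

End Segment.

Section AllTimes.
Variables (M T t1 m Nb : nat) (Z V kappa eta : R).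
Hypotheses (Tt1 : (T <= t1)%N).
Hypotheses (Z0 : 0 < Z) (k0 : 0 < kappa) (eta0 : 0 < eta) (eta1 : eta <= 1).
Hypothesis eta_kappa : 2 ^+ 15 * eta <= kappa.
Hypothesis kV : 9216 * V <= #|A|%:R * kappa ^+ 2 * Z.
Hypothesis HNb : 4 <= Nb%:R * eta ^+ 2.

Definition in_range (t : nat) : bool :=
  [&& (t1 <= t)%N, F t <= 4 * Z & N2 (cnt t1 t) <= V].

Definition median_est (w : {ffun 'I_M -> {ffun I0 -> Sd}}) t : R :=
  median (fun c => diff_est (w c) T t1 t).

(* A union over times would be too expensive; instead time is cut into the
   segments on which F2 stays in a window of width eta^2 Z. *)
Lemma Pr_tracking :
  Pr R (fun w => [exists t : 'I_m.+1, in_range t &&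
          (kappa * Z < `|median_est w t - (N2 (cnt T t) - N2 (cnt T t1))|)])
  <= Nb.+1%:R * 2^-1 ^+ M.
Proof.
pose h := eta ^+ 2 * Z.
have h0 : 0 < h by rewrite mulr_gt0 // exprn_gt0.
pose bk (k : nat) (t : nat) := in_range t && (k%:R * h <= F t < k.+1%:R * h).
pose err w t := kappa * Z < `|median_est w t - (N2 (cnt T t) - N2 (cnt T t1))|.
pose E (k : 'I_Nb.+1) w := [exists t : 'I_m.+1, bk k t && err w t].
apply: (@le_trans _ _ (Pr R (fun w => [exists k, E k w]))).
  apply: le_Pr => w /existsP[t /andP[rt et]].
  have Ft : 0 <= F t / h by rewrite divr_ge0 ?N2_ge0 // ltW.
  have /andP[f1 f2] := truncn_itv Ft.
  have fN : (Num.truncn (F t / h) < Nb.+1)%N.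
    rewrite ltnS -(ler_nat R) (le_trans f1) //.
    rewrite ler_pdivrMr // mulrA; have /and3P[_ H _] := rt.
    by apply: (le_trans H); rewrite ler_pM2r.
  apply/existsP; exists (Ordinal fN); apply/existsP; exists t.
  apply/andP; split; last exact: et.
  by rewrite /bk rt /= -ler_pdivlMr // f1 -ltr_pdivrMr.
apply: (le_trans (Pr_exists _ _)).
rewrite (_ : Nb.+1%:R * _ = \sum_(k < Nb.+1) 2^-1 ^+ M); last first.
  by rewrite sumr_const card_ord -(mulr_natl (2^-1 ^+ M)).
apply: ler_sum => k _.
case: (pickP (fun t : 'I_m.+1 => bk k t)) => [t0 bt0|none]; last first.
  rewrite Pr_pred0 ?exprn_ge0 ?invr_ge0 // => w.
  by apply/existsP => -[t /andP[bt _]]; rewrite none in bt.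
(* [a] and [b] are the first and last times in the window: all its times lie between them, while F2
   grows by at most [h] from [a] to [b]. *)
case: (@arg_minnP _ t0 (fun t : 'I_m.+1 => bk k t) val bt0) => a ba amin.
case: (@arg_maxnP _ t0 (fun t : 'I_m.+1 => bk k t) val bt0) => b bb bmax.
have ab : (a <= b)%N by apply: (leq_trans (amin _ bt0)); apply: bmax.
have /andP[/and3P[a1 a2 a3] /andP[a4 a5]] := ba.
have /andP[_ /andP[b4 b5]] := bb.
have Fab : F b - F a <= eta ^+ 2 * Z.
  rewrite -/h; move: a4 b5; rewrite -natr1 mulrDl mul1r; lra.
apply: le_trans (Pr_half_bad M _ (Pr_bad_copy Tt1 a1 ab Z0 k0 eta0 kV a2 a3 Fab)); last first.
  by rewrite card_ffun expn_gt0 Sd_gt0.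
apply: le_Pr => w /existsP[t /andP[bt]]; apply: contraTT; rewrite -ltnNge => Hgood.
rewrite /err -leNgt ler_distl; apply: median_itv.
have := cardC [pred c | bad_copy T t1 a b Z kappa eta (w c)]; rewrite card_ord.
suff : (#|predC [pred c | bad_copy T t1 a b Z kappa eta (w c)]| <= 
   #|[pred j | (N2 (cnt T t) - N2 (cnt T t1) - kappa * Z <= diff_est (w j) T t1 t <= N2 (cnt T t) - N2 (cnt T t1) + kappa * Z)%R]|)%N.
  by move: Hgood; move: #|_| #|predC _| #|_| => x y z; clear; lia.
apply: subset_leq_card; apply/subsetP => c; rewrite !inE -ler_distl => gc.
apply: (good_copy Tt1 a1 Z0 eta0 eta1 eta_kappa Fab gc).
by apply/andP; split; [exact: amin|exact: bmax].
Qed.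

End AllTimes.
End Tracking.

(** * The algorithm *)

Lemma mod_window (L b x y : nat) : (b <= x < b + L)%N -> (b <= y < b + L)%N ->
  x = y %[mod L] -> x = y.
Proof.
wlog xy : x y / (x <= y)%N => [H|] bx by_.
  by case: (leqP x y) => [/H|/ltnW/H] H' E; [exact: H'|symmetry; apply: H'].
move/eqP; rewrite eq_sym (eqn_mod_dvd _ xy) => /dvdnP[[|k] E]; nia.
Qed.

Lemma dot_cnt (R : realType) (n : nat) (Sd : finType) (sg : Sd -> 'I_n -> R)
    (us : nat -> 'I_n) (b : Sd) (T t : nat) :
  dot sg b (cnt R us T t) = \sum_(T <= r < t) sg b (us r).
Proof.
rewrite /dot /cnt; under eq_bigr do rewrite natr_sum mulr_sumr.
rewrite exchange_big /=; apply: eq_bigr => r _.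
rewrite (bigD1 (us r)) //= eqxx mulr1 big1 ?addr0 // => i ir.
by rewrite eq_sym (negPf ir) mulr0.
Qed.

Section Algorithm.
Variables (R : realType) (n : nat) (Sd : finType) (sg : Sd -> 'I_n -> R).
Variables (J L M k0 N0 : nat).
Hypotheses (L_gt0 : (0 < L)%N) (N0_gt0 : (0 < N0)%N).

(* A row is (slot, level, leaf, number). At level [j] the leaves [i] with
   [i %/ 2 ^ j = a] belong to the node [(j, a)], so that every level has
   [2 ^ J * k0] rows; level [J] is the root. *)
Definition row : finType := ('I_L * 'I_J.+1 * 'I_(2 ^ J) * 'I_k0)%type.
Definition seeds : finType := {ffun 'I_M -> {ffun row -> Sd}}.

Definition slot (i : row) : nat := i.1.1.1.
Definition level (i : row) : nat := i.1.1.2.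
Definition leaf (i : row) : nat := i.1.2.

Definition block (l j a : nat) : pred row :=
  fun i => [&& slot i == l, level i == j & leaf i %/ 2 ^ j == a]%N.

(* Position [0] is the phase in which the first [N0] updates are stored;
   position [p.+1] is the grid value number [p]. *)
Record mem := Mem {
  mtime : nat;
  mhist : {ffun 'I_N0 -> 'I_n};
  mpos : nat;
  mrows : {ffun 'I_M -> {ffun row -> Sd * R * R}} }.

Definition epoch (p : nat) : nat := (p.-1 %/ 2 ^ J)%N.
Definition offset (p : nat) : nat := (p.-1 %% 2 ^ J)%N.

(* The epoch e with e = l mod L and epoch p <= e < epoch p + L. *)
Definition hosted (p l : nat) : nat := (epoch p + (l + (L - epoch p %% L)) %% L)%N.

(** Numbers of grid values, one less than the position that outputs the value: a sketch that is
    active while the position is at most [q] ends with the update that moves the output to value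
    [q]. The root ends where its epoch begins. *)
Definition first_pos (e j a : nat) : nat := (e * 2 ^ J + a * 2 ^ j)%N.
Definition last_pos (e j a : nat) : nat :=
  if (j < J)%N then first_pos e j a.+1 else (e * 2 ^ J)%N.

(* A row carries its seed and two sketches [x] and [y] of the stream since its
   seeding: [x] stops at the beginning of the block of its node (and stays [0]
   at the root), [y] at the end. *)
Definition xactive (e p : nat) (i : row) : bool :=
  (level i < J)%N && (p <= first_pos e (level i) (leaf i %/ 2 ^ level i))%N.
Definition yactive (e p : nat) (i : row) : bool :=
  (p <= last_pos e (level i) (leaf i %/ 2 ^ level i))%N.

Definition hist_F2 (t : nat) (h : {ffun 'I_N0 -> 'I_n}) : R :=
  \sum_v (\sum_(s < N0 | (s < t)%N) (h s == v))%:R ^+ 2.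

Definition grid (W : R) (p : nat) : R :=
  W * 2 ^+ epoch p * (1 + (offset p)%:R / 2 ^+ J).

Definition node_est (r : {ffun 'I_M -> {ffun row -> Sd * R * R}}) (l j a : nat) : R :=
  median (fun c => (\sum_(i | block l j a i) ((r c i).2 ^+ 2 - (r c i).1.2 ^+ 2))
                   / #|block l j a|%:R).

(* The nodes in the sum partition [0, offset p) into dyadic intervals. *)
Definition F2_est r (p : nat) : R :=
  let l := (epoch p %% L)%N in let i := offset p in
  node_est r l J 0
  + \sum_(j < J) (if odd (i %/ 2 ^ j) then node_est r l j (i %/ 2 ^ j.+1).*2 else 0)
  + node_est r l 0 i.

Definition add_update (p : nat) (u : 'I_n) (r : {ffun 'I_M -> {ffun row -> Sd * R * R}}) :=
  [ffun c => [ffun i : row => let: (s, x, y) := r c i in let e := hosted p (slot i) in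
     (s, x + (xactive e p i)%:R * sg s u, y + (yactive e p i)%:R * sg s u)]]
  : {ffun 'I_M -> {ffun row -> Sd * R * R}}.

Definition reseed (l : nat) (xi : seeds) (r : {ffun 'I_M -> {ffun row -> Sd * R * R}}) :=
  [ffun c => [ffun i : row => if slot i == l then (xi c i, 0, 0) else r c i]]
  : {ffun 'I_M -> {ffun row -> Sd * R * R}}.

(** The cap freezes the position. The algorithm runs with one large cap; smaller caps yield the
    stopped games of the robustness argument. With cap [0] the position never leaves the storing
    phase. *)
Definition next_pos (cap t p : nat) h r : nat :=
  if p == 0%N then (t.+1 == N0) && (0 < cap)%N : nat
  else (p + ((p < cap)%N && (grid (hist_F2 N0 h) p.+1 <= F2_est r p)%R))%N.

(** When an epoch ends, its slot passes to the epoch [L] later. Fresh seeds [xi] are drawn at every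
    step and discarded unless this happens. *)
Definition mstep (cap : nat) (s : mem) (u : 'I_n) (xi : seeds) : mem :=
  let h := [ffun k : 'I_N0 => if k == mtime s :> nat then u else mhist s k] in
  let r := add_update (mpos s) u (mrows s) in
  let p := next_pos cap (mtime s) (mpos s) h r in
  Mem (mtime s).+1 h p
      (if (epoch (mpos s) < epoch p)%N then reseed (epoch (mpos s) %% L) xi r else r).

Definition mout (s : mem) : R :=
  if mpos s == 0%N then hist_F2 (mtime s) (mhist s)
  else grid (hist_F2 N0 (mhist s)) (mpos s).

Variable v0 : 'I_n.

Definition minit (xi : seeds) : mem :=
  Mem 0 [ffun=> v0] 0 [ffun c => [ffun i => (xi c i, 0, 0)]].

Variable adv : strategy R n.

(** * Trajectories, stopping times and the contents of the memory *)

Section Run.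
Variables (cap : nat) (xi : nat -> seeds).

Fixpoint traj (t : nat) : mem * seq R :=
  if t is t'.+1 then
    let: (s, os) := traj t' in
    let s' := mstep cap s (adv os) (xi t) in (s', rcons os (mout s'))
  else (minit (xi 0%N), [::]).

Definition memo t := (traj t).1.
Definition upd t := adv (traj t).2.
Definition pos t := mpos (memo t).

Lemma memoS t : memo t.+1 = mstep cap (memo t) (upd t) (xi t.+1).
Proof. by rewrite /memo /upd /=; case: (traj t). Qed.

Lemma trajS t : (traj t.+1).2 = rcons (traj t).2 (mout (memo t.+1)).
Proof. by rewrite /memo /=; case: (traj t). Qed.

Lemma outputs_traj t : (traj t).2 = [seq mout (memo s) | s <- iota 1 t].
Proof.
elim: t => // t IHt; rewrite trajS IHt -[in RHS](addn1 t) iotaD map_cat /=.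
by rewrite cats1 add1n.
Qed.

Lemma mtimeE t : mtime (memo t) = t.
Proof. by elim: t => // t IHt; rewrite memoS /= IHt. Qed.

Lemma mhistE t (s : 'I_N0) : (s < t)%N -> mhist (memo t) s = upd s.
Proof.
elim: t => // t IHt; rewrite ltnS memoS /= ffunE mtimeE => st.
by case: eqP => [->|/eqP sN] //; apply: IHt; rewrite ltn_neqAle sN.
Qed.

Lemma hist_F2E t r : (r <= t)%N -> (r <= N0)%N ->
  hist_F2 r (mhist (memo t)) = N2 (cnt R upd 0 r).
Proof.
move=> rt rN; apply: eq_bigr => v _; congr (_%:R ^+ 2).
rewrite big_mkord (big_ord_widen _ (fun s => (upd s == v) : nat) rN).
by apply: eq_bigr => s sr; rewrite mhistE // (leq_trans sr).
Qed.

Lemma posS t : pos t.+1 = next_pos cap t (pos t) (mhist (memo t.+1))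
   (add_update (pos t) (upd t) (mrows (memo t))).
Proof. by rewrite /pos memoS /= mtimeE. Qed.

Lemma pos_step t : (pos t <= pos t.+1 <= (pos t).+1)%N.
Proof.
rewrite posS /next_pos; case: eqP => [->|_] /=; first exact: leq_b1.
by rewrite leq_addr -addn1 leq_add2l leq_b1.
Qed.

Lemma pos_mono s t : (s <= t)%N -> (pos s <= pos t)%N.
Proof.
move=> st; rewrite -(subnKC st); elim: (t - s)%N => [|k IHk]; first by rewrite addn0.
by rewrite addnS (leq_trans IHk) //; case/andP: (pos_step (s + k)).
Qed.

Lemma pos0 : pos 0 = 0%N. Proof. by []. Qed.

Lemma pos_le t : (pos t <= t)%N.
Proof. by elim: t => // t IHt; case/andP: (pos_step t) => _ /leq_trans; apply. Qed.

Lemma pos_cap t : (pos t <= cap)%N.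
Proof.
elim: t => // t IHt; rewrite posS /next_pos; case: eqP => [_|_].
  by case: (_ == _) => //=; case: cap.
by case: ltnP => Hc; rewrite ?addn0 //=; case: (_ <= _); rewrite ?addn1 ?addn0.
Qed.

Lemma pos_eq0 t : (t < N0)%N -> pos t = 0%N.
Proof.
elim: t => // t IHt tN; by rewrite posS /next_pos (IHt (ltnW tN)) eqxx (ltn_eqF tN).
Qed.

Lemma pos_N0 : pos N0 = (0 < cap)%N.
Proof. by rewrite -(prednK N0_gt0) posS pos_eq0 ?prednK // /next_pos eqxx prednK // eqxx. Qed.

Variable m : nat.

(* The first time at which the position exceeds [q] ([m.+1] if there is no
   such time), since [pos] is monotone. *)
Definition tau (q : nat) : nat := \sum_(s < m.+1) (pos s <= q)%N.

Lemma tauP t q : (t <= m)%N -> (pos t <= q)%N = (t < tau q)%N.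
Proof.
move=> tm; apply/idP/idP => [ptq|].
  rewrite /tau (bigID (fun s : 'I_m.+1 => (s < t.+1)%N)) /=.
  rewrite (leq_trans _ (leq_addr _ _)) //.
  rewrite -(big_ord_widen _ (fun s => (pos s <= q)%N : nat)) //.
  rewrite (eq_bigr (fun=> 1%N)) ?sum1_card ?card_ord // => s _.
  by rewrite (leq_trans _ ptq) // pos_mono // -ltnS ltn_ord.
apply: contraTT; rewrite -ltnNge -leqNgt => qpt.
rewrite /tau (bigID (fun s : 'I_m.+1 => (s < t)%N)) /=.
rewrite [X in (_ + X)%N]big1 ?addn0; last first.
  move=> s; rewrite -leqNgt => /pos_mono pts; apply/eqP; rewrite eqb0 -ltnNge.
  exact: leq_trans pts.
rewrite -(big_ord_widen _ (fun s => (pos s <= q)%N : nat)); last by rewrite leqW.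
apply: (@leq_trans (\sum_(s < t) 1)%N); last by rewrite sum1_card card_ord.
by apply: leq_sum => s _; exact: leq_b1.
Qed.

Lemma le_tau q q' : (q <= q')%N -> (tau q <= tau q')%N.
Proof.
move=> qq; apply: leq_sum => s _; case: (leqP (pos s) q) => // /leq_trans H.
by rewrite H.
Qed.

Lemma pos_tau q : (tau q <= m)%N -> pos (tau q) = q.+1.
Proof.
move=> tm; apply/eqP; rewrite eqn_leq; apply/andP; split; last first.
  by rewrite ltnNge tauP // ltnn.
case t0: (tau q) => [|t]; first by rewrite pos0.
have /andP[_ /leq_trans] := pos_step t; apply.
by rewrite ltnS tauP ?t0 // (leq_trans _ tm) // t0.
Qed.

Lemma epoch_gt p e : (0 < p)%N -> (e <= epoch p)%N = (e * 2 ^ J < p)%N.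
Proof. by move=> p0; rewrite /epoch leq_divRL ?expn_gt0 // -ltnS prednK. Qed.

Lemma le_epoch p p' : (p <= p')%N -> (epoch p <= epoch p')%N.
Proof. by move=> pp; apply: leq_div2r; rewrite -!subn1 leq_sub2r. Qed.

(* The time at which the sketches of epoch [e] are seeded. *)
Definition alloc (e : nat) : nat :=
  if (e < L)%N then 0%N else tau ((e - L).+1 * 2 ^ J).

Lemma alloc_le e t : (t <= m)%N -> (alloc e <= t)%N = (e < epoch (pos t) + L)%N.
Proof.
move=> tm; rewrite /alloc; case: ltnP => eL; first by rewrite ltn_addl.
rewrite leqNgt -tauP // -ltnNge addnC -ltn_subLR //.
case: (posnP (pos t)) => [->|p0]; last by rewrite -epoch_gt.
by rewrite /epoch div0n !ltn0.
Qed.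

Lemma hosted_mod p l : (l < L)%N -> (hosted p l %% L)%N = l.
Proof.
move=> lL; rewrite /hosted modnDmr addnCA.
have H : ((epoch p + (L - epoch p %% L)) %% L = 0)%N.
  rewrite {1}(divn_eq (epoch p) L) -addnA subnKC ?modnMDl ?modnn //.
  by rewrite ltnW // ltn_mod.
by rewrite -modnDmr H addn0 modn_small.
Qed.

Lemma hosted_itv p l : (epoch p <= hosted p l < epoch p + L)%N.
Proof. by rewrite /hosted leq_addr ltn_add2l ltn_mod. Qed.

Lemma hosted_uniq p l e : (e %% L)%N = l -> (epoch p <= e < epoch p + L)%N ->
  hosted p l = e.
Proof.
move=> el H; apply: (mod_window (hosted_itv p l) H).
by rewrite el hosted_mod // -el ltn_mod.
Qed.

(** A slot is reset exactly at the time [alloc] of the epoch that it is about to host, so both sums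
    start empty there; every other slot keeps its epoch when the epoch number goes up by one. *)
Lemma rows_seed_sum t c i : (t <= m)%N ->
  let e := hosted (pos t) (slot i) in let s := xi (alloc e) c i in
  mrows (memo t) c i =
    (s, \sum_(alloc e <= r < t) (xactive e (pos r) i)%:R * sg s (upd r),
        \sum_(alloc e <= r < t) (yactive e (pos r) i)%:R * sg s (upd r)).
Proof.
have lL : (slot i < L)%N by exact: ltn_ord.
elim: t => [|t IHt] tm /=.
  rewrite /memo /= !ffunE; set e := hosted _ _.
  have -> : alloc e = 0%N.
    by apply/eqP; rewrite -leqn0 alloc_le // pos0; case/andP: (hosted_itv 0 (slot i)).
  by rewrite !big_geq.
have tm' := ltnW tm; have := IHt tm'; set e := hosted (pos t) _ => /= Hr.
have eT : (alloc e <= t)%N by rewrite alloc_le //; case/andP: (hosted_itv (pos t) (slot i)).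
have Hadd : add_update (pos t) (upd t) (mrows (memo t)) c i =
    (xi (alloc e) c i,
     \sum_(alloc e <= r < t.+1) (xactive e (pos r) i)%:R * sg (xi (alloc e) c i) (upd r),
     \sum_(alloc e <= r < t.+1) (yactive e (pos r) i)%:R * sg (xi (alloc e) c i) (upd r)).
  by rewrite !ffunE Hr -/e !big_nat_recr.
have /andP[p1 p2] := pos_step t.
rewrite memoS /= -/(pos t) mtimeE.
have -> : next_pos cap t (pos t) [ffun k : 'I_N0 => if k == t :> nat then upd t else mhist (memo t) k]
   (add_update (pos t) (upd t) (mrows (memo t))) = pos t.+1.
  by rewrite posS memoS /= mtimeE.
case: ltnP => Hep; last first.
  have Eep : epoch (pos t.+1) = epoch (pos t).
    by apply/eqP; rewrite eqn_leq Hep le_epoch.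
  by rewrite /hosted Eep -/(hosted (pos t) (slot i)) -/e.
have Eep : epoch (pos t.+1) = (epoch (pos t)).+1.
  apply/eqP; rewrite eqn_leq Hep andbT.
  apply: (leq_trans (le_epoch p2)); rewrite /epoch /=.
  case: (pos t) => [|p] /=; first by rewrite div0n.
  apply: (@leq_trans ((p + 2 ^ J) %/ 2 ^ J)).
    by apply: leq_div2r; rewrite -addn1 leq_add2l expn_gt0.
  by rewrite divnDr // divnn expn_gt0 addn1.
rewrite ffunE ffunE; case: eqP => [sl|sl].
  have -> : hosted (pos t.+1) (slot i) = (epoch (pos t) + L)%N.
    by apply: hosted_uniq; rewrite ?modnDr // Eep addSn ltnSn andbT -addn1 leq_add2l.
  have -> : alloc (epoch (pos t) + L) = t.+1.
    apply/eqP; rewrite eqn_leq; apply/andP; split.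
      by rewrite alloc_le // Eep addSn.
    by rewrite ltnNge alloc_le // ltnn.
  by rewrite !big_geq.
have -> : hosted (pos t.+1) (slot i) = e; last exact: Hadd.
apply: hosted_uniq; first exact: hosted_mod.
have /andP[e1 e2] := hosted_itv (pos t) (slot i).
rewrite Eep addSn ltnS (ltnW e2) andbT ltn_neqAle e1 andbT.
by apply/eqP => E; apply: sl; rewrite E hosted_mod.
Qed.

Lemma sum_active (T t q : nat) (f : nat -> R) : (t <= m)%N ->
  \sum_(T <= r < t.+1) (pos r <= q)%N%:R * f r
  = \sum_(T <= r < minn t.+1 (tau q)) f r.
Proof.
move=> tm; rewrite [RHS](big_nat_widen _ _ t.+1) ?geq_minl // [RHS]big_mkcond.
apply: eq_big_nat => r /andP[_ rt].
rewrite /= leq_min rt -tauP; last by rewrite (leq_trans _ tm).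
by case: leqP; rewrite ?mul1r ?mul0r.
Qed.

Definition node_start (e j a t : nat) : nat :=
  if (j < J)%N then minn t (tau (first_pos e j a)) else alloc e.
Definition node_stop (e j a t : nat) : nat := minn t (tau (last_pos e j a)).

(** Links memory and analysis: a sketch frozen by the position is a sketch up to a stopping time, as
    [pos r <= q] means [r < tau q]. At the root the start is [alloc e], where [x] is still [0]. *)
Lemma node_estE t j a (e := epoch (pos t)) : (t < m)%N ->
  node_est (add_update (pos t) (upd t) (mrows (memo t))) (e %% L) j a
  = median (fun c => diff_est sg upd (block (e %% L) j a) (xi (alloc e) c) (alloc e)
        (node_start e j a t.+1) (node_stop e j a t.+1)).
Proof.
move=> tm; congr median; apply: boolp.funext => c; congr (_ / _).
apply: eq_bigr => i /and3P[/eqP sl /eqP lv /eqP lf].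
have he : hosted (pos t) (slot i) = e.
  by rewrite sl; apply: hosted_uniq => //; rewrite leqnn -[X in (X < _)%N]addn0 ltn_add2l.
rewrite !ffunE (rows_seed_sum c i (ltnW tm)) he /=.
rewrite -!(big_nat_recr _ _ _) /=; first last.
- by rewrite alloc_le ?(ltnW tm) // -[X in (X < _)%N]addn0 ltn_add2l.
- by rewrite alloc_le ?(ltnW tm) // -[X in (X < _)%N]addn0 ltn_add2l.
rewrite /yactive lv lf sum_active 1?ltnW // -dot_cnt; congr (_ - _ ^+ 2).
rewrite /xactive lv lf /node_start; case: ifP => jJ.
  by rewrite sum_active 1?ltnW // dot_cnt.
rewrite dot_cnt [RHS]big_geq // big1 // => r _.
by rewrite mul0r.
Qed.

End Run.

(** * Stopped runs and their independence of the seeds of a node *)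

Lemma next_pos_cap cap cap' t p h r : (cap <= cap')%N ->
  (p < cap)%N || (next_pos cap' t p h r == p) ->
  next_pos cap t p h r = next_pos cap' t p h r.
Proof.
move=> cc; have cc1 x : (x < cap)%N -> (x < cap')%N by move=> /leq_trans; apply.
rewrite /next_pos; case: (p =P 0%N) => [->|_].
  by case: (ltnP 0 cap) => [/cc1->//|_] /=; rewrite andbF => /eqP->.
case: (ltnP p cap) => [/cc1->//|_] /=.
by rewrite -[X in _ == X]addn0 eqn_add2l => /eqP->.
Qed.

(** Lowering the cap is a stopping rule: nothing changes until the position wants to pass the lower
    cap, and from then on it stays there. *)
Lemma traj_cap cap cap' xi t : (cap <= cap')%N ->
  ((pos cap' xi t <= cap)%N -> traj cap xi t = traj cap' xi t) /\
  pos cap xi t = minn (pos cap' xi t) cap.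
Proof.
move=> cc; elim: t => [|t [IH1 IH2]]; first by split; rewrite // /pos /= min0n.
have /andP[p1 p2] := pos_step cap' xi t; have /andP[q1 q2] := pos_step cap xi t.
have [ptc|ctp] := leqP (pos cap' xi t) cap; last first.
  split; first by move/(leq_trans p1); rewrite leqNgt ctp.
  apply/eqP; rewrite eqn_leq leq_min pos_cap andbT (leq_trans (pos_cap _ _ _)) /=; last first.
    exact: leq_trans (ltnW ctp) p1.
  apply: leq_trans q1; rewrite IH2; apply: leq_trans (geq_minr _ _) _.
  by rewrite leq_min leqnn andbT ltnW.
have E := IH1 ptc.
have Em : memo cap xi t = memo cap' xi t by rewrite /memo E.
have Eu : upd cap xi t = upd cap' xi t by rewrite /upd E.
have Ep : pos cap xi t = pos cap' xi t by rewrite /pos Em.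
have F : (pos cap' xi t < cap)%N || (pos cap' xi t.+1 == pos cap' xi t) ->
    traj cap xi t.+1 = traj cap' xi t.+1.
  move=> H; suff Em1 : memo cap xi t.+1 = memo cap' xi t.+1.
    rewrite [LHS]surjective_pairing [RHS]surjective_pairing !trajS -/(memo _ _ _) -/(memo _ _ _).
    by rewrite Em1 E.
  rewrite !memoS Em Eu /mstep; set h := finfun _; set r := add_update _ _ _.
  rewrite (next_pos_cap cc) //.
  case/orP: H => [->//|].
  by rewrite posS memoS /= -/h -/r mtimeE => ->; rewrite orbT.
have [pc|pc] := ltnP (pos cap' xi t) cap.
  have Ft := F (introT orP (or_introl pc)).
  split=> [_ //|]; rewrite /pos /memo Ft -/(memo _ _ _) -/(pos _ _ _).
  by apply/esym/minn_idPl; apply: leq_trans pc.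
have pE : pos cap' xi t = cap by apply/eqP; rewrite eqn_leq ptc.
split=> [pc1|].
  by apply: F; rewrite pE ltnn /= eqn_leq pc1 -pE.
apply/eqP; rewrite eqn_leq leq_min pos_cap andbT; apply/andP; split.
  by rewrite (leq_trans (pos_cap _ _ _)) // -pE.
by rewrite (leq_trans (geq_minr _ _)) // -[X in (X <= _)%N]pE -Ep.
Qed.

Definition used (p j a : nat) : bool :=
  [|| (j == J) && (a == 0%N),
      [&& (j < J)%N, odd (offset p %/ 2 ^ j) & a == (offset p %/ 2 ^ j.+1).*2]
    | (j == 0%N) && (a == offset p)].

Lemma node_est_eq (r r' : {ffun 'I_M -> {ffun row -> Sd * R * R}}) l j a :
  (forall c i, block l j a i -> r c i = r' c i) -> node_est r l j a = node_est r' l j a.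
Proof.
move=> rr; congr median; apply: boolp.funext => c; congr (_ / _).
by apply: eq_bigr => i bi; rewrite rr.
Qed.

Lemma F2_est_eq r r' p :
  (forall j a, used p j a ->
     node_est r (epoch p %% L) j a = node_est r' (epoch p %% L) j a) ->
  F2_est r p = F2_est r' p.
Proof.
move=> H; rewrite /F2_est !(H 0%N (offset p)) ?(H J 0%N) /used ?eqxx ?orbT //.
congr (_ + _ + _); apply: eq_bigr => j _; case: ifP => // oj.
by rewrite H // /used ltn_ord oj eqxx orbT.
Qed.

Lemma pos_divE p : (0 < p)%N -> p = (epoch p * 2 ^ J + offset p).+1.
Proof. by move=> p0; rewrite -divn_eq prednK. Qed.

(** The heart of robustness. A node is consulted only at positions from its [last_pos] on, with
    equality for the leaf, whereas in the run capped at [last_pos] an estimate can matter only at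
    smaller positions. Hence that run cannot depend on the seeds of the node. *)
Lemma used_last p j a : (0 < J)%N -> (0 < p)%N -> used p j a ->
  (last_pos (epoch p) j a <= p)%N.
Proof.
move=> J0 p0; rewrite {3}(pos_divE p0) /last_pos /first_pos.
case/or3P => [/andP[/eqP-> _]|/and3P[jJ oj /eqP->]|/andP[/eqP-> /eqP->]].
- by rewrite ltnn leqW // leq_addr.
- rewrite jJ leqW // leq_add2l expnSr divnMA divn2.
  rewrite -[X in (X.+1 * _)%N]add0n -addnS.
  have -> : (0 + ((offset p %/ 2 ^ j)./2).*2.+1 = offset p %/ 2 ^ j)%N.
    by rewrite add0n -[RHS]odd_double_half oj.
  exact: leq_trunc_div.
- by rewrite J0 muln1 -addnS.
Qed.

Lemma reseedE l xi r c i :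
  reseed l xi r c i = if slot i == l then (xi c i, 0, 0) else r c i.
Proof. by rewrite !ffunE. Qed.

Section Resample.
Variables (m e j a : nat) (xi xi' : nat -> seeds).
Let cap := last_pos e j a.
Let T := alloc cap xi m e.
Hypotheses (J_gt0 : (0 < J)%N) (jaJ : (j < J)%N -> (a.+1 * 2 ^ j <= 2 ^ J)%N).
Hypothesis xiT : forall s, (s <= m)%N -> s != T -> xi s = xi' s.
Hypothesis xiB : forall c i, ~~ block (e %% L) j a i -> xi T c i = xi' T c i.

Let xiB' s c i : s = T -> ~~ block (e %% L) j a i -> xi s c i = xi' s c i.
Proof. by move=> ->; exact: xiB. Qed.

(* Before position [cap] the seeds of the node (e, j, a) are not looked at. *)
Lemma traj_resample t : (t <= m)%N ->
  [/\ (traj cap xi t).2 = (traj cap xi' t).2,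
      mhist (memo cap xi t) = mhist (memo cap xi' t),
      pos cap xi t = pos cap xi' t &
      forall c i, (t < T)%N || ~~ block (e %% L) j a i ->
        mrows (memo cap xi t) c i = mrows (memo cap xi' t) c i].
Proof.
elim: t => [|t IHt] tm.
  split=> // c i; rewrite /memo /= !ffunE => H; congr (_, _, _).
  have [T0|T0] := eqVneq 0%N T; last by rewrite xiT.
  by apply: xiB' => //; move: H; rewrite -T0 ltnn.
have [E1 E2 E3 E4] := IHt (ltnW tm).
have Eu : upd cap xi t = upd cap xi' t by rewrite /upd E1.
pose r := add_update (pos cap xi t) (upd cap xi t) (mrows (memo cap xi t)).
pose r' := add_update (pos cap xi' t) (upd cap xi' t) (mrows (memo cap xi' t)).
have Er c i : (t < T)%N || ~~ block (e %% L) j a i -> r c i = r' c i.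
  by move=> H; rewrite !ffunE E4 // E3 Eu.
have Eh : mhist (memo cap xi t.+1) = mhist (memo cap xi' t.+1).
  by rewrite !memoS /= !mtimeE E2 Eu.
have Ep : pos cap xi t.+1 = pos cap xi' t.+1.
  rewrite !posS Eh -/r -/r' -E3 /next_pos; case: eqP => // /eqP; rewrite -lt0n => p0.
  case: ltnP => // pc /=; congr (_ + nat_of_bool (_ <= _)%R)%N.
  apply: F2_est_eq => j' a' u; apply: node_est_eq => c i bi; apply: Er.
  (* A consulted row of the resampled block would belong to epoch [e]: its slot fixes the epoch
     modulo [L], while [T <= t] and the cap confine [e] to one window of length [L]. Then
     [used_last] contradicts [pos < cap]. *)
  case: (ltnP t T) => //= Tt; apply/negP => bi'.
  have /and3P[/eqP s1 /eqP l1 /eqP b1] := bi; have /and3P[/eqP s2 /eqP l2 /eqP b2] := bi'.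
  have jj : j' = j by rewrite -l1 l2.
  have aa : a' = a by rewrite -b1 -b2 jj.
  have ecap : (cap <= e.+1 * 2 ^ J)%N.
    rewrite /cap /last_pos /first_pos mulSn addnC.
    by case: ifP => [/jaJ|_]; rewrite ?leq_add2r // leq_addl.
  have ep : epoch (pos cap xi t) = e.
    have e1 : (e < epoch (pos cap xi t) + L)%N by rewrite -(alloc_le _ _ _ (ltnW tm)).
    have e2 : (epoch (pos cap xi t) <= e)%N.
      rewrite /epoch -ltnS ltn_divLR ?expn_gt0 //.
      by rewrite (leq_trans _ ecap) // prednK // ltnW.
    apply: (@mod_window L (epoch (pos cap xi t))); last by rewrite -s1 s2.
      by rewrite leqnn -[X in (X < _)%N]addn0 ltn_add2l.
    by rewrite e2.
  have := used_last J_gt0 p0 u; rewrite ep jj aa -/cap.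
  by rewrite leqNgt pc.
have Et : mtime (memo cap xi t.+1) = mtime (memo cap xi' t.+1) by rewrite !mtimeE.
split => //.
  rewrite !trajS E1; congr rcons.
  by rewrite /mout -/(pos _ _ _) -/(pos _ _ _) Ep Et Eh.
move=> c i Hi.
have Hi' : (t < T)%N || ~~ block (e %% L) j a i.
  by case/orP: Hi => [/ltnW->|->] //; rewrite orbT.
have mE x : mrows (memo cap x t.+1) =
   if (epoch (pos cap x t) < epoch (pos cap x t.+1))%N
   then reseed (epoch (pos cap x t) %% L) (x t.+1) (add_update (pos cap x t) (upd cap x t) (mrows (memo cap x t)))
   else add_update (pos cap x t) (upd cap x t) (mrows (memo cap x t)).
  by rewrite posS !memoS /= mtimeE.
rewrite !mE -/r -/r' -Ep -E3; case: ifP => _; last exact: Er.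
rewrite !reseedE; case: ifP => _; last exact: Er.
have [T0|T0] := eqVneq t.+1 T; last by rewrite xiT.
by rewrite (xiB' _ T0) //; move: Hi; rewrite -T0 ltnn.
Qed.

End Resample.

End Algorithm.

(** * Grid values and bad nodes *)

(** An update of an item with frequency [f] raises F2 by [2 f + 1], here at most 6 times the root of
    [Z]. That root is at least [32 q], which leaves less than a quarter of the step [Z / q]. *)
Lemma jump_bound (R : realType) (q Z W F f : R) :
  1 <= q -> 1024 * q ^+ 2 <= W -> W <= Z -> F <= 4 * Z -> f ^+ 2 <= F ->
  2 * f + 1 <= Z / q / 4.
Proof.
move=> q1 qW WZ FZ fF; have q0 : 0 < q by apply: lt_le_trans q1.
have q2 : 1 <= q ^+ 2 by rewrite exprn_ege1.
have Z0 : 0 < Z by lra.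
rewrite -mulrA -invfM ler_pdivlMr ?mulr_gt0 //.
set X := 2 * f + 1.
have X2 : X ^+ 2 <= 36 * Z.
  have := sqr_ge0 (f - 1); rewrite /X !expr2 in fF * => ?; lra.
rewrite leNgt; apply/negP => ZX.
have : Z ^+ 2 < (X * (q * 4)) ^+ 2 by rewrite ltrXn2r // ?nnegrE ltW // (lt_trans Z0).
rewrite !exprMn => H.
have : X ^+ 2 * (q ^+ 2 * 4 ^+ 2) <= 36 * Z * (q ^+ 2 * 4 ^+ 2).
  by apply: ler_wpM2r => //; rewrite mulr_ge0 // sqr_ge0.
have : 1024 * (q ^+ 2 * Z) <= Z ^+ 2 by rewrite mulrA expr2 ler_pM2r //; lra.
have : 0 < q ^+ 2 * Z by rewrite mulr_gt0 // exprn_gt0.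
rewrite (_ : 4 ^+ 2 = 16 :> R); last by ring.
rewrite (_ : 36 * Z * (q ^+ 2 * 16) = 576 * (q ^+ 2 * Z)); last by ring.
lra.
Qed.

Section Grid.
Variables (R : realType) (J : nat).

Lemma epochE e i : (i < 2 ^ J)%N -> epoch J (e * 2 ^ J + i).+1 = e.
Proof. by move=> iJ; rewrite /epoch /= divnMDl ?expn_gt0 // divn_small ?addn0. Qed.

Lemma gridE (W : R) e i : (i <= 2 ^ J)%N ->
  grid J W (e * 2 ^ J + i).+1 = W * 2 ^+ e * (1 + i%:R / 2 ^+ J).
Proof.
rewrite leq_eqVlt => /orP[/eqP->|iJ].
  have := @epochE e.+1 0; rewrite expn_gt0 addn0 mulSn addnC => /(_ isT) E.
  rewrite /grid E /offset /= modnDr modnMl mul0r addr0 mulr1.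
  rewrite natrX divff ?expf_neq0 ?pnatr_eq0 //.
  by rewrite exprS; ring.
rewrite /grid epochE // /offset /= modnMDl modn_small //.
Qed.

Lemma gridS (W : R) p : (0 < p)%N ->
  grid J W p.+1 = grid J W p + W * 2 ^+ epoch J p / 2 ^+ J.
Proof.
move=> p0; have iJ : (offset J p < 2 ^ J)%N by rewrite ltn_mod expn_gt0.
rewrite [in LHS](pos_divE J p0) -addnS gridE // [grid J W p]/grid.
by rewrite -natr1; ring.
Qed.

Lemma grid_bounds (W : R) p : 0 <= W ->
  W * 2 ^+ epoch J p <= grid J W p <= 2 * (W * 2 ^+ epoch J p).
Proof.
move=> W0; have iJ : (offset J p < 2 ^ J)%N by rewrite ltn_mod expn_gt0.
have Z0 : 0 <= W * 2 ^+ epoch J p by rewrite mulr_ge0 // exprn_ge0.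
have x0 : 0 <= (offset J p)%:R / 2 ^+ J :> R by rewrite divr_ge0 ?exprn_ge0.
have x1 : (offset J p)%:R / 2 ^+ J <= 1 :> R.
  by rewrite ler_pdivrMr ?exprn_gt0 // mul1r -natrX ler_nat ltnW.
rewrite /grid; apply/andP; split; first by rewrite ler_peMr // lerDl.
by rewrite [leLHS]mulrC ler_wpM2r //; lra.
Qed.

End Grid.

Section Correctness.
Variables (R : realType) (n : nat) (Sd : finType) (sg : Sd -> 'I_n -> R).
Variables (J L M k0 N0 : nat).
Hypotheses (L_gt1 : (1 < L)%N) (N0_gt0 : (0 < N0)%N) (J_gt0 : (0 < J)%N).
Variables (v0 : 'I_n) (adv : strategy R n) (m : nat) (kappa : R).

Local Notation upd := (upd sg N0 v0 adv).
Local Notation tau_ cap xi := (tau sg N0 v0 adv cap xi m).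
Local Notation alloc_ cap xi := (alloc sg N0 v0 adv cap xi m).
Local Notation first_pos := (first_pos J).
Local Notation last_pos := (last_pos J).
Local Notation epoch := (epoch J).

Let L_gt0 : (0 < L)%N := ltnW L_gt1.

(** Mass allowed to the updates of a block: four times its [2 ^ j] grid steps of size [Z / 2 ^ J],
    which leaves room for the tracking errors at both ends. *)
Definition window (Z : R) (j : nat) : R :=
  if (j < J)%N then 2 ^+ j.+2 / 2 ^+ J * Z else 4 * Z.

Definition start_time cap (xi : nat -> seeds Sd J L M k0) e j a : nat :=
  if (j < J)%N then tau_ cap xi (first_pos e j a) else alloc_ cap xi e.

(* The estimator is judged along the run that is stopped at position
   [last_pos e j a], which does not depend on the seeds of the node. *)
Definition bad_node (e j a : nat) (xi : nat -> seeds Sd J L M k0) : bool :=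
  let cap := last_pos e j a in
  let us := upd cap xi in
  let T := alloc_ cap xi e in
  let t1 := start_time cap xi e j a in
  let Z := N2 (cnt R us 0 N0) * 2 ^+ e in
  [exists t : 'I_m.+1, in_range us t1 Z (window Z j) t &&
     (kappa * Z < `|median_est sg us (block (e %% L) j a) T t1 (xi T) t
                    - (N2 (cnt R us T t) - N2 (cnt R us T t1))|)].

Lemma alloc_start cap xi e j a : (alloc_ cap xi e <= start_time cap xi e j a)%N.
Proof.
rewrite /start_time; case: ifP => // jJ; rewrite /alloc.
case: ltnP => // eL; apply: le_tau; rewrite /first_pos (leq_trans _ (leq_addr _ _)) //.
by rewrite leq_mul2r ltn_subrL L_gt0 (leq_trans L_gt0 eL) orbT.
Qed.

Section Transfer.
Variables (cap cap' : nat) (xi : nat -> seeds Sd J L M k0).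
Hypothesis cc : (cap <= cap')%N.

Lemma tau_cap q : (q < cap)%N -> tau_ cap xi q = tau_ cap' xi q.
Proof.
move=> qc; apply: eq_bigr => s _.
have [_ ->] := traj_cap sg N0 v0 adv xi s cc.
by rewrite geq_min [X in _ || X]leqNgt qc orbF.
Qed.

Lemma upd_cap s : (s <= m)%N -> (s < tau_ cap' xi cap)%N -> upd cap xi s = upd cap' xi s.
Proof.
move=> sm; rewrite -tauP // => ps.
by rewrite /upd; have [->] := traj_cap sg N0 v0 adv xi s cc.
Qed.

Lemma cnt_cap T t : (t <= m)%N -> (t <= tau_ cap' xi cap)%N ->
  cnt R (upd cap xi) T t = cnt R (upd cap' xi) T t.
Proof.
move=> tm tt; apply: boolp.funext => i; congr (_%:R).
apply: eq_big_nat => s /andP[_ st]; rewrite upd_cap //.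
  by rewrite (leq_trans (ltnW st)).
by rewrite (leq_trans st).
Qed.

Lemma dot_cnt_cap s T t : (t <= m)%N -> (t <= tau_ cap' xi cap)%N ->
  dot sg s (cnt R (upd cap xi) T t) = dot sg s (cnt R (upd cap' xi) T t).
Proof. by move=> tm tt; rewrite cnt_cap. Qed.

End Transfer.

Lemma good_node_transfer cap' xi e j a t :
  let us := upd cap' xi in
  let T := alloc_ cap' xi e in
  let t1 := start_time cap' xi e j a in
  let Z := N2 (cnt R us 0 N0) * 2 ^+ e in
  (last_pos e j a <= cap')%N -> ~~ bad_node e j a xi ->
  (N0 <= m)%N -> (t <= m)%N -> (t <= tau_ cap' xi (last_pos e j a))%N ->
  in_range us t1 Z (window Z j) t ->
  `|median (fun c => diff_est sg us (block (e %% L) j a) (xi T c) T t1 t)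
    - (N2 (cnt R us T t) - N2 (cnt R us T t1))| <= kappa * Z.
Proof.
move=> us T t1 Z lc; rewrite /bad_node; set cap := last_pos e j a.
have Tc : alloc_ cap xi e = T.
  rewrite /T /alloc; case: ltnP => // eL; apply: tau_cap => //.
  rewrite /cap /last_pos /first_pos; apply: (@leq_trans (e * 2 ^ J)%N).
    by rewrite ltn_mul2r expn_gt0 /= -subSn // ltn_subLR; [rewrite addnC; lia|lia].
  by case: ifP => // _; rewrite leq_addr.
have t1c : start_time cap xi e j a = t1.
  rewrite /t1 /start_time; case: ifP => // jJ; apply: tau_cap => //.
  by rewrite /cap /last_pos jJ /first_pos ltn_add2l ltn_mul2r expn_gt0 ltnSn.
rewrite Tc t1c => /existsPn bad Nm tm tc.
have N0c : (N0 <= tau_ cap' xi cap)%N.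
  have N1 : (N0.-1 < tau_ cap' xi cap)%N.
    by rewrite -tauP ?pos_eq0 ?prednK // (leq_trans (leq_pred _)).
  by rewrite prednK in N1.
have t1t r : in_range us t1 r (window Z j) t -> (t1 <= t)%N by case/and3P.
move=> rt; have t1t' := t1t _ rt.
have Zc : N2 (cnt R (upd cap xi) 0 N0) = N2 (cnt R us 0 N0) by rewrite (cnt_cap lc).
have := bad (Ordinal (tm : (t < m.+1)%N)).
rewrite Zc -/Z negb_and /=.
have -> : in_range (upd cap xi) t1 Z (window Z j) t.
  by move: rt; rewrite /in_range !(cnt_cap lc).
rewrite /= -leNgt (cnt_cap lc) // (cnt_cap lc) ?(leq_trans t1t') //.
suff -> : median_est sg (upd cap xi) (block (e %% L) j a) T t1 (xi T) t =
  median (fun c => diff_est sg us (block (e %% L) j a) (xi T c) T t1 t) by [].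
congr median; apply: boolp.funext => c; congr (_ / _); apply: eq_bigr => i _.
by rewrite !(dot_cnt_cap lc) // ?(leq_trans t1t').
Qed.

End Correctness.

(** * Correctness when no node is bad *)

Section StreamF2.
Variables (R : realType) (n : nat) (us : nat -> 'I_n).
Local Notation cnt := (cnt R us).
Local Notation F t := (N2 (cnt 0 t)).

Lemma cnt_sum T t : \sum_i cnt T t i = (t - T)%:R.
Proof.
rewrite /cnt -natr_sum exchange_big /= (eq_bigr (fun=> 1%N)) ?sum_nat_const_nat ?muln1 //.
by move=> r _; rewrite (bigD1 (us r)) //= eqxx big1 // => i; rewrite eq_sym => /negPf->.
Qed.

Lemma F2_ge_length t : t%:R <= F t.
Proof.
rewrite -[t in t%:R]subn0 -cnt_sum; apply: ler_sum => i _.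
by rewrite /cnt -natrX ler_nat; case: (\sum_(_ <= _ < _) _)%N => // k; rewrite leq_pmulr.
Qed.

Lemma F2_le_length t : F t <= t%:R ^+ 2.
Proof.
rewrite -[t in t%:R]subn0 -cnt_sum expr2 mulr_suml; apply: ler_sum => i _.
rewrite expr2 ler_wpM2l ?cnt_ge0 // (bigD1 i) //= lerDl.
by apply: sumr_ge0 => k _; exact: cnt_ge0.
Qed.

Lemma F2S t : F t.+1 = F t + (2 * cnt 0 t (us t) + 1).
Proof.
rewrite (@N2_cntD R n us 0 t t.+1) ?leqnSn //.
have d i : cnt t t.+1 i = (us t == i)%:R by rewrite /cnt big_nat1.
rewrite -addrA; congr (_ + (2 * _ + _)).
  by rewrite -(sum_delta (cnt 0 t) (us t)); apply: eq_bigr => i _; rewrite d.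
rewrite /N2 (bigD1 (us t)) //= d eqxx expr1n big1 ?addr0 // => i iu.
by rewrite d eq_sym (negPf iu) expr0n.
Qed.

Lemma sqr_cnt_le t i : cnt 0 t i ^+ 2 <= F t.
Proof. by rewrite /N2 (bigD1 i) //= lerDl sumr_ge0 // => k _; rewrite sqr_ge0. Qed.

(** Counting from [T] loses only inner products with the prefix. By Cauchy-Schwarz, twice such a
    product is at most [Z] times the root of [16 c]. In the second bound the prefix is paired with
    the whole vector, so that [F T] is covered too. *)
Lemma prefix_error (T t1 t2 : nat) (Z kappa c : R) : 0 <= Z -> 0 <= kappa ->
  (T <= t1 <= t2)%N -> F t2 <= 4 * Z -> F T <= c * Z -> 16 * c <= kappa ^+ 2 ->
  `|(F t2 - F t1) - (N2 (cnt T t2) - N2 (cnt T t1))| <= kappa * Z /\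
  `|F t2 - N2 (cnt T t2)| <= kappa * Z.
Proof.
move=> Z0 k0 /andP[T1 t12] F2 FT ck.
have key v : (forall i, 0 <= v i) -> (forall i, v i <= cnt 0 t2 i) -> 0 <= 2 * ip (cnt 0 T) v <= kappa * Z.
  move=> v0 v2; have ip0 : 0 <= ip (cnt 0 T) v by apply: ip_ge0 => // i; exact: cnt_ge0.
  rewrite mulr_ge0 //= -(@ler_pXn2r _ 2) ?nnegrE ?mulr_ge0 //.
  rewrite !exprMn; apply: (@le_trans _ _ (4 * (F T * F t2))).
    rewrite (_ : 2 ^+ 2 = 4 :> R); last by ring.
    rewrite ler_pM2l // (le_trans (cauchy_schwarz _ _)) // ler_wpM2l ?N2_ge0 //.
    by apply: ler_sum => i _; rewrite lerXn2r ?nnegrE ?cnt_ge0.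
  apply: (@le_trans _ _ (4 * (c * Z * (4 * Z)))).
    by rewrite ler_pM2l // ler_pM ?N2_ge0.
  rewrite (_ : 4 * _ = 16 * c * Z ^+ 2); last by ring.
  by rewrite ler_wpM2r ?sqr_ge0.
have Tt2 := leq_trans T1 t12.
split.
  have -> : F t2 - F t1 - (N2 (cnt T t2) - N2 (cnt T t1)) = 2 * ip (cnt 0 T) (cnt t1 t2).
    rewrite (@N2_cntD R n us 0 T t2) // (@N2_cntD R n us 0 T t1) //.
    have -> : ip (cnt 0 T) (cnt T t2) = ip (cnt 0 T) (cnt T t1) + ip (cnt 0 T) (cnt t1 t2).
      rewrite /ip -big_split; apply: eq_bigr => i _ /=.
      by rewrite (@cntD R n us T t1 t2) ?T1 // mulrDr.
    ring.
  have /andP[k1 k2] := key (cnt t1 t2) (@cnt_ge0 R n us t1 t2)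
    (fun i => ltac:(rewrite (@cntD R n us 0 t1 t2) ?t12 // lerDr; exact: cnt_ge0)).
  by rewrite ger0_norm.
have E : F t2 = F T + 2 * ip (cnt 0 T) (cnt T t2) + N2 (cnt T t2) by apply: N2_cntD.
have /andP[_ k2] := key (cnt 0 t2) (@cnt_ge0 R n us 0 t2) (fun i => lexx _).
have E2 : ip (cnt 0 T) (cnt 0 t2) = F T + ip (cnt 0 T) (cnt T t2).
  rewrite /ip /N2 -big_split; apply: eq_bigr => i _ /=.
  by rewrite (@cntD R n us 0 T t2) ?Tt2 // mulrDr expr2.
have FT0 := N2_ge0 (cnt 0 T).
have i0 : 0 <= ip (cnt 0 T) (cnt T t2) by apply: ip_ge0; exact: cnt_ge0.
by rewrite E addrK ger0_norm ?addr_ge0 ?mulr_ge0 //; rewrite E2 in k2; lra.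
Qed.

End StreamF2.

(** Rounding [i] down to a multiple of [2 ^ j] and of [2 ^ j.+1] differs exactly when bit [j] is
    set, so the sum telescopes from [i] to [0]. *)
Lemma sum_dyadic (R : realType) (F : nat -> R) (i J : nat) : (i < 2 ^ J)%N ->
  \sum_(j < J) (if odd (i %/ 2 ^ j)
     then F (i %/ 2 ^ j * 2 ^ j)%N - F (i %/ 2 ^ j.+1 * 2 ^ j.+1)%N else 0)
  = F i - F 0%N.
Proof.
move=> iJ.
have -> : F i - F 0%N = F (i %/ 2 ^ 0 * 2 ^ 0)%N - F (i %/ 2 ^ J * 2 ^ J)%N.
  by rewrite divn1 muln1 divn_small.
elim: J {iJ} => [|J IHJ]; first by rewrite big_ord0 subrr.
rewrite big_ord_recr /= IHJ; case: ifP => oi; first by ring.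
rewrite addr0; congr (_ - F _).
by rewrite expnSr divnMA divn2 mulnA [RHS]mulnAC -[in LHS](odd_double_half (i %/ 2 ^ J)) oi muln2.
Qed.

Lemma grid_arith (R : realType) (w x y q : R) : q != 0 ->
  w * (1 + (x + y) / q) = w * (1 + y / q) + x * (w / q).
Proof. by move=> q0; field. Qed.

Lemma window_arith (R : realType) (z q : R) (j : nat) : q != 0 ->
  2 ^+ j.+2 / q * z = 4 * (2 ^+ j * (z / q)).
Proof. by move=> q0; rewrite !exprS; field. Qed.

(** Explains the value of [kappa]: each of [J + 2] nodes may err by [2 * kappa * z], half for the
    estimator and half for the unseen prefix, and together they have a quarter of the grid step
    [z / q]. *)
Lemma error_budget (R : realType) (kappa z q : R) (J : nat) : q != 0 ->
  kappa * (8 * J.+2%:R * q) = 1 ->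
  z / q / 4 = 2 * kappa * z + (2 * kappa * z) *+ J + 2 * kappa * z.
Proof.
move=> q0 kE; rewrite -[X in _ + X + _]mulr_natr.
have -> : 2 * kappa * z + 2 * kappa * z * J%:R + 2 * kappa * z
    = kappa * (8 * J.+2%:R * q) * (z / q / 4).
  by rewrite -!natr1; field.
by rewrite kE mul1r.
Qed.

Section Induction.
Variables (R : realType) (n : nat) (Sd : finType) (sg : Sd -> 'I_n -> R).
Variables (J L M k0 N0 : nat).
Hypotheses (L_gt1 : (1 < L)%N) (N0_gt0 : (0 < N0)%N) (J_gt0 : (0 < J)%N).
Variables (v0 : 'I_n) (adv : strategy R n) (m : nat) (kappa : R).
Variables (E cap : nat) (xi : nat -> seeds Sd J L M k0).
Hypothesis kappaE : kappa * (8 * J.+2%:R * 2 ^+ J) = 1.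
Hypothesis kappaL : 64 <= kappa ^+ 2 * 2 ^+ L.
Hypothesis N0J : 1024 * (2 ^+ J) ^+ 2 <= N0%:R :> R.
Hypothesis mE : 2 * m%:R ^+ 2 <= 2 ^+ E :> R.
Hypothesis Ecap : (E * 2 ^ J < cap)%N.
Hypothesis good : forall e j a, (e < E)%N -> (j <= J)%N ->
  (a.+1 * 2 ^ j <= 2 ^ J)%N ->
  ~~ bad_node sg N0 v0 adv m kappa e j a xi.

Local Notation pos := (pos sg N0 v0 adv cap xi).
Local Notation us := (upd sg N0 v0 adv cap xi).
Local Notation memo := (memo sg N0 v0 adv cap xi).
Local Notation tau_ := (tau sg N0 v0 adv cap xi m).
Local Notation alloc_ := (alloc sg N0 v0 adv cap xi m).
Local Notation F t := (N2 (cnt R us 0 t)).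
Let W : R := F N0.
Let Z e : R := W * 2 ^+ e.
Let G e : R := Z e / 2 ^+ J.

Let J2 : 0 < 2 ^+ J :> R. Proof. exact: exprn_gt0. Qed.

Let W_gt0 : 0 < W. Proof. exact: N2_cnt_gt0. Qed.
Let Z_gt0 e : 0 < Z e. Proof. by rewrite mulr_gt0 // exprn_gt0. Qed.
Let G_gt0 e : 0 < G e. Proof. by rewrite divr_gt0. Qed.

Let ZG e : 2 * G e <= Z e.
Proof.
rewrite mulrA ler_pdivrMr // mulrC ler_pM2l //.
by rewrite -[leLHS]expr1 ler_eXn2l // ltr1n.
Qed.

(** The slack is the error of [F2_est]: staying certifies the upper bound, moving certifies the new
    lower bound. The new upper bound after a move holds because one update adds at most a quarter
    step. *)
Definition tracked (t : nat) : Prop :=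
  (0 < pos t)%N /\
  grid J W (pos t) - G (epoch J (pos t)) / 4 <= F t
    <= grid J W (pos t).+1 + G (epoch J (pos t)) / 4.

Lemma tracked_N0 : tracked N0.
Proof.
have c0 : (0 < cap)%N by apply: leq_trans Ecap.
rewrite /tracked pos_N0 // c0; split => //.
have g1 : grid J W 1 = W.
  have := @gridE R J W 0 0; rewrite mul0n add0n expr0 mulr1 mul0r addr0 mulr1.
  by apply.
have e1 : epoch J 1 = 0%N by rewrite /epoch /= div0n.
rewrite (gridS J W (ltn0Sn 0)) -/(Z _) -/(G _) g1 e1 /W -/W.
by have := G_gt0 0; rewrite /W => ?; apply/andP; split; lra.
Qed.

Section Step.
Variable t : nat.
Hypotheses (N0t : (N0 <= t)%N) (tm : (t < m)%N).
Hypothesis IH : forall s, (N0 <= s <= t)%N -> tracked s.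

Let p := pos t.
Let e := epoch J p.
Let i := offset J p.
Let T := alloc_ e.

Let p_gt0 : (0 < p)%N. Proof. by have [] := IH (introT andP (conj N0t (leqnn t))). Qed.

Let iJ : (i < 2 ^ J)%N. Proof. by rewrite ltn_mod expn_gt0. Qed.

Let pE : p = (e * 2 ^ J + i).+1. Proof. exact: pos_divE. Qed.

Let Ft_itv : grid J W p - G e / 4 <= F t <= grid J W p.+1 + G e / 4.
Proof. by have [] := IH (introT andP (conj N0t (leqnn t))). Qed.

Let Ft_Z : F t <= 4 * Z e - G e.
Proof.
have /andP[_] := Ft_itv; have /andP[_] := grid_bounds J p (ltW W_gt0).
rewrite gridS // -/(Z _) -/(G _) -/e; have := ZG e; have := G_gt0 e; lra.
Qed.

(** In epoch [E] the invariant would push F2 above [m ^ 2], the largest value a stream of length [m]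
    can reach. *)
Lemma epoch_lt : (e < E)%N.
Proof.
rewrite ltnNge; apply/negP => Ee.
have /andP[g1 _] := grid_bounds J p (ltW W_gt0).
have /andP[F1 _] := Ft_itv; have F3 := F2_le_length R us t.
have tm2 : t%:R ^+ 2 <= m%:R ^+ 2 :> R by rewrite lerXn2r ?nnegrE // ler_nat ltnW.
have W1 : 1 <= W.
  by apply: le_trans (F2_ge_length R us N0); rewrite ler1n.
have Ze : 2 ^+ E <= Z e.
  by rewrite -[leLHS]mul1r ler_pM ?exprn_ge0 // ler_eXn2l // ltr1n.
have m1 : 1 <= m%:R ^+ 2 :> R by rewrite exprn_ege1 // ler1n (leq_ltn_trans _ tm).
have mZ : 2 * m%:R ^+ 2 <= Z e := le_trans mE Ze.
have ZGe := ZG e; rewrite -/e -/(Z e) in g1; lra.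
Qed.

Lemma F_step : F t.+1 <= F t + G e / 4.
Proof.
rewrite F2S lerD2l /G; apply: (@jump_bound _ _ _ W (F t)).
- by rewrite exprn_ege1 // ler1n.
- exact: le_trans N0J (F2_ge_length R us N0).
- by rewrite /Z ler_peMr ?(ltW W_gt0) // exprn_ege1 // ler1n.
- by have := Ft_Z; have := G_gt0 e; lra.
- exact: sqr_cnt_le.
Qed.

Let Ft1_Z : F t.+1 <= 4 * Z e.
Proof. by have := F_step; have := Ft_Z; have := G_gt0 e; lra. Qed.

Let T_le : (T <= t)%N.
Proof. by rewrite /T alloc_le ?(ltnW tm) // -[X in (X < _)%N]addn0 ltn_add2l ltnW. Qed.

(** Seeding happens when the output reaches the first value [Z (e - L).+1] of epoch [e - L + 1].
    There the invariant bounds F2 by twice that value, and [2 * 2 / 2 ^ L] is the ratio to [Z e].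
    The first [L] epochs are seeded on the empty stream. *)
Lemma alloc_prefix : F T <= 4 / 2 ^+ L * Z e.
Proof.
have R0 : 0 <= 4 / 2 ^+ L * Z e by rewrite mulr_ge0 ?divr_ge0 ?exprn_ge0 // ltW.
rewrite /T /alloc; case: ltnP => eL; first by rewrite N2_cnt_id.
set q := ((e - L).+1 * 2 ^ J)%N.
have Tt : (tau_ q <= t)%N by have := T_le; rewrite /T /alloc ltnNge eL.
have pT : pos (tau_ q) = q.+1 by apply: pos_tau; rewrite (leq_trans Tt) // ltnW.
have N0T : (N0 <= tau_ q)%N.
  by rewrite leqNgt; apply/negP => /(pos_eq0 sg v0 adv cap xi); rewrite pT.
have [_ /andP[_]] := IH (introT andP (conj N0T Tt)).
have qe : epoch J q.+1 = (e - L).+1.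
  by rewrite -[q]addn0 epochE // expn_gt0.
rewrite pT gridS // -/(Z _) -/(G _) qe.
have -> : grid J W q.+1 = Z (e - L).+1.
  by rewrite -[q]addn0 gridE // mul0r addr0 mulr1.
have -> : 4 / 2 ^+ L * Z e = 2 * Z (e - L).+1.
  have -> : Z e = Z (e - L) * 2 ^+ L by rewrite /Z -mulrA -exprD subnK.
  have -> : Z (e - L).+1 = 2 * Z (e - L) by rewrite /Z exprS mulrCA.
  have q0 : 2 ^+ L != 0 :> R by rewrite expf_neq0 ?pnatr_eq0.
  by rewrite mulrCA divfK // mulrC mulrA; congr (_ * _); ring.
have := ZG (e - L).+1; have := G_gt0 (e - L).+1; lra.
Qed.

Let Fd (q : nat) : R := F (tau_ q).

Lemma node_error j a : (j <= J)%N -> used J p j a ->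
  `|node_est (add_update sg p (us t) (mrows (memo t))) (e %% L) j a
    - (F (node_stop sg N0 v0 adv cap xi m e j a t.+1)
       - (if (j < J)%N then Fd (first_pos J e j a) else 0))| <= 2 * kappa * Z e.
Proof.
move=> jJ u; rewrite (node_estE sg N0 (ltnW L_gt1) v0 adv cap xi j a tm) -/p -/e -/T.
set t2 := node_stop _ _ _ _ _ _ _ _ _ _ _.
have k_ge0 : 0 <= kappa.
  have : 0 < kappa * (8 * J.+2%:R * 2 ^+ J) by rewrite kappaE.
  by rewrite pmulr_lgt0 ?mulr_gt0 ?exprn_gt0 // => /ltW.
have lastp : (last_pos J e j a <= p)%N by apply: used_last.
have aJ : (j < J -> a.+1 * 2 ^ j <= 2 ^ J)%N.
  move=> lt_jJ; move: lastp; rewrite /last_pos lt_jJ /first_pos pE -addnS leq_add2l.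
  by move/leq_trans; apply.
have aJ' : (a.+1 * 2 ^ j <= 2 ^ J)%N.
  move: jJ; rewrite leq_eqVlt => /orP[/eqP jJ|]; last exact: aJ.
  move: u; rewrite /used jJ ltnn eqxx /= (gtn_eqF J_gt0) /= orbF => /eqP->.
  by rewrite mul1n.
pose t1 := if (j < J)%N then tau_ (first_pos J e j a) else T.
have first_lt : (j < J -> first_pos J e j a < last_pos J e j a)%N.
  by move=> lt_jJ; rewrite /last_pos lt_jJ ltn_add2l ltn_mul2r expn_gt0 /=.
have start_t : (j < J -> tau_ (first_pos J e j a) <= t)%N.
  move=> lt_jJ; rewrite leqNgt -tauP ?(ltnW tm) // -ltnNge -/p.
  exact: leq_trans (first_lt lt_jJ) lastp.
have nsE : node_start sg N0 v0 adv cap xi m e j a t.+1 = t1.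
  rewrite /node_start /t1; case: ifP => // lt_jJ.
  by apply/minn_idPr; rewrite leqW // start_t.
have t2t : (t2 <= t.+1)%N by rewrite geq_minl.
have Tt1 : (T <= t1)%N.
  by have := @alloc_start R n Sd sg J L M k0 N0 L_gt1 v0 adv m cap xi e j a.
have t1t2 : (t1 <= t2)%N.
  rewrite /t1 /t2 /node_stop leq_min; case: ifP => lt_jJ.
    by rewrite (leqW (start_t lt_jJ)) le_tau // ltnW // first_lt.
  rewrite (leqW T_le) /=; have := @alloc_start R n Sd sg J L M k0 N0 L_gt1 v0 adv m cap xi e 0 0.
  by rewrite /start_time J_gt0 /first_pos mul0n addn0 /last_pos lt_jJ.
have F2Z : F t2 <= 4 * Z e by apply: le_trans Ft1_Z; apply: le_N2_cnt.
have Fwin : N2 (cnt R us t1 t2) <= window J (Z e) j.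
  have Fdiff : N2 (cnt R us t1 t2) <= F t2 - F t1.
    by rewrite lerBrDl; apply: N2_cnt_add.
  rewrite /window; case: ifP => lt_jJ; last first.
    by apply: le_trans F2Z; apply: le_N2_cnt_from.
  apply: (le_trans Fdiff).
  have t1E : t1 = tau_ (first_pos J e j a) by rewrite /t1 lt_jJ.
  have s_t := start_t lt_jJ.
  have pt1 : pos t1 = (first_pos J e j a).+1.
    by rewrite t1E; apply: pos_tau; rewrite (leq_trans s_t) // ltnW.
  have N0s s : (0 < pos s)%N -> (N0 <= s)%N.
    by move=> ps; rewrite leqNgt; apply/negP => /(pos_eq0 sg v0 adv cap xi) ps0; rewrite ps0 in ps.
  have t1_itv : (N0 <= t1 <= t)%N by rewrite N0s ?pt1 // t1E.
  have fi : (a * 2 ^ j < 2 ^ J)%N.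
    by apply: leq_trans (aJ lt_jJ); rewrite ltn_mul2r expn_gt0 /=.
  have F1 : grid J W (first_pos J e j a).+1 - G e / 4 <= F t1.
    by have [_ /andP[+ _]] := IH t1_itv; rewrite pt1 epochE.
  have ga : grid J W (first_pos J e j a.+1).+1 = grid J W (first_pos J e j a).+1 + 2 ^+ j * G e.
    rewrite /first_pos !gridE ?aJ // ?(ltnW fi) // mulSn natrD natrX.
    by rewrite grid_arith // gt_eqF.
  (* If the block has ended, the invariant at [t2] applies; otherwise the node is the current leaf
     and [F_step] covers the update being read. With the quarter step lost at [t1] the overshoot is
     3/2 of a step, within the factor 4 of [window]. *)
  have F2 : F t2 <= grid J W (first_pos J e j a.+1).+1 + 5 / 4 * G e.
    have [le_t2t|lt_tt2] := leqP t2 t.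
      have lE : last_pos J e j a = first_pos J e j a.+1 by rewrite /last_pos lt_jJ.
      have t2E : t2 = tau_ (last_pos J e j a).
        move: le_t2t; rewrite /t2 /node_stop /minn; case: ifP => // _.
        by rewrite ltnn.
      have pt2 : pos t2 = (first_pos J e j a.+1).+1.
        by rewrite t2E pos_tau -?lE // -t2E (leq_trans le_t2t) // ltnW.
      have t2_itv : (N0 <= t2 <= t)%N by rewrite N0s ?pt2.
      have ei : (a.+1 * 2 ^ j < 2 ^ J)%N.
        have : (pos t2 <= p)%N by apply: pos_mono.
        rewrite pt2 pE /first_pos ltnS leq_add2l => /leq_ltn_trans; exact.
      have [_ /andP[_]] := IH t2_itv; rewrite pt2 epochE // gridS // epochE //.
      rewrite -/(first_pos J e j a.+1) -/(Z e) -/(G e); lra.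
    have t2E : t2 = t.+1 by apply/eqP; rewrite eqn_leq t2t.
    have plast : (p <= last_pos J e j a)%N.
      rewrite /p (tauP sg N0 v0 adv cap xi _ (ltnW tm)).
      by move: lt_tt2; rewrite /t2 /node_stop leq_min => /andP[].
    have pl : p = first_pos J e j a.+1.
      by apply/eqP; rewrite eqn_leq; move: plast lastp; rewrite /last_pos lt_jJ => -> ->.
    have /andP[_ F3] := Ft_itv; rewrite -pl t2E.
    by have := F_step; have := G_gt0 e; lra.
  have -> : 2 ^+ j.+2 / 2 ^+ J * Z e = 4 * (2 ^+ j * G e).
    by rewrite window_arith // gt_eqF.
  have j2G : G e <= 2 ^+ j * G e by rewrite ler_peMl ?(ltW (G_gt0 e)) // exprn_ege1 // ler1n.
  by rewrite ga in F2; have Ge := G_gt0 e; lra.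
have Nm : (N0 <= m)%N by rewrite (leq_trans N0t) // ltnW.
have lcap : (last_pos J e j a <= cap)%N.
  apply: (leq_trans _ (ltnW Ecap)); apply: (@leq_trans (e.+1 * 2 ^ J)).
    rewrite /last_pos /first_pos mulSn addnC; case: ifP => [/aJ|_].
      by rewrite leq_add2r.
    by rewrite leq_addl.
  by rewrite leq_mul2r epoch_lt orbT.
have := @good_node_transfer R n Sd sg J L M k0 N0 L_gt1 N0_gt0 J_gt0 v0 adv m kappa cap xi e j a t2
  lcap (good epoch_lt jJ aJ') Nm (leq_trans t2t tm) (geq_minr _ _).
have st1 : start_time sg N0 v0 adv m cap xi e j a = t1 by [].
rewrite -/T -/W -/(Z e) nsE st1 /in_range t1t2 F2Z Fwin => /(_ isT).
have c16 : 16 * (4 / 2 ^+ L) <= kappa ^+ 2.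
  by rewrite mulrA ler_pdivrMr ?exprn_gt0 //; apply: le_trans kappaL; lra.
have T12 : (T <= t1 <= t2)%N by rewrite Tt1.
have [e1 e2] := prefix_error (ltW (Z_gt0 e)) k_ge0 T12 F2Z alloc_prefix c16.
set D := median _ => HD.
rewrite (_ : 2 * kappa * Z e = kappa * Z e + kappa * Z e); last by ring.
move: HD e1 e2; rewrite /t1 /Fd; case: ifP => lt_jJ HD e1 e2.
  rewrite (_ : D - _ = (D - (N2 (cnt R us T t2) - N2 (cnt R us T (tau_ (first_pos J e j a)))))
     - ((F t2 - F (tau_ (first_pos J e j a))) - (N2 (cnt R us T t2) - N2 (cnt R us T (tau_ (first_pos J e j a)))))); last by ring.
  by rewrite (le_trans (ler_normB _ _)) // lerD.
rewrite (_ : D - _ = (D - (N2 (cnt R us T t2) - N2 (cnt R us T T)))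
     - (F t2 - N2 (cnt R us T t2))); last by rewrite (N2_cnt_id _ _ (leqnn T)); ring.
by rewrite (le_trans (ler_normB _ _)) // lerD.
Qed.

Lemma F2_est_error :
  `|F2_est (add_update sg p (us t) (mrows (memo t))) p - F t.+1| <= G e / 4.
Proof.
set r := add_update _ _ _ _; pose d := 2 * kappa * Z e.
have stop_lt q : (q < p)%N -> minn t.+1 (tau_ q) = tau_ q.
  by move=> qp; apply/minn_idPr; rewrite leqW // leqNgt -tauP ?(ltnW tm) // -ltnNge.
have root : `|node_est r (e %% L) J 0 - Fd (e * 2 ^ J)%N| <= d.
  have := @node_error J 0 (leqnn J); rewrite /used !eqxx => /(_ isT).
  by rewrite ltnn subr0 /node_stop /last_pos ltnn stop_lt // pE ltnS leq_addr.
have leafE : `|node_est r (e %% L) 0 i - (F t.+1 - Fd (e * 2 ^ J + i)%N)| <= d.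
  have := @node_error 0 i (leq0n J); rewrite /used !eqxx !orbT => /(_ isT).
  rewrite J_gt0 /node_stop /last_pos J_gt0 /first_pos !muln1 addnS -pE.
  rewrite (minn_idPl _) // -tauP //; exact: ltnW.
pose S j := if odd (i %/ 2 ^ j) then node_est r (e %% L) j (i %/ 2 ^ j.+1).*2 else 0.
pose S' j := if odd (i %/ 2 ^ j) then Fd (e * 2 ^ J + i %/ 2 ^ j * 2 ^ j)%N
   - Fd (e * 2 ^ J + i %/ 2 ^ j.+1 * 2 ^ j.+1)%N else 0.
have inner (j : 'I_J) : `|S j - S' j| <= d.
  rewrite /S /S'; case: ifP => oj; last first.
    rewrite subrr normr0 mulr_ge0 ?(ltW (Z_gt0 e)) // mulr_ge0 //.
    have : 0 < kappa * (8 * J.+2%:R * 2 ^+ J) by rewrite kappaE.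
    by rewrite pmulr_lgt0 ?mulr_gt0 ?exprn_gt0 // => /ltW.
  have := @node_error j (i %/ 2 ^ j.+1).*2 (ltnW (ltn_ord j)).
  rewrite /used -/i oj ltn_ord eqxx orbT => /(_ isT).
  rewrite /node_stop /last_pos ltn_ord /first_pos.
  have -> : ((i %/ 2 ^ j.+1).*2.+1 = i %/ 2 ^ j)%N.
    by rewrite expnSr divnMA divn2 -[RHS]odd_double_half oj.
  have -> : ((i %/ 2 ^ j.+1).*2 * 2 ^ j = i %/ 2 ^ j.+1 * 2 ^ j.+1)%N.
    by rewrite -muln2 -mulnA -expnS.
  by rewrite stop_lt // pE ltnS leq_add2l leq_trunc_div.
have sumS' : \sum_(j < J) S' j = Fd (e * 2 ^ J + i)%N - Fd (e * 2 ^ J)%N.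
  by rewrite /S' (sum_dyadic (fun q => Fd (e * 2 ^ J + q)%N) iJ) addn0.
have -> : F2_est r p - F t.+1 = (node_est r (e %% L) J 0 - Fd (e * 2 ^ J)%N)
  + \sum_(j < J) (S j - S' j)
  + (node_est r (e %% L) 0 i - (F t.+1 - Fd (e * 2 ^ J + i)%N)).
  rewrite sumrB sumS' /F2_est -/e -/i -/(S _) /S; ring.
have -> : G e / 4 = d + d *+ J + d.
  by apply: error_budget => //; exact: lt0r_neq0.
rewrite (le_trans (ler_normD _ _)) // lerD // (le_trans (ler_normD _ _)) // lerD //.
apply: (le_trans (ler_norm_sum _ _ _)).
apply: (@le_trans _ _ (\sum_(j < J) d)); first by apply: ler_sum.
by rewrite sumr_const card_ord.
Qed.

Lemma trackedS : tracked t.+1.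
Proof.
have /andP[F1 F2] := Ft_itv; have Fs := F_step; have := F2_est_error.
rewrite ler_norml => /andP[d1 d2]; have Ge := G_gt0 e.
have FS : F t <= F t.+1 by apply: le_N2_cnt.
have pS : pos t.+1 = (p + ((p < cap) && (grid J W p.+1
    <= F2_est (add_update sg p (us t) (mrows (memo t))) p)%R))%N.
  rewrite posS /next_pos -/p -[p == 0%N]negbK -lt0n p_gt0 /=.
  by rewrite hist_F2E // leqW.
have pc : (p < cap)%N.
  apply: leq_ltn_trans Ecap; rewrite pE -addnS.
  apply: (@leq_trans (e.+1 * 2 ^ J)); first by rewrite mulSn addnC leq_add2r.
  by rewrite leq_mul2r epoch_lt orbT.
move: pS; rewrite pc /=; case: leP => Hg; rewrite ?addn0 ?addn1 => pS.
  rewrite /tracked pS; split => //.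
  have ee : G e <= G (epoch J p.+1).
    rewrite /G ler_pM2r ?invr_gt0 // /Z ler_pM2l // ler_eXn2l ?ltr1n //.
    exact: le_epoch.
  rewrite (gridS J W (ltn0Sn p)) -/(Z _) -/(G _); apply/andP; split; lra.
rewrite /tracked pS -/e; split => //; apply/andP; split; lra.
Qed.

End Step.

Lemma tracked_all t : (N0 <= t <= m)%N -> tracked t.
Proof.
have [k] := ubnP t; elim: k => // k IHk in t *; rewrite ltnS => tk /andP[N0t tm].
move: N0t; rewrite leq_eqVlt => /orP[/eqP <-|N0t]; first exact: tracked_N0.
case: t tk tm N0t => // t tk tm; rewrite ltnS => N0t.
apply: trackedS => // s /andP[N0s st]; apply: IHk; first exact: leq_ltn_trans tk.
by rewrite N0s (leq_trans st) // ltnW.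
Qed.

(** F2 lies between a quarter step below and 5/4 of a step above the output, and [2 <= eps * 2 ^ J]
    makes a step at most [eps / 2] times the output. *)
Lemma good_approx (eps : R) t : 2 <= eps * 2 ^+ J -> eps <= 2^-1 -> (t <= m)%N ->
  approx eps (mout (memo t)) (F t).
Proof.
move=> epsJ eps1 tm.
have eps0 : 0 < eps by rewrite -(pmulr_lgt0 _ J2); apply: lt_le_trans epsJ.
rewrite /approx /mout -/(pos t).
have [tN0|N0t] := ltnP t N0.
  rewrite pos_eq0 // eqxx mtimeE hist_F2E // 1?ltnW //.
  by rewrite ler_piMl ?ler_peMl ?N2_ge0 // ?lerDl ?gerBl ltW.
have [|p0 /andP[F1 F2]] := @tracked_all t; first by rewrite N0t.
rewrite -[_ == _]negbK -lt0n p0 /= hist_F2E // -/W.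
have g0 := grid_bounds J (pos t) (ltW W_gt0); move: F1 F2.
rewrite gridS //.
move: g0; rewrite -/(Z _) -/(G _); set e := epoch _ _; set g := grid _ _ _.
move=> /andP[g1 _] F1 F2.
have GZ : 2 * G e <= eps * Z e.
  by rewrite /G mulrA ler_pdivrMr // mulrAC ler_pM2r.
have Zg : eps * Z e <= eps * g by rewrite ler_pM2l.
have FS0 := N2_ge0 (cnt R us 0 t).
have eg : eps * g <= 2^-1 * g by rewrite ler_wpM2r // (le_trans _ g1) // ltW.
have a1 : eps * (g + G e + G e / 4) >= eps * g by rewrite ler_pM2l // -addrA lerDl addr_ge0 ?divr_ge0 // ltW.
have a2 : eps * F t >= eps * (g - G e / 4) by rewrite ler_pM2l.
have a3 : (1 - eps) * F t <= (1 - eps) * (g + G e + G e / 4).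
  by rewrite ler_wpM2l // subr_ge0 (le_trans eps1) // invf_le1 // ler1n.
have a4 : eps * G e <= 2^-1 * G e by rewrite ler_wpM2r // ltW.
have a5 := G_gt0 e.
apply/andP; split; lra.
Qed.

End Induction.

(** * Resampling a node *)

Section BadNode.
Variables (R : realType) (n : nat) (Sd : finType) (sg : Sd -> 'I_n -> R).
Variables (J L M k0 N0 : nat).
Hypotheses (L_gt1 : (1 < L)%N) (N0_gt0 : (0 < N0)%N) (J_gt0 : (0 < J)%N).
Variables (v0 : 'I_n) (adv : strategy R n) (m : nat) (kappa : R).
Hypothesis Sd_gt0 : (0 < #|Sd|)%N.
Hypothesis sg_pm : forall b i, sg b i = 1 \/ sg b i = -1.
Hypothesis sg4 : forall i j k l,
  Ex (fun b => sg b i * sg b j * sg b k * sg b l) = (paired i j k l)%:R.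
Variables (Nb : nat) (eta : R).
Hypotheses (kappa_gt0 : 0 < kappa) (eta_gt0 : 0 < eta) (eta_le1 : eta <= 1).
Hypothesis eta_kappa : 2 ^+ 15 * eta <= kappa.
Hypothesis HNb : 4 <= Nb%:R * eta ^+ 2.
Hypothesis k0_kappa : 2 ^+ 16 <= k0%:R * kappa ^+ 2 * 2 ^+ J.
Hypothesis N0m : (N0 <= m)%N.

Local Notation seeds := (seeds Sd J L M k0).
Local Notation block := (@block J L k0).
Local Notation Omega := {ffun 'I_m.+1 -> seeds}.

Definition seq_of (xi : Omega) (t : nat) : seeds := xi (inord t).

Let k0_gt0 : (0 < k0)%N.
Proof.
rewrite lt0n; apply/eqP => k00; move: k0_kappa; rewrite k00 !mul0r.
by rewrite leNgt exprn_gt0.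
Qed.

Lemma card_block l j a : (l < L)%N -> (j <= J)%N -> (a.+1 * 2 ^ j <= 2 ^ J)%N ->
  (2 ^ j * k0 <= #|block l j a|)%N.
Proof.
move=> lL jJ aJ.
have fP (x : 'I_(2 ^ j)) : (a * 2 ^ j + x < 2 ^ J)%N.
  by apply: leq_trans aJ; rewrite mulSn addnC ltn_add2r.
pose f (x : 'I_(2 ^ j) * 'I_k0) : row J L k0 :=
  (Ordinal lL, Ordinal (jJ : (j < J.+1)%N), Ordinal (fP x.1), x.2).
have f_inj : injective f.
  by move=> [x r] [y s] [/eqP]; rewrite eqn_add2l => /eqP/val_inj -> ->.
rewrite -[X in (X * _)%N]card_ord -[X in (_ * X)%N]card_ord -card_prod -(card_codom f_inj).
apply: subset_leq_card; apply/subsetP => _ /codomP[x ->].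
change (block l j a (f x)); rewrite /block /slot /level /leaf /= !eqxx.
by rewrite divnMDl ?expn_gt0 // divn_small ?addn0 ?eqxx.
Qed.

Section Node.
Variables (e j a : nat).
Hypotheses (jJ : (j <= J)%N) (aJ : (a.+1 * 2 ^ j <= 2 ^ J)%N).
Let A := block (e %% L) j a.
Let cap := last_pos J e j a.

Section Merge.
Variable T0 : 'I_m.+1.

Definition merge_rows (x w : seeds) : seeds :=
  [ffun c => [ffun i => if A i then w c i else x c i]].

Definition merge (xi : Omega) (w : seeds) : Omega :=
  [ffun s => if s == T0 then merge_rows (xi s) w else xi s].

(** Redrawing the rows of the node preserves the uniform law: exchanging old and new rows is an
    involution of the pairs [(xi, w)]. *)
Lemma Ex_merge (F : Omega -> R) :
  (0 < #|seeds|)%N -> Ex F = Ex (fun xi => Ex (fun w => F (merge xi w))).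
Proof.
move=> s0; rewrite /Ex -mulr_suml; congr (_ / _).
have sn0 : #|seeds|%:R != 0 :> R by rewrite pnatr_eq0 -lt0n.
apply/(canRL (mulfK sn0)).
rewrite pair_big /=.
pose h (p : Omega * seeds) := (merge p.1 p.2, merge_rows p.2 (p.1 T0)).
have hK : involutive h.
  move=> [xi w]; rewrite /h /=; congr (_, _).
    apply/ffunP => s; rewrite !ffunE; case: eqP => // ->.
    by apply/ffunP => c; apply/ffunP => i; rewrite !ffunE; case: (A i).
  apply/ffunP => c; apply/ffunP => i; rewrite !ffunE eqxx !ffunE.
  by case: (A i).
rewrite (reindex_inj (inv_inj hK)) /=.
transitivity (\sum_(p : Omega * seeds) F p.1).
  rewrite -(pair_big xpredT xpredT (fun xi (w : seeds) => F xi)) /= mulr_suml.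
  by apply: eq_bigr => xi _; rewrite sumr_const -[RHS]mulr_natr.
apply: eq_bigr => -[xi w] _ /=; congr F.
by have := hK (xi, w); rewrite /h /= => -[].
Qed.

Lemma merge_agree (xi : Omega) w :
  let x := seq_of (merge xi w) in let x' := seq_of xi in
  alloc sg N0 v0 adv cap x m e = T0 ->
  [/\ forall t, (t <= m)%N -> pos sg N0 v0 adv cap x t = pos sg N0 v0 adv cap x' t
    & forall t, (t <= m)%N -> upd sg N0 v0 adv cap x t = upd sg N0 v0 adv cap x' t].
Proof.
move=> x x' xT.
have H t : (t <= m)%N -> pos sg N0 v0 adv cap x t = pos sg N0 v0 adv cap x' t /\
    upd sg N0 v0 adv cap x t = upd sg N0 v0 adv cap x' t.
  move=> tm; have [] // := @traj_resample R n Sd sg J L M k0 N0 (ltnW L_gt1) v0 adv m e j a x x' J_gt0 _ _ _ t tm.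
  - rewrite -/cap xT => s sm sT; rewrite /x /x' /seq_of !ffunE.
    by case: eqP => // E; case/eqP: sT; rewrite -E inordK.
  - rewrite -/cap xT => c i Ai; rewrite /x /x' /seq_of inord_val !ffunE eqxx /merge_rows !ffunE.
    by rewrite (negPf Ai : A i = false).
  - by move=> E1 _ E3 _; split; rewrite // /upd E1.
by split=> t /H[].
Qed.

End Merge.

(** The seeding time is random, so the event is split by its value [T0]. On each piece the other
    seeds are fixed and those of the node are redrawn; the stopped stream stays the same and
    [Pr_tracking] applies to it. The pieces are disjoint, so summing over [T0] costs no factor
    [m]. *)
Lemma Pr_bad_node :
  Pr R (fun xi : Omega => bad_node sg N0 v0 adv m kappa e j a (seq_of xi))
  <= Nb.+1%:R * 2^-1 ^+ M.
Proof.
set delta := _ * _.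
have seeds_gt0 : (0 < #|seeds|)%N by rewrite !card_ffun expn_gt0 expn_gt0 Sd_gt0.
have Omega_gt0 : (0 < #|{: Omega}|)%N by rewrite card_ffun expn_gt0 seeds_gt0.
have delta0 : 0 <= delta by rewrite mulr_ge0 // exprn_ge0 // invr_ge0.
pose al (xi : Omega) := alloc sg N0 v0 adv cap (seq_of xi) m e.
pose bad xi := bad_node sg N0 v0 adv m kappa e j a (seq_of xi).
apply: (@le_trans _ _ (Pr R (fun xi => [exists T0 : 'I_m.+1, (al xi == T0) && bad xi]))).
  apply: le_Pr => xi bx; apply/existsP.
  have alm : (al xi < m.+1)%N.
    have /existsP[t /andP[/and3P[t1 _ _] _]] := bx.
    rewrite (leq_ltn_trans (alloc_start sg N0 L_gt1 v0 adv m cap (seq_of xi) e j a)) //.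
    exact: leq_ltn_trans t1 (ltn_ord t).
  by exists (Ordinal alm); rewrite eqxx.
apply: (le_trans (Pr_exists _ _)).
apply: (@le_trans _ _ (\sum_(T0 < m.+1) Ex (fun xi => delta * (al xi == T0)%:R))).
  apply: ler_sum => T0 _; rewrite /Pr (Ex_merge T0) //; apply: le_Ex => xi.
  pose us := upd sg N0 v0 adv cap (seq_of xi).
  pose t1 := start_time sg N0 v0 adv m cap (seq_of xi) e j a.
  pose Z := N2 (cnt R us 0 N0) * 2 ^+ e.
  (* Redrawing the node leaves the event of seeding at [T0] unchanged, so it can be taken out of the
     inner average. *)
  case: (eqVneq (al xi) T0) => [aT|aT]; last first.
    rewrite mulr0 (_ : Ex _ = 0) //; apply: (Pr_pred0 R) => w; apply/negP => /andP[/eqP bT _].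
    move/eqP: aT; apply; rewrite -bT /al /alloc; case: ifP => // eL.
    apply: eq_bigr => s _; have [-> //] := merge_agree bT.
    by rewrite -ltnS.
  have Tt1 : (T0 <= t1)%N.
    by rewrite -aT; exact: (alloc_start sg N0 L_gt1 v0 adv m cap (seq_of xi) e j a).
  rewrite mulr1.
  have Z0 : 0 < Z by rewrite mulr_gt0 ?exprn_gt0 // N2_cnt_gt0.
  have lL : (e %% L < L)%N by rewrite ltn_mod ltnW.
  have cA := card_block lL jJ aJ.
  have A_gt0 : (0 < #|A|)%N by apply: leq_trans cA; rewrite muln_gt0 expn_gt0 k0_gt0.
  (* Rows and [window] both scale with [2 ^ j], so one [k0] serves all levels; [2 ^ 16] is a power
     of two above [9216 * 4]. *)
  have kV : 9216 * window J Z j <= #|A|%:R * kappa ^+ 2 * Z.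
    have cA' : 2 ^+ j * k0%:R <= #|A|%:R :> R by rewrite -natrX -natrM ler_nat.
    apply: (@le_trans _ _ (2 ^+ j * k0%:R * kappa ^+ 2 * Z)); last first.
      by rewrite !ler_pM2r // ?exprn_gt0.
    have J2 : 0 < 2 ^+ J :> R by rewrite exprn_gt0.
    have j2 : 0 < 2 ^+ j :> R by rewrite exprn_gt0.
    have kk : 2 ^+ 16 / 2 ^+ J <= k0%:R * kappa ^+ 2 by rewrite ler_pdivrMr.
    have c16 : 9216 * 4 <= 2 ^+ 16 :> R by rewrite -natrM -natrX ler_nat; vm_compute.
    rewrite /window; case: ifP => lt_jJ.
      apply: (@le_trans _ _ (2 ^+ j * (2 ^+ 16 / 2 ^+ J) * Z)); last first.
        by rewrite ler_pM2r // -[leRHS]mulrA ler_pM2l.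
      rewrite !exprS (_ : 9216 * _ = 9216 * 4 / 2 ^+ J * (2 ^+ j * Z)); last by ring.
      rewrite [leRHS](_ : _ = 2 ^+ 16 / 2 ^+ J * (2 ^+ j * Z)); last by ring.
      by rewrite ler_pM2r ?(mulr_gt0 j2 Z0) // ler_pM2r // invr_gt0.
    have -> : j = J by apply/eqP; rewrite eqn_leq jJ leqNgt lt_jJ.
    rewrite mulrA ler_pM2r // (le_trans c16) //.
    by rewrite -mulrA mulrC.
  apply: le_trans (Pr_tracking Sd_gt0 sg_pm sg4 us A_gt0 M m Tt1 Z0 kappa_gt0 eta_gt0 eta_le1 eta_kappa kV HNb).
  apply: le_Pr => w /andP[/eqP bT].
  have [posE updE] := merge_agree bT.
  have alE : alloc sg N0 v0 adv cap (seq_of (merge T0 xi w)) m e = T0 := bT.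
  have t1E : start_time sg N0 v0 adv m cap (seq_of (merge T0 xi w)) e j a = t1.
    rewrite /t1 /start_time; case: ifP => _; last by rewrite alE -aT.
    by apply: eq_bigr => s _; rewrite posE // -ltnS.
  have cntE T t : (t <= m)%N ->
      cnt R (upd sg N0 v0 adv cap (seq_of (merge T0 xi w))) T t = cnt R us T t.
    move=> tm; apply: boolp.funext => i; congr (_%:R).
    by apply: eq_big_nat => s /andP[_ st]; rewrite updE // (leq_trans (ltnW st)).
  rewrite /bad /bad_node -/cap alE t1E !(cntE 0 N0) // -/Z => /existsP[t /andP[/and3P[t1t h2 h3] h4]].
  have tm : (t <= m)%N by rewrite -ltnS.
  have t1m := leq_trans t1t tm.
  rewrite cntE // in h2; rewrite cntE // in h3; rewrite !cntE // -/A in h4.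
  apply/existsP; exists t; rewrite /in_range t1t h2 h3 /=.
  suff -> : median_est sg us A T0 t1 w t = 
    median_est sg (upd sg N0 v0 adv cap (seq_of (merge T0 xi w))) A T0 t1 (seq_of (merge T0 xi w) T0) t by [].
  congr median; apply: boolp.funext => c; congr (_ / _); apply: eq_bigr => i Ai.
  have -> : seq_of (merge T0 xi w) T0 c i = w c i.
    by rewrite /seq_of inord_val !ffunE eqxx !ffunE (Ai : A i = true).
  by rewrite !cntE.
rewrite -Ex_sum; apply: le_trans (Ex_cst_le Omega delta0); apply: le_Ex => xi.
rewrite -mulr_sumr -[leRHS]mulr1 ler_wpM2l // -natr_sum lern1.
case: (ltnP (al xi) m.+1) => H.
  by rewrite (bigD1 (Ordinal H)) //= eqxx big1 // => T0; rewrite -val_eqE eq_sym /= => /negPf->.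
rewrite big1 // => T0 _; case: eqP => // E.
by have := ltn_ord T0; rewrite -E ltnNge H.
Qed.

End Node.

Definition bad_any (E : nat) (xi : Omega) : bool :=
  [exists e : 'I_E, exists j : 'I_J.+1, exists a : 'I_(2 ^ J),
    (a.+1 * 2 ^ j <= 2 ^ J)%N && bad_node sg N0 v0 adv m kappa e j a (seq_of xi)].

Lemma Pr_bad_any (E : nat) :
  Pr R (bad_any E) <= (E * J.+1 * 2 ^ J)%:R * (Nb.+1%:R * 2^-1 ^+ M).
Proof.
set delta := _.+1%:R * _.
have delta0 : 0 <= delta by rewrite mulr_ge0 // exprn_ge0 // invr_ge0.
apply: (le_trans (Pr_exists _ _)).
apply: (@le_trans _ _ (\sum_(e < E) \sum_(j < J.+1) \sum_(a < 2 ^ J) delta)).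
  apply: ler_sum => e _; apply: (le_trans (Pr_exists _ _)).
  apply: ler_sum => j _; apply: (le_trans (Pr_exists _ _)).
  apply: ler_sum => a _; case: leqP => aJ /=; last by rewrite Pr_pred0.
  by apply: Pr_bad_node => //; rewrite -ltnS.
rewrite !sumr_const !card_ord -!mulrnA [leRHS]mulr_natl.
by rewrite [X in delta *+ X <= _](_ : _ = (E * J.+1 * 2 ^ J)%N) //; ring.
Qed.

End BadNode.

(** * Law of the memory and encoding *)

Section Law.
Variables (R : realType) (X T : finType).
Hypothesis X_gt0 : (0 < #|X|)%N.

Lemma pushforward_sum1 (f : X -> T) : \sum_y Pr R (fun x => f x == y) = 1.
Proof.
rewrite -Ex_sum -[RHS](Ex_cst (T := X)) //; apply: eq_Ex => x.
by rewrite (bigD1 (f x)) //= eqxx big1 ?addr0 // => y; rewrite eq_sym => /negPf->.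
Qed.

Definition pushforward (f : X -> T) : fdist R T :=
  FDist (fun y => Pr_ge0 R (fun x => f x == y)) (pushforward_sum1 f).

End Law.

Section RunLaw.
Variables (R : realType) (n b m : nat) (X : finType).
Hypothesis X_gt0 : (0 < #|X|)%N.
Local Notation B := (b.-tuple bool).
Variables (init : X -> B) (step : B -> 'I_n -> X -> B) (out : B -> R).

Definition seeded_alg : streaming_alg R n b :=
  StreamingAlg (pushforward R X_gt0 init) (fun q u => pushforward R X_gt0 (step q u)) out.

Variables (adv : strategy R n) (beta : {ffun 'I_m.+1 -> X} -> nat -> B).
Hypothesis beta0 : forall xi, beta xi 0 = init (xi ord0).
Hypothesis betaS : forall xi t, (t < m)%N -> beta xi t.+1 =
  step (beta xi t) (adv [seq out (beta xi s) | s <- iota 1 t]) (xi (inord t.+1)).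

Definition run_of (xi : {ffun 'I_m.+1 -> X}) : run b m := [ffun t : 'I_m.+1 => beta xi t].

Lemma run_of_inord xi t : (t <= m)%N -> run_of xi (inord t) = beta xi t.
Proof. by move=> tm; rewrite ffunE inordK. Qed.

Lemma outputs_run_of xi t : (t <= m)%N ->
  outputs seeded_alg (run_of xi) t = [seq out (beta xi s) | s <- iota 1 t].
Proof.
move=> tm; apply/eq_in_map => s; rewrite mem_iota => /andP[_ st].
by rewrite /= run_of_inord //; lia.
Qed.

(** The run is [p] exactly when every single seed maps one state of [p] to the next. These are
    events on different coordinates of [xi], so their probabilities multiply. *)
Lemma run_probE p : run_prob seeded_alg adv p = Pr R (fun xi => run_of xi == p).
Proof.
pose H (t : 'I_m.+1) (x : X) : bool :=
  if nat_of_ord t is t'.+1 then step (p (inord t')) (adv (outputs seeded_alg p t')) x == p t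
  else init x == p t.
transitivity (\prod_(t < m.+1) Pr R (H t)).
  rewrite big_ord_recl; congr (_ * _).
  apply: eq_bigr => t _; apply: eq_Ex => x.
  rewrite /H lift0 (_ : lift ord0 t = inord t.+1) //.
  by apply: ord_inj; rewrite lift0 inordK // ltnS.
rewrite -(Ex_prod (fun t x => (H t x)%:R)); apply: eq_Ex => xi.
rewrite -natr_prod; congr (_%:R).
transitivity (nat_of_bool [forall t, H t (xi t)]).
  case: forallP => [Ht|/forallP]; first by rewrite big1 // => t _; rewrite Ht.
  by rewrite negb_forall => /existsP[t /negPf Ht]; rewrite (bigD1 t) //= Ht.
congr nat_of_bool; apply/forallP/eqP => [Ht|rp t].
  have bE t : (t <= m)%N -> beta xi t = p (inord t).
    have [k] := ubnP t; elim: k t => // k IHk [|t] tk tm.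
      have := Ht ord0; rewrite /H /= beta0 => /eqP->.
      by congr (p _); apply: val_inj; rewrite /= inordK.
    rewrite betaS // IHk // 1?ltnW //.
    have -> : [seq out (beta xi s) | s <- iota 1 t] = outputs seeded_alg p t.
      apply/eq_in_map => s; rewrite mem_iota => /andP[_ st].
      by rewrite IHk //; lia.
    by have := Ht (inord t.+1); rewrite /H inordK // => /eqP.
  by apply/ffunP => t; rewrite ffunE (bE _ (ltn_ord t)) inord_val.
rewrite /H -rp /=; case: t => -[|t] tm /=.
  by rewrite ffunE /= beta0 (_ : Ordinal tm = ord0) //; apply: val_inj.
have tm' : (t < m)%N by [].
rewrite outputs_run_of 1?ltnW // run_of_inord 1?ltnW // ffunE /= betaS //.
by rewrite (_ : inord t.+1 = Ordinal tm) //; apply: val_inj; rewrite /= inordK.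
Qed.

Lemma success_probE eps :
  success_prob seeded_alg m eps adv = Pr R (fun xi => run_correct seeded_alg eps adv (run_of xi)).
Proof.
rewrite /success_prob; under eq_bigr do rewrite run_probE.
rewrite -Ex_sum; apply: eq_Ex => xi; rewrite big_mkcond (bigD1 (run_of xi)) //= eqxx.
rewrite big1 ?addr0 => [|p]; first by case: ifP.
by rewrite eq_sym => /negPf->; case: ifP.
Qed.

End RunLaw.

Lemma exists_code (T : finType) (b : nat) : (0 < #|T|)%N -> (#|T| <= 2 ^ b)%N ->
  exists (f : T -> b.-tuple bool) (g : b.-tuple bool -> T), cancel f g.
Proof.
case/card_gt0P=> x0 _ Tb.
have bE : #|{: b.-tuple bool}| = (2 ^ b)%N by rewrite card_tuple card_bool.
have fP (x : T) : (enum_rank x < #|{: b.-tuple bool}|)%N.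
  by rewrite bE (leq_trans _ Tb).
pose f x : b.-tuple bool := enum_val (Ordinal (fP x)).
exists f, (fun q => odflt x0 [pick x | f x == q]) => x.
case: pickP => [y /eqP/enum_val_inj/(congr1 val)/= /val_inj/enum_rank_inj//|/(_ x)].
by rewrite eqxx.
Qed.

Section Encoding.
Variables (R : realType) (n : nat) (Sd : finType) (sg : Sd -> 'I_n -> R).
Variables (J L M k0 N0 m : nat).
Hypothesis sg_pm : forall b i, sg b i = 1 \/ sg b i = -1.
Local Notation mem := (mem R n Sd J L M k0 N0).

(** Sketches are integers between [- m] and [m], stored with offset [m]. *)
Definition counter := 'I_(m.*2.+1).
Definition dec_counter (o : counter) : R := o%:R - m%:R.
Definition enc_counter (x : R) : counter :=
  odflt ord0 [pick o | dec_counter o == x].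

Definition bounded (t : nat) (x : R) : Prop :=
  exists o : nat, [/\ x = o%:R - m%:R, (m <= o + t)%N & (o <= m + t)%N].

Lemma enc_counterK t x : (t <= m)%N -> bounded t x -> dec_counter (enc_counter x) = x.
Proof.
move=> tm [o [xE o1 o2]]; have om : (o < m.*2.+1)%N by lia.
rewrite /enc_counter; case: pickP => [o' /eqP //|/(_ (Ordinal om))].
by rewrite /dec_counter xE eqxx.
Qed.

Lemma bounded0 t : bounded t 0.
Proof. by exists m; rewrite subrr; split => //; rewrite leq_addr. Qed.

Lemma boundedS t x (c : bool) s i : (t < m)%N -> bounded t x ->
  bounded t.+1 (x + c%:R * sg s i).
Proof.
move=> tm [o [-> o1 o2]]; case: c; last first.
  by exists o; rewrite mul0r addr0; split => //; lia.
rewrite mul1r; case: (sg_pm s i) => ->.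
  by exists o.+1; split; [rewrite -natr1; ring|lia|lia].
exists o.-1; split; [|lia|lia].
have {1}-> : o = o.-1.+1 by lia.
by rewrite -natr1; ring.
Qed.

Definition enc_mem_type : finType :=
  ('I_m.+1 * {ffun 'I_N0 -> 'I_n} * 'I_m.+1 *
   {ffun 'I_M -> {ffun row J L k0 -> Sd * counter * counter}})%type.

Definition enc_mem (s : mem) : enc_mem_type :=
  (inord (mtime s), mhist s, inord (mpos s),
   [ffun c => [ffun i => let: (b, x, y) := mrows s c i in
                         (b, enc_counter x, enc_counter y)]]).

Definition dec_mem (q : enc_mem_type) : mem :=
  let: (t, h, p, r) := q in
  Mem t h p [ffun c => [ffun i => let: (b, x, y) := r c i in
                                  (b, dec_counter x, dec_counter y)]].

Lemma enc_memK (s : mem) t : (t <= m)%N -> mtime s = t -> (mpos s <= t)%N ->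
  (forall c i, bounded t (mrows s c i).1.2 /\ bounded t (mrows s c i).2) ->
  dec_mem (enc_mem s) = s.
Proof.
case: s => t' h p r /= tm tE pt rb; rewrite /dec_mem /=.
rewrite !inordK ?tE ?(leq_ltn_trans pt) //; congr Mem.
apply/ffunP => c; apply/ffunP => i; rewrite !ffunE.
by have := rb c i; case: (r c i) => -[b x] y /= [bx by_]; rewrite !(enc_counterK tm).
Qed.

Variables (v0 : 'I_n) (adv : strategy R n) (cap : nat) (xi : nat -> seeds Sd J L M k0).

Lemma memo_bounded t c i : (t <= m)%N ->
  let q := mrows (memo sg N0 v0 adv cap xi t) c i in bounded t q.1.2 /\ bounded t q.2.
Proof.
elim: t => [|t IHt] tm /=.
  by rewrite /memo /= !ffunE; split; exact: bounded0.
have := IHt (ltnW tm); rewrite memoS /=.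
set r := mrows _; move=> /= rb.
have Ha : let q := add_update sg (mpos (memo sg N0 v0 adv cap xi t)) (upd sg N0 v0 adv cap xi t) r c i in
   bounded t.+1 q.1.2 /\ bounded t.+1 q.2.
  rewrite /= !ffunE; move: rb; case: (r c i) => -[b x] y /= [bx by_].
  by split; apply: boundedS.
case: ifP => _; last exact: Ha.
by rewrite reseedE; case: ifP => _ //; split; exact: bounded0.
Qed.

Lemma memo_encK t : (t <= m)%N ->
  dec_mem (enc_mem (memo sg N0 v0 adv cap xi t)) = memo sg N0 v0 adv cap xi t.
Proof.
move=> tm; apply: (enc_memK tm); first exact: mtimeE.
  exact: pos_le.
by move=> c i; apply: memo_bounded.
Qed.

End Encoding.

(** * Robustness of the encoded algorithm, given the parameter inequalities *)

Section Robust.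
Variables (R : realType) (n : nat) (Sd : finType) (sg : Sd -> 'I_n -> R).
Variables (J L M k0 N0 m b E Nb : nat) (kappa eta : R).
Hypotheses (n_gt0 : (0 < n)%N).
Hypotheses (L_gt1 : (1 < L)%N) (N0_gt0 : (0 < N0)%N) (J_gt0 : (0 < J)%N).
Hypothesis Sd_gt0 : (0 < #|Sd|)%N.
Hypothesis sg_pm : forall b i, sg b i = 1 \/ sg b i = -1.
Hypothesis sg4 : forall i j k l,
  Ex (fun b => sg b i * sg b j * sg b k * sg b l) = (paired i j k l)%:R.
Hypotheses (eta_gt0 : 0 < eta) (eta_le1 : eta <= 1).
Hypothesis eta_kappa : 2 ^+ 15 * eta <= kappa.
Hypothesis HNb : 4 <= Nb%:R * eta ^+ 2.
Hypothesis k0_kappa : 2 ^+ 16 <= k0%:R * kappa ^+ 2 * 2 ^+ J.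
Hypothesis kappaE : kappa * (8 * J.+2%:R * 2 ^+ J) = 1.
Hypothesis kappaL : 64 <= kappa ^+ 2 * 2 ^+ L.
Hypothesis N0J : 1024 * (2 ^+ J) ^+ 2 <= N0%:R :> R.
Hypothesis mE : 2 * m%:R ^+ 2 <= 2 ^+ E :> R.
Hypothesis failure : (E * J.+1 * 2 ^ J)%:R * (Nb.+1%:R * 2^-1 ^+ M) <= 3^-1 :> R.
Variable eps : R.
Hypotheses (epsJ : 2 <= eps * 2 ^+ J) (eps_half : eps <= 2^-1).
Hypothesis card_enc : (#|enc_mem_type n Sd J L M k0 N0 m| <= 2 ^ b)%N.

Let v0 : 'I_n := Ordinal n_gt0.
Let cap := (E * 2 ^ J).+1.

Lemma exists_robust_alg : exists A : streaming_alg R n b, robust A m eps (2%:R / 3%:R).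
Proof.
have enc_gt0 : (0 < #|enc_mem_type n Sd J L M k0 N0 m|)%N.
  by rewrite !card_prod !card_ffun !card_prod !card_ord !(muln_gt0, expn_gt0) n_gt0 Sd_gt0.
have [f [g fK]] := exists_code enc_gt0 card_enc.
have seeds_gt0 : (0 < #|seeds Sd J L M k0|)%N by rewrite !card_ffun expn_gt0 expn_gt0 Sd_gt0.
pose enc (s : mem R n Sd J L M k0 N0) := f (enc_mem m s); pose dec q : mem R n Sd J L M k0 N0 := dec_mem R (g q).
pose A := @seeded_alg R n b (seeds Sd J L M k0) seeds_gt0 (fun x => enc (minit R N0 v0 x))
  (fun q u x => enc (mstep sg cap (dec q) u x)) (fun q => mout (dec q)).
have succ adv : 2 / 3 <= success_prob A m eps adv.
  pose x xi := @seq_of Sd J L M k0 m xi.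
  pose beta xi t := enc (memo sg N0 v0 adv cap (x xi) t).
  have decK xi t : (t <= m)%N -> dec (beta xi t) = memo sg N0 v0 adv cap (x xi) t.
    by move=> tm; rewrite /dec /beta /enc fK memo_encK.
  have outE xi t : (t <= m)%N -> [seq mout (dec (beta xi s)) | s <- iota 1 t]
      = (traj sg N0 v0 adv cap (x xi) t).2.
    move=> tm; rewrite outputs_traj; apply/eq_in_map => s; rewrite mem_iota => /andP[_ st].
    by rewrite decK // (leq_trans _ tm) // -ltnS -add1n.
  have b0 xi : beta xi 0 = enc (minit R N0 v0 (xi ord0)).
    rewrite /beta /memo /= /x /seq_of (_ : inord 0 = ord0) //.
    by apply: val_inj; rewrite /= inordK.
  have bS xi t : (t < m)%N -> beta xi t.+1 = enc (mstep sg cap (dec (beta xi t))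
      (adv [seq mout (dec (beta xi s)) | s <- iota 1 t]) (xi (inord t.+1))).
    by move=> tm; rewrite outE 1?ltnW // decK 1?ltnW // /beta memoS.
  rewrite (success_probE seeds_gt0 b0 bS).
  have correctE xi : (forall t, (t <= m)%N -> approx eps (mout (memo sg N0 v0 adv cap (x xi) t))
       (N2 (cnt R (upd sg N0 v0 adv cap (x xi)) 0 t))) ->
      run_correct A eps adv (run_of beta xi).
    move=> H; apply/forallP => t; have tm : (t < m)%N := ltn_ord t.
    rewrite run_of_inord // [alg_out _ _]/= decK //; have := H _ tm.
    have -> : updates A adv (run_of beta xi) t.+1
        = [seq upd sg N0 v0 adv cap (x xi) s | s <- iota 0 t.+1].
      apply/eq_in_map => s; rewrite mem_iota add0n => /andP[_ st].
      have sm : (s <= m)%N := ltnW (leq_trans st tm).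
      by rewrite outputs_run_of // outE.
    congr (approx _ _ _); rewrite /F2 /N2 natr_sum; apply: eq_bigr => i _.
    rewrite natrX; congr (_%:R ^+ 2); rewrite /freq count_map -sum1_count.
    rewrite /index_iota subn0 [RHS]big_mkcond /=; apply: eq_bigr => s _.
    by case: (_ == _).
  have Omega_gt0 : (0 < #|{ffun 'I_m.+1 -> seeds Sd J L M k0}|)%N.
    by rewrite card_ffun expn_gt0 seeds_gt0.
  (* A stream shorter than [N0] ends within the storing phase, where all outputs are exact; the
     probability bounds assume [N0 <= m]. *)
  have [N0m|mN0] := leqP N0 m; last first.
    apply: (@le_trans _ _ 1); first by lra.
    rewrite -(Ex_cst (T := {ffun 'I_m.+1 -> seeds Sd J L M k0}) 1) //.
    apply: le_Ex => xi; rewrite correctE // => t tm.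
    have tN0 := leq_ltn_trans tm mN0.
    have eps0 : 0 < eps.
      by rewrite -(pmulr_lgt0 _ (_ : 0 < 2 ^+ J)) ?exprn_gt0 //; apply: lt_le_trans epsJ.
    rewrite /approx /mout -/(pos sg N0 v0 adv cap (x xi) t) pos_eq0 // eqxx mtimeE hist_F2E // 1?ltnW //.
    by rewrite ler_piMl ?ler_peMl ?N2_ge0 // ?lerDl ?gerBl ltW.
  have kappa_gt0 : 0 < kappa by apply: lt_le_trans eta_kappa; rewrite mulr_gt0 ?exprn_gt0.
  apply: (@le_trans _ _ (1 - Pr R (bad_any (k0 := k0) sg N0 v0 adv (m := m) kappa E))).
    have := Pr_bad_any M L_gt1 N0_gt0 J_gt0 v0 adv Sd_gt0 sg_pm sg4 kappa_gt0 eta_gt0 eta_le1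
      eta_kappa HNb k0_kappa N0m E.
    move=> /le_trans/(_ failure); lra.
  rewrite (PrC R _ Omega_gt0) opprD opprK addrA subrr add0r.
  apply: le_Pr => xi gx; apply: correctE => t tm.
  apply: (good_approx L_gt1 N0_gt0 J_gt0 kappaE kappaL N0J mE _ _ epsJ eps_half tm) => //.
  move=> e j a eE jJ aJ; apply/negP => be; move/negP: gx; apply.
  have a2 : (a < 2 ^ J)%N by apply: leq_trans aJ; rewrite leq_pmulr // expn_gt0.
  apply/existsP; exists (Ordinal eE); apply/existsP; exists (Ordinal (jJ : (j < J.+1)%N)).
  by apply/existsP; exists (Ordinal a2); rewrite /= aJ.
exists A => Om seed adv.
(* The bound holds for every deterministic strategy, hence on average over the private seed of the
   adversary. *)
apply: (@le_trans _ _ (\sum_w seed w * (2 / 3))).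
  by rewrite -mulr_suml fdist_sum1 mul1r.
by apply: ler_sum => w _; rewrite ler_wpM2l // fdist_ge0.
Qed.

End Robust.

(** * Space *)

Section Log2.
Variable R : realType.

Lemma ln2_gt0 : 0 < ln (2%:R : R).
Proof. by rewrite ln_gt0 // ltr1n. Qed.

Lemma log2_le (x y : R) : 0 < x -> x <= y -> log2 x <= log2 y.
Proof.
move=> x0 xy; rewrite /log2 ler_pM2r ?invr_gt0 ?ln2_gt0 // ler_ln // posrE //.
exact: lt_le_trans xy.
Qed.

Lemma log2M (x y : R) : 0 < x -> 0 < y -> log2 (x * y) = log2 x + log2 y.
Proof. by move=> x0 y0; rewrite /log2 lnM ?posrE // mulrDl. Qed.

Lemma log2_expr2 k : log2 (2 ^+ k : R) = k%:R.
Proof.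
by rewrite /log2 lnXn // -[_ *+ k]mulr_natl mulfK // gt_eqF // ln2_gt0.
Qed.

Lemma log2_ge_nat k (x : R) : 2 ^+ k <= x -> k%:R <= log2 x.
Proof. by rewrite -[X in X <= log2 _]log2_expr2 => /log2_le; apply; rewrite exprn_gt0. Qed.

Lemma up_log_le (x : nat) : (0 < x)%N -> (up_log 2 x)%:R <= log2 (x%:R : R) + 1.
Proof.
case: x => // -[|x] _; first by rewrite up_log1 addr_ge0 // (@log2_ge_nat 0) // expr0.
have /andP[H _] := @up_log_bounds 2 x.+2 isT isT.
have k0 : (0 < up_log 2 x.+2)%N by rewrite up_log_gt0.
rewrite -(prednK k0) -natr1 lerD2r; apply: log2_ge_nat.
by rewrite -natrX ler_nat ltnW.
Qed.

End Log2.

Lemma exists_pow2 (R : realType) (x : R) : 4 <= x ->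
  exists J, [/\ (0 < J)%N, x <= 2 ^+ J & 2 ^+ J <= 2 * x].
Proof.
move=> x4; have ex : exists J, x <= 2 ^+ J.
  exists (Num.truncn x).+1; apply: (le_trans (ltW (truncnS_gt x))).
  by rewrite -natrX ler_nat ltnW // ltn_expl.
case: (ex_minnP ex) => -[|J] xJ Jmin; first by rewrite expr0 in xJ; lra.
exists J.+1; split => //; rewrite exprS ler_pM2l // leNgt; apply/negP => /ltW/Jmin.
by rewrite ltnn.
Qed.

(** Here [lam], [l], [ll], [ie] are [log n], [log (1 / eps)], [log log n], [1 / eps]; [lnn] and [lm]
    are the bit lengths of an item and a time, [j] is [J] and [q] is [2 ^ J]. The three summands are
    the time and position, the stored prefix, and the rows. *)
Lemma space_arith (R : realType) (K lam l ll ie lnn lm j M q c : R) :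
  0 < K -> 1 <= lam -> 1 <= l -> 0 <= ll -> 1 <= ie ->
  0 <= lnn <= 2 * lam -> 0 <= lm <= (K + 1) * lam -> 0 <= q <= 4 * ie ->
  0 <= j <= 3 * l -> 0 <= c -> 0 <= M <= c * (l + ll) ->
  2 * (lm + 1) + 2 ^+ 10 * q ^+ 2 * lnn
   + M * ((4 * j + 14) * (j + 1) * q * (2 ^+ 22 * (j + 2) ^+ 2 * q))
     * (3 * lnn + 2 * (lm + 2))
  <= (2 * (K + 2) + 2 ^+ 15 + c * (26 * 4 * 4 * (2 ^+ 22 * 5 ^+ 2 * 4)) * (2 * K + 12))
     * (ie ^+ 2 * lam * l ^+ 4 * (l + ll)).
Proof.
move=> K0 lam1 l1 ll0 ie1 /andP[lnn0 lnn2] /andP[lm0 lm2] /andP[q0 q2] /andP[j0 j2] c0 /andP[M0 M2].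
set P := ie ^+ 2 * lam * l ^+ 4 * (l + ll).
have ie2 : 1 <= ie ^+ 2 by rewrite exprn_ege1.
have l4 : 1 <= l ^+ 4 by rewrite exprn_ege1.
have H1 : 1 <= l + ll by lra.
have ge0 (x : R) : 1 <= x -> 0 <= x by move=> /(le_trans ler01).
have lamP : ie ^+ 2 * lam <= P.
  rewrite /P -[leLHS]mulr1 -[leRHS]mulrA; apply: ler_pM => //.
    by rewrite mulr_ge0 // ge0.
  by rewrite mulr_ege1.
have lamP' : lam <= P by apply: le_trans lamP; rewrite ler_peMl // ge0.
rewrite !(mulrDl _ _ P); apply: lerD; first apply: lerD.
- apply: (@le_trans _ _ (2 * (K + 2) * lam)); last by rewrite ler_wpM2l // mulr_ge0 // addr_ge0 // ltW.
  have : K * lam + lam = (K + 1) * lam by ring.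
  have : 2 * (K + 2) * lam = 2 * (K * lam) + 4 * lam by ring.
  by move=> -> E; rewrite -E in lm2; lra.
- apply: (@le_trans _ _ (2 ^+ 10 * (4 * ie) ^+ 2 * (2 * lam))).
    rewrite ler_pM // ?mulr_ge0 ?exprn_ge0 //.
    by rewrite ler_pM2l ?exprn_gt0 // lerXn2r ?nnegrE // mulr_ge0 // ge0.
  rewrite (_ : 2 ^+ 10 * _ * _ = 2 ^+ 15 * (ie ^+ 2 * lam)); last by ring.
  by rewrite ler_pM2l ?exprn_gt0.
have j1 : 4 * j + 14 <= 26 * l by lra.
have j3 : j + 1 <= 4 * l by lra.
have j4 : j + 2 <= 5 * l by lra.
have j20 : 0 <= j + 2 by lra.
have b1 : 3 * lnn + 2 * (lm + 2) <= (2 * K + 12) * lam.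
  have : K * lam + lam = (K + 1) * lam by ring.
  have : (2 * K + 12) * lam = 2 * (K * lam) + 12 * lam by ring.
  by move=> -> E; rewrite -E in lm2; lra.
have pos_a : 0 <= 4 * j + 14 by lra.
have pos_b : 0 <= j + 1 by lra.
have pos_k : 0 <= 2 ^+ 22 * (j + 2) ^+ 2 * q by rewrite !mulr_ge0 ?exprn_ge0.
apply: (@le_trans _ _ (c * (l + ll) * (26 * l * (4 * l) * (4 * ie) * (2 ^+ 22 * (5 * l) ^+ 2 * (4 * ie)))
   * ((2 * K + 12) * lam))); last first.
  rewrite le_eqVlt; apply/orP; left; apply/eqP; rewrite /P; ring.
have pos_abq : 0 <= (4 * j + 14) * (j + 1) * q by rewrite !mulr_ge0.
apply: ler_pM => //; first by rewrite mulr_ge0 // mulr_ge0.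
  by lra.
apply: ler_pM => //; first by rewrite mulr_ge0.
apply: ler_pM => //.
  apply: ler_pM => //; first by rewrite mulr_ge0.
  exact: ler_pM.
apply: ler_pM => //; first by rewrite mulr_ge0 ?exprn_ge0.
rewrite ler_pM2l ?exprn_gt0 // lerXn2r ?nnegrE //; lra.
Qed.

Lemma succ_le_exp2 k : (k.+1 <= 2 ^ k)%N.
Proof. exact: ltn_expl. Qed.

Lemma kappa_lower (R : realType) (J : nat) :
  2^-1 ^+ (2 * J + 4) <= (8 * J.+2%:R * 2 ^+ J)^-1 :> R.
Proof.
rewrite exprVn lef_pV2 ?posrE ?mulr_gt0 ?exprn_gt0 //.
have -> : 2 ^+ (2 * J + 4) = 8 * 2 ^+ J.+1 * 2 ^+ J :> R.
  rewrite (_ : (2 * J + 4 = 3 + J.+1 + J)%N); last by lia.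
  by rewrite !exprD; congr (_ * _ * _); ring.
by rewrite ler_pM2r ?exprn_gt0 // ler_pM2l // -natrX ler_nat succ_le_exp2.
Qed.

Lemma rows_suffice (R : realType) (z x y : R) : x != 0 -> y != 0 ->
  (z * 8 ^+ 2) * x ^+ 2 * y * ((8 * x * y)^-1) ^+ 2 * y = z.
Proof. by move=> x0 y0; field; rewrite y0. Qed.

(** Nodes times segments number at most [2 ^ (lE + 6 * J + 41)]; the two further copies in the
    exponent leave 1/4. *)
Lemma failure_bound (R : realType) (E lE J : nat) : (E <= 2 ^ lE)%N ->
  (E * J.+1 * 2 ^ J)%:R * ((2 ^ (4 * J + 40)).+1%:R * 2^-1 ^+ (lE + 6 * J + 43))
    <= 3^-1 :> R.
Proof.
move=> ElE; apply: (@le_trans _ _ (2 ^+ (lE + J + J) * (2 ^+ (4 * J + 41) * 2^-1 ^+ (lE + 6 * J + 43)))).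
  apply: ler_pM => //; first by rewrite mulr_ge0 // exprn_ge0 // invr_ge0.
    rewrite -natrX ler_nat !expnD leq_mul2r; apply/orP; right.
    by apply: leq_mul => //; exact: succ_le_exp2.
  rewrite ler_wpM2r ?exprn_ge0 ?invr_ge0 // -natrX ler_nat.
  have g k : ((2 ^ k).+1 <= 2 ^ k.+1)%N.
    by rewrite expnS mul2n -addnn -addn1 leq_add2l expn_gt0.
  by rewrite (_ : (4 * J + 41)%N = (4 * J + 40).+1) ?g // addnS.
rewrite mulrA -exprD (_ : (lE + 6 * J + 43 = lE + J + J + (4 * J + 41) + 2)%N); last by lia.
rewrite [X in _ * X]exprD mulrA -exprMn divff ?pnatr_eq0 // expr1n mul1r.
by rewrite exprVn lef_pV2 ?posrE ?exprn_gt0 // -natrX ler_nat.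
Qed.

(* The factor 2^22 is kept inside an existential so that it is never computed
   in unary. *)
Lemma exists_rows (R : realType) (J : nat) :
  exists k0 : nat, k0%:R = 2 ^+ 22 * (J%:R + 2) ^+ 2 * 2 ^+ J :> R.
Proof.
move: 22%N => a; exists (2 ^ a * J.+2 ^ 2 * 2 ^ J)%N.
by rewrite !natrM !natrX -(natrD _ J 2) addn2.
Qed.

Lemma card_enc_le (n d J L M k0 N0 m lnn lm b : nat) :
  (n <= 2 ^ lnn)%N -> (m <= 2 ^ lm)%N -> (0 < m)%N ->
  b = (2 * (lm + 1) + N0 * lnn + M * (L * J.+1 * 2 ^ J * k0) * (d + 2 * (lm + 2)))%N ->
  (#|enc_mem_type n {ffun 'I_d -> bool} J L M k0 N0 m| <= 2 ^ b)%N.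
Proof.
move=> nl ml m0 ->; rewrite !card_prod !card_ffun !card_prod !card_ord card_ffun card_bool card_ord.
have m1 : (m.+1 <= 2 ^ (lm + 1))%N.
  by move: ml; rewrite expnD expn1; move: (2 ^ lm)%N => x; lia.
have m2 : (m.*2.+1 <= 2 ^ (lm + 2))%N.
  by move: ml; rewrite expnD -[(2 ^ 2)%N]/4%N; move: (2 ^ lm)%N => x; lia.
have -> : (2 * (lm + 1) + N0 * lnn + M * (L * J.+1 * 2 ^ J * k0) * (d + 2 * (lm + 2))
   = (lm + 1) + lnn * N0 + (lm + 1) + (d + (lm + 2) + (lm + 2)) * (L * J.+1 * 2 ^ J * k0) * M)%N by ring.
have lt a b' e : (a <= b')%N -> (a ^ e <= b' ^ e)%N.
  by move=> ab; case: e => // e; rewrite leq_exp2r.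
have e1 (u v w r : nat) : (2 ^ (u + v + u + w * r * M) = 2 ^ u * 2 ^ v * 2 ^ u * ((2 ^ w) ^ r) ^ M)%N.
  by rewrite !expnD !expnM.
rewrite e1; apply: leq_mul.
  by apply: leq_mul => //; apply: leq_mul => //; rewrite expnM; apply: lt.
apply: (lt); apply: (lt); rewrite (expnD 2 (d + (lm + 2)) (lm + 2)) (expnD 2 d (lm + 2)).
by apply: leq_mul => //; apply: leq_mul.
Qed.

Lemma bits_natr (R : realType) (lm N0 lnn M L J k0 d : nat) :
  (2 * (lm + 1) + N0 * lnn + M * (L * J.+1 * 2 ^ J * k0) * (d + 2 * (lm + 2)))%:R
  = 2 * (lm%:R + 1) + N0%:R * lnn%:R
    + M%:R * (L%:R * (J%:R + 1) * 2 ^+ J * k0%:R) * (d%:R + 2 * (lm%:R + 2)) :> R.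
Proof. by rewrite !(natrD, natrM, natrX) -[J.+1%:R]natr1. Qed.

Theorem mainTheorem6 (R : realType) (K : R) (hK : 0 < K) :
  exists C : R, 0 < C /\
    forall (eps : R) (n m : nat),
      0 < eps -> (1 < n)%N -> (0 < m)%N ->
      log2 (m%:R : R) <= K * log2 (n%:R : R) ->
      exists (b : nat) (A : streaming_alg R n b),
        b%:R <= C * space_bound eps n /\
        robust A m eps (2%:R / 3%:R).
Proof.
(* [62 = 18 + 1 + 43] from [M]: the bound [6 J <= 18 l], the rounding in [lE], and the additive
   constant. *)
pose c : R := log2 (2 * K + 3) + 62.
have K3 : 1 <= 2 * K + 3 by lra.
have lK : 0 <= log2 (2 * K + 3) by rewrite (@log2_ge_nat _ 0) // expr0.
have c0 : 0 <= c by rewrite addr_ge0.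
pose C := 2 * (K + 2) + 2 ^+ 15 + c * (26 * 4 * 4 * (2 ^+ 22 * 5 ^+ 2 * 4)) * (2 * K + 12).
exists C; split.
  rewrite /C ltr_pwDl //.
    by rewrite addr_gt0 ?exprn_gt0 // mulr_gt0 // addr_gt0.
  by rewrite mulr_ge0 ?addr_ge0 ?mulr_ge0 ?exprn_ge0 // ltW.
move=> eps n m eps0 n1 m0 mn.
pose e : R := Num.min eps 2^-1; pose lam := log2 (n%:R : R); pose l := log2 e^-1.
have e0 : 0 < e by rewrite lt_min eps0 invr_gt0 ltr0n.
have e_half : e <= 2^-1 by rewrite ge_min lexx orbT.
have e_eps : e <= eps by rewrite ge_min lexx.
have ie2 : 2 <= e^-1 by rewrite -[2]invrK lef_pV2 ?posrE ?invr_gt0.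
have l1 : 1 <= l by apply: (@log2_ge_nat _ 1); rewrite expr1.
have lam1 : 1 <= lam by apply: (@log2_ge_nat _ 1); rewrite expr1 ler_nat.
have ll0 : 0 <= log2 lam by have := @log2_ge_nat R 0 lam; rewrite expr0; apply.
have [J [J0 eJ Je]] : exists J, [/\ (0 < J)%N, 2 * e^-1 <= 2 ^+ J :> R & 2 ^+ J <= 2 * (2 * e^-1)].
  by apply: exists_pow2; lra.
have [k0 k0E] := exists_rows R J.
(* As [kappa >= 2 ^- (2 J + 4)], the value [L = 2 (2 J + 4) + 6] gives [kappa ^ 2 * 2 ^ L >= 64];
   [N0 = 1024 * 4 ^ J] is the threshold of [jump_bound]. *)
pose L := (4 * J + 14)%N; pose N0 := (2 ^ (10 + 2 * J))%N.
pose lm := up_log 2 m; pose lnn := up_log 2 n.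
pose E := (2 * lm + 1)%N; pose lE := up_log 2 E; pose M := (lE + 6 * J + 43)%N.
(* [eta] lies 15 bits below the lower bound on [kappa], and [4 / eta ^ 2 = 2 ^ (4 J + 40)] is the
   number of segments used below. *)
pose kappa : R := (8 * J.+2%:R * 2 ^+ J)^-1; pose eta : R := 2^-1 ^+ (2 * J + 19).
pose d := (lnn * 3)%N.
pose b := (2 * (lm + 1) + N0 * lnn + M * (L * J.+1 * 2 ^ J * k0) * (d + 2 * (lm + 2)))%N.
have [sg [sg_pm sg4]] : exists sg : {ffun 'I_d -> bool} -> 'I_n -> R,
    (forall b i, sg b i = 1 \/ sg b i = -1) /\
    (forall i j k l, Ex (fun b => sg b i * sg b j * sg b k * sg b l) = (paired i j k l)%:R).
  by apply: exists_signs; rewrite expnM leq_exp2r // up_logP.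
have kap0 : 8 * J.+2%:R * 2 ^+ J != 0 :> R by rewrite !mulf_neq0 ?expf_neq0 ?pnatr_eq0.
have kappa_gt0 : 0 < kappa by rewrite invr_gt0 !mulr_gt0 ?exprn_gt0.
have klow := kappa_lower R J.
have h1 : 0 < eta by rewrite exprn_gt0 // invr_gt0.
have h2 : eta <= 1 by rewrite exprn_ile1 ?invr_ge0 // invf_le1 // ler1n.
have h3 : 2 ^+ 15 * eta <= kappa.
  apply: le_trans klow; rewrite /eta (_ : (2 * J + 19 = 15 + (2 * J + 4))%N); last by ring.
  by rewrite (exprD 2^-1) mulrA -exprMn divff ?pnatr_eq0 // expr1n mul1r.
have h4 : 4 <= (2 ^ (4 * J + 40))%:R * eta ^+ 2 :> R.
  rewrite natrX /eta -exprM (_ : (4 * J + 40 = 2 + (2 * J + 19) * 2)%N); last by ring.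
  by rewrite exprD -mulrA -exprMn divff ?pnatr_eq0 // expr1n mulr1 -natrX ler_nat.
have h5 : 2 ^+ 16 <= k0%:R * kappa ^+ 2 * 2 ^+ J.
  rewrite k0E (_ : J%:R + 2 = J.+2%:R); last by rewrite -(natrD _ J 2) addn2.
  rewrite (_ : 2 ^+ 22 = 2 ^+ 16 * 8 ^+ 2 :> R); last first.
    by rewrite (exprD 2 16 6); congr (_ * _); ring.
  by rewrite rows_suffice ?expf_neq0 ?pnatr_eq0.
have h6 : kappa * (8 * J.+2%:R * 2 ^+ J) = 1 by rewrite mulVf.
have h7 : 64 <= kappa ^+ 2 * 2 ^+ L.
  apply: (@le_trans _ _ ((2^-1 ^+ (2 * J + 4)) ^+ 2 * 2 ^+ L)).
    rewrite -exprM (_ : L = (2 * J + 4) * 2 + 6)%N; last by rewrite /L; ring.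
    by rewrite exprD mulrA -exprMn mulVf ?pnatr_eq0 // expr1n mul1r -natrX ler_nat.
  by rewrite ler_pM2r ?exprn_gt0 // lerXn2r // nnegrE; [rewrite exprn_ge0 // invr_ge0|exact: ltW].
have h8 : 1024 * (2 ^+ J) ^+ 2 <= N0%:R :> R.
  by rewrite natrX exprD -exprM (mulnC J) ler_pM2r ?exprn_gt0 // -natrX ler_nat.
have h9 : 2 * m%:R ^+ 2 <= 2 ^+ E :> R.
  rewrite /E addn1 [leRHS]exprS ler_pM2l // (mulnC 2 lm) exprM lerXn2r ?nnegrE ?exprn_ge0 //.
  by rewrite -natrX ler_nat up_logP.
have h10 : 2 <= e * 2 ^+ J.
  by move: eJ; rewrite ler_pdivrMr // mulrC.
have cardE : (#|enc_mem_type n {ffun 'I_d -> bool} J L M k0 N0 m| <= 2 ^ b)%N.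
  by apply: (@card_enc_le n d J L M k0 N0 m lnn lm b); rewrite // up_logP.
have Sd0 : (0 < #|{ffun 'I_d -> bool}|)%N by rewrite card_ffun card_bool expn_gt0.
have L1 : (1 < L)%N by rewrite /L addnC.
have N00 : (0 < N0)%N by rewrite expn_gt0.
have [A Arob] := @exists_robust_alg R n {ffun 'I_d -> bool} sg J L M k0 N0 m b E (2 ^ (4 * J + 40))%N
  kappa eta (ltnW n1) L1 N00 J0 Sd0 sg_pm sg4 h1 h2 h3 h4 h5 h6 h7 h8 h9
  (failure_bound R J (up_logP E (isT : 1 < 2)%N)) e h10 e_half cardE.
exists b, A; split; last first.
  (* The algorithm is built for the capped precision [e]; a run that is correct for [e] is correct
     for [eps >= e], so the success probability can only grow. *)
  move=> Om seed adv; apply: (le_trans (Arob Om seed adv)); apply: ler_sum => w _.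
  rewrite ler_wpM2l ?fdist_ge0 // /success_prob big_mkcond [leRHS]big_mkcond.
  apply: ler_sum => p _; case: ifP => [cp|_]; last first.
    by case: ifP => _ //; rewrite mulr_ge0 ?fdist_ge0 // prodr_ge0 // => t _; exact: fdist_ge0.
  rewrite ifT //; apply/forallP => t; have /forallP/(_ t) := cp.
  rewrite /approx; set y := _%:R => /andP[y1 y2]; have y0 : 0 <= y by exact: ler0n.
  rewrite (le_trans _ y1) ?(le_trans y2) // ler_wpM2r //; first by rewrite lerD2l.
  by rewrite lerB.
rewrite /space_bound -/e -/lam -/l.
have -> : (e ^+ 2)^-1 * lam * l ^+ 4 * (l + log2 lam) = e^-1 ^+ 2 * lam * l ^+ 4 * (l + log2 lam).
  by rewrite exprVn.
have lnn_le : lnn%:R <= 2 * lam.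
  have := up_log_le R (ltnW n1); rewrite -/lnn -/lam; lra.
have lm_le : lm%:R <= (K + 1) * lam.
  have := up_log_le R m0; rewrite -/lm; have : (K + 1) * lam = K * lam + lam by ring.
  move: mn; rewrite -/lam; lra.
have J_le : J%:R <= 3 * l.
  apply: (@le_trans _ _ (log2 (2 ^+ 2 * e^-1))).
    by apply: log2_ge_nat; apply: (le_trans Je); lra.
  rewrite log2M ?exprn_gt0 ?invr_gt0 // log2_expr2 -/l; lra.
have M_le : M%:R <= c * (l + log2 lam).
  have Ele : E%:R <= (2 * K + 3) * lam.
    rewrite /E natrD natrM; have : (2 * K + 3) * lam = 2 * ((K + 1) * lam) + lam by ring.
    by move: lm_le; lra.
  have E0 : 0 < E%:R :> R by rewrite ltr0n /E addn1.
  have lE_le : lE%:R <= log2 (2 * K + 3) + log2 lam + 1.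
    apply: (le_trans (up_log_le R _)); first by rewrite /E addn1.
    rewrite lerD2r -log2M; [exact: log2_le|lra|lra].
  have lKH : log2 (2 * K + 3) <= log2 (2 * K + 3) * (l + log2 lam).
    by rewrite ler_peMr //; lra.
  rewrite /M natrD (natrD _ lE) natrM /c mulrDl; lra.
have -> : b%:R = 2 * (lm%:R + 1) + 2 ^+ 10 * (2 ^+ J) ^+ 2 * lnn%:R
   + M%:R * ((4 * J%:R + 14) * (J%:R + 1) * 2 ^+ J * (2 ^+ 22 * (J%:R + 2) ^+ 2 * 2 ^+ J))
     * (3 * lnn%:R + 2 * (lm%:R + 2)) :> R.
  rewrite -k0E /b bits_natr /N0 natrX exprD (mulnC 2 J) exprM.
  by rewrite /L natrD natrM /d natrM (mulrC lnn%:R 3).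
apply: space_arith => //.
- lra.
- by rewrite ler0n.
- by rewrite ler0n.
- by rewrite exprn_ge0 //=; lra.
- by rewrite ler0n.
- by rewrite ler0n.
Qed.
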